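(* The system $\mathsf{RCA}_0^\omega+\mathsf{NCC}$ proves $\mathsf{NBI}$, while $\mathsf{Z}_2^\omega+\mathsf{NCC}$ does not prove $\mathsf{NIN}$. Here: $\mathsf{NCC}$: for every $Y^2$ and $A(n,m)\equiv(\exists f\in 2^{\mathbb{N}})(Y(f,m,n)=0)$, we have $(\forall n\in\mathbb{N})(\exists m\in\mathbb{N})A(n,m)\to(\exists g:\mathbb{N}\to\mathbb{N})(\forall n\in\mathbb{N})A(n,g(n))$. $\mathsf{NIN}$: for any $Y:[0,1]\to\mathbb{N}$ there are $x,y\in[0,1]$ with $x\neq_{\mathbb{R}}y$ and $Y(x)=Y(y)$. $\mathsf{NBI}$: for any $Y:[0,1]\to\mathbb{N}$, either there are $x,y\in[0,1]$ with $x\neq_{\mathbb{R}}y$ and $Y(x)=Y(y)$, or there is $N\in\mathbb{N}$ with $(\forall x\in[0,1])(Y(x)\neq N)$.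
   Context: Finite types: $0$ is a type (natural numbers), and if $\sigma,\tau$ are types then so is $\sigma\to\tau$; $1:=0\to 0$ and $n+1:=n\to 0$; superscripts indicate types. $\mathsf{L}_\omega$ is the many-sorted language with variables of every finite type, constants $0,1,<_0,+_0,\times_0,=_0$ (with usual meaning), typed combinators $\Pi,\Sigma$, and recursor constants $\mathbf{R}_\sigma$. For $\tau=(\tau_1\to\dots\to\tau_k\to 0)$, $x=_\tau y$ abbreviates $\forall z_1^{\tau_1}\dots z_k^{\tau_k}(xz_1\dots z_k=_0 yz_1\dots z_k)$. $\mathsf{QF\text{-}AC}^{\sigma,\tau}$ is the schema $(\forall x^\sigma)(\exists y^\tau)A(x,y)\to(\exists Y^{\sigma\to\tau})(\forall x^\sigma)A(x,Y(x))$ for quantifier-free $A$ of $\mathsf{L}_\omega$. $\mathsf{RCA}_0^\omega$ (Kohlenbach's base theory, classical logic) has the following axioms: ordered semi-ring axioms for $0,1,<_0,+_0,\times_0$; defining axioms of $\Pi,\Sigma$ (giving $\lambda$-abstraction); $\mathbf{R}_0(f,m,0)=m$ and $\mathbf{R}_0(f,m,n+1)=f(n,\mathbf{R}_0(f,m,n))$; extensionality $x=_\rho y\to\varphi(x)=_\tau\varphi(y)$ for all types $\rho,\tau$; induction for quantifier-free formulas of $\mathsf{L}_\omega$; and $\mathsf{QF\text{-}AC}^{1,0}$. Finite sequences and tuples are coded as usual. For $g^1$, $\overline{g}n$ is the (code of the) sequence $\langle g(0),\dots,g(n-1)\rangle$. $(\mathsf{S}_k^2)$ is the axiom stating the existence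 of a type 2 functional $\mathsf{S}_k^2$ with values in $\{0,1\}$ deciding the truth of $\Sigma^1_k$-formulas of second-order arithmetic (function parameters allowed), e.g. for $k=1$: $(\forall f^1)[(\exists g^1)(\forall n^0)(f(\overline{g}n)=0)\leftrightarrow \mathsf{S}_1(f)=0]$, and for general $k$ the same with the normal form of $\Sigma^1_k$-formulas. $\mathsf{Z}_2^\omega:=\bigcup_k(\mathsf{RCA}_0^\omega+(\mathsf{S}_k^2))$. Inside these theories a real is a sequence of rationals $(q_n)$ with $|q_n-q_{n+i}|<2^{-n}$ for all $n,i$; reals $x,y$ represented by $(q_n),(r_n)$ satisfy $x=_{\mathbb{R}}y$ iff $|q_n-r_n|\le 2^{-n+1}$ for all $n$. Functions on $[0,1]$ or $\mathbb{R}$ with values in $\mathbb{N}$ or $\mathbb{R}$ are objects of the corresponding finite type that map $=_{\mathbb{R}}$-equal reals to equal values. *)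

(* Defs.v *)
From Stdlib Require Import List.
Import ListNotations.

Set Implicit Arguments.
Unset Strict Implicit.
Unset Printing Implicit Defensive.

(** * Finite types and the terms of L_omega *)

Inductive ty : Type :=
| ty0 : ty
| Arr : ty -> ty -> ty.

Declare Scope lw_scope.
Delimit Scope lw_scope with lw.
Local Open Scope lw_scope.

Notation "s --> t" := (Arr s t) (at level 55, right associativity) : lw_scope.

Definition ty1 : ty := ty0 --> ty0.
Definition ty2 : ty := ty1 --> ty0.

(** Terms and formulas are intrinsically typed, with de Bruijn variables: the
    head of a context is the type of the innermost bound variable. *)
Definition ctx := list ty.

Inductive var : ctx -> ty -> Type :=
| vz G s : var (s :: G) s
| vs G s t : var G t -> var (s :: G) t.

Arguments vz {G s}.
Arguments vs {G s t} v.

Inductive cst : ty -> Type :=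
| Zero : cst ty0
| One : cst ty0
| Plus : cst (ty0 --> ty0 --> ty0)
| Times : cst (ty0 --> ty0 --> ty0)
| Pi r s : cst (r --> s --> r)
| Sigma r s t : cst ((r --> s --> t) --> (r --> s) --> r --> t)
| Rec s : cst ((ty0 --> s --> s) --> s --> ty0 --> s).

Inductive tm (G : ctx) : ty -> Type :=
| Var t : var G t -> tm G t
| Cst t : cst t -> tm G t
| App s t : tm G (s --> t) -> tm G s -> tm G t.

Arguments Var {G t} v.
Arguments Cst {G t} c.
Arguments App {G s t} a b.

Notation "a @ b" := (App a b) (at level 38, left associativity) : lw_scope.
Notation x0 := (Var vz).
Notation x1 := (Var (vs vz)).
Notation x2 := (Var (vs (vs vz))).
Notation x3 := (Var (vs (vs (vs vz)))).
Notation x4 := (Var (vs (vs (vs (vs vz))))).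
Notation x5 := (Var (vs (vs (vs (vs (vs vz)))))).

Definition zero {G} : tm G ty0 := Cst Zero.
Definition one {G} : tm G ty0 := Cst One.
Definition plus {G} (a b : tm G ty0) : tm G ty0 := Cst Plus @ a @ b.
Definition times {G} (a b : tm G ty0) : tm G ty0 := Cst Times @ a @ b.
Definition succ {G} (a : tm G ty0) : tm G ty0 := plus a one.

Notation "a +' b" := (plus a b) (at level 50, left associativity) : lw_scope.
Notation "a *' b" := (times a b) (at level 40, left associativity) : lw_scope.

(** * Formulas; the only prime formulas are (in)equalities of type 0 *)

Inductive fm (G : ctx) : Type :=
| Eq : tm G ty0 -> tm G ty0 -> fm G
| Lt : tm G ty0 -> tm G ty0 -> fm G
| Bot : fm G
| Imp : fm G -> fm G -> fm G
| And : fm G -> fm G -> fm G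
| Or : fm G -> fm G -> fm G
| All s : fm (s :: G) -> fm G
| Ex s : fm (s :: G) -> fm G.

Arguments Bot {G}.
Arguments All {G} s A.
Arguments Ex {G} s A.

Definition Not {G} (A : fm G) : fm G := Imp A Bot.
Definition Iff {G} (A B : fm G) : fm G := And (Imp A B) (Imp B A).
Definition Le {G} (a b : tm G ty0) : fm G := Or (Lt a b) (Eq a b).

Notation "a == b" := (Eq a b) (at level 70) : lw_scope.
Notation "a <' b" := (Lt a b) (at level 70) : lw_scope.
Notation "A ==> B" := (Imp A B) (at level 85, right associativity) : lw_scope.
Notation "A &' B" := (And A B) (at level 78, right associativity) : lw_scope.
Notation "A |' B" := (Or A B) (at level 79, right associativity) : lw_scope.

Fixpoint qf {G} (A : fm G) : Prop :=
  match A with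
  | Eq _ _ | Lt _ _ | Bot => True
  | Imp A B | And A B | Or A B => qf A /\ qf B
  | All _ _ | Ex _ _ => False
  end.

(** * Renaming and substitution *)

Definition scons {P : ty -> Type} {G s} (a : P s) (f : forall t, var G t -> P t)
    t (v : var (s :: G) t) : P t :=
  match v in var (s0 :: G0) t0
    return P s0 -> (forall u, var G0 u -> P u) -> P t0
  with
  | vz => fun a _ => a
  | vs w => fun _ f => f _ w
  end a f.

Definition ren (G D : ctx) := forall t, var G t -> var D t.
Definition sub (G D : ctx) := forall t, var G t -> tm D t.

Fixpoint ren_tm {G D} (r : ren G D) t (a : tm G t) : tm D t :=
  match a with
  | Var v => Var (r _ v)
  | Cst c => Cst c
  | App a b => ren_tm r a @ ren_tm r b
  end.

Definition shift {G s} : ren G (s :: G) := fun _ v => vs v.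
Definition wk {G s t} (a : tm G t) : tm (s :: G) t := ren_tm shift a.

Definition up_ren {G D} s (r : ren G D) : ren (s :: G) (s :: D) :=
  scons (P := var (s :: D)) vz (fun _ v => vs (r _ v)).

Fixpoint ren_fm {G D} (r : ren G D) (A : fm G) : fm D :=
  match A with
  | Eq a b => Eq (ren_tm r a) (ren_tm r b)
  | Lt a b => Lt (ren_tm r a) (ren_tm r b)
  | Bot => Bot
  | Imp A B => Imp (ren_fm r A) (ren_fm r B)
  | And A B => And (ren_fm r A) (ren_fm r B)
  | Or A B => Or (ren_fm r A) (ren_fm r B)
  | All s A => All s (ren_fm (up_ren r) A)
  | Ex s A => Ex s (ren_fm (up_ren r) A)
  end.

Definition wk_fm {G s} (A : fm G) : fm (s :: G) := ren_fm shift A.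

Fixpoint sub_tm {G D} (r : sub G D) t (a : tm G t) : tm D t :=
  match a with
  | Var v => r _ v
  | Cst c => Cst c
  | App a b => sub_tm r a @ sub_tm r b
  end.

Definition up_sub {G D} s (r : sub G D) : sub (s :: G) (s :: D) :=
  scons (P := tm (s :: D)) x0 (fun _ v => wk (r _ v)).

Fixpoint sub_fm {G D} (r : sub G D) (A : fm G) : fm D :=
  match A with
  | Eq a b => Eq (sub_tm r a) (sub_tm r b)
  | Lt a b => Lt (sub_tm r a) (sub_tm r b)
  | Bot => Bot
  | Imp A B => Imp (sub_fm r A) (sub_fm r B)
  | And A B => And (sub_fm r A) (sub_fm r B)
  | Or A B => Or (sub_fm r A) (sub_fm r B)
  | All s A => All s (sub_fm (up_sub r) A)
  | Ex s A => Ex s (sub_fm (up_sub r) A)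
  end.

Definition inst {G s} (A : fm (s :: G)) (a : tm G s) : fm G :=
  sub_fm (scons (P := tm G) a (fun _ v => Var v)) A.

Fixpoint closure {G} : fm G -> fm [] :=
  match G with
  | [] => fun A => A
  | s :: G => fun A => closure (All s A)
  end.

(** * Many-sorted classical natural deduction *)

Definition theory := fm [] -> Prop.

Inductive nd (T : theory) : forall G, list (fm G) -> fm G -> Prop :=
| nd_ax G (H : list (fm G)) (A : fm []) (r : ren [] G) :
    T A -> nd T H (ren_fm r A)
| nd_hyp G (H : list (fm G)) A : In A H -> nd T H A
| nd_raa G (H : list (fm G)) A : nd T (Not A :: H) Bot -> nd T H A
| nd_impI G (H : list (fm G)) A B : nd T (A :: H) B -> nd T H (A ==> B)
| nd_impE G (H : list (fm G)) A B : nd T H (A ==> B) -> nd T H A -> nd T H B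
| nd_andI G (H : list (fm G)) A B : nd T H A -> nd T H B -> nd T H (A &' B)
| nd_andE1 G (H : list (fm G)) A B : nd T H (A &' B) -> nd T H A
| nd_andE2 G (H : list (fm G)) A B : nd T H (A &' B) -> nd T H B
| nd_orI1 G (H : list (fm G)) A B : nd T H A -> nd T H (A |' B)
| nd_orI2 G (H : list (fm G)) A B : nd T H B -> nd T H (A |' B)
| nd_orE G (H : list (fm G)) A B C :
    nd T H (A |' B) -> nd T (A :: H) C -> nd T (B :: H) C -> nd T H C
| nd_allI G (H : list (fm G)) s (A : fm (s :: G)) :
    nd T (map wk_fm H) A -> nd T H (All s A)
| nd_allE G (H : list (fm G)) s (A : fm (s :: G)) (a : tm G s) :
    nd T H (All s A) -> nd T H (inst A a)
| nd_exI G (H : list (fm G)) s (A : fm (s :: G)) (a : tm G s) :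
    nd T H (inst A a) -> nd T H (Ex s A)
| nd_exE G (H : list (fm G)) s (A : fm (s :: G)) C :
    nd T H (Ex s A) -> nd T (A :: map wk_fm H) (wk_fm C) -> nd T H C.

Definition proves (T : theory) (A : fm []) : Prop := nd T (G := []) [] A.

Definition extend (T : theory) (A : fm []) : theory := fun B => T B \/ B = A.

(** * The base theory RCA_0^omega *)

Fixpoint eq_at {G} t : tm G t -> tm G t -> fm G :=
  match t with
  | ty0 => fun a b => a == b
  | s --> t => fun a b => All s (eq_at (wk a @ x0) (wk b @ x0))
  end.

Definition arith_axioms : list (fm [ty0; ty0; ty0]) :=
  [ (* =_0 *)
    x0 == x0;
    x0 == x1 ==> x1 == x0;
    x0 == x1 ==> x1 == x2 ==> x0 == x2;
    x0 == x1 ==> x0 <' x2 ==> x1 <' x2;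
    x0 == x1 ==> x2 <' x0 ==> x2 <' x1;
    (* commutative semi-ring *)
    (x0 +' x1) +' x2 == x0 +' (x1 +' x2);
    x0 +' x1 == x1 +' x0;
    x0 +' zero == x0;
    (x0 *' x1) *' x2 == x0 *' (x1 *' x2);
    x0 *' x1 == x1 *' x0;
    x0 *' one == x0;
    x0 *' zero == zero;
    x0 *' (x1 +' x2) == x0 *' x1 +' x0 *' x2;
    (* strict linear order, compatible with the operations *)
    Not (x0 <' x0);
    x0 <' x1 ==> x1 <' x2 ==> x0 <' x2;
    x0 <' x1 |' x0 == x1 |' x1 <' x0;
    zero <' one;
    x0 <' x1 ==> x0 +' x2 <' x1 +' x2;
    zero <' x2 ==> x0 <' x1 ==> x0 *' x2 <' x1 *' x2 ].

Inductive RCA0w : theory :=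
| ax_arith A : In A arith_axioms -> RCA0w (closure A)
| ax_Pi r s :
    RCA0w (All r (All s (eq_at (Cst (Pi r s) @ x1 @ x0) x1)))
| ax_Sigma r s t :
    RCA0w (All (r --> s --> t) (All (r --> s) (All r
      (eq_at (Cst (Sigma r s t) @ x2 @ x1 @ x0) (x2 @ x0 @ (x1 @ x0))))))
| ax_Rec0_zero :
    RCA0w (All (ty0 --> ty0 --> ty0) (All ty0 (Cst (Rec ty0) @ x1 @ x0 @ zero == x0)))
| ax_Rec0_succ :
    RCA0w (All (ty0 --> ty0 --> ty0) (All ty0 (All ty0
      (Cst (Rec ty0) @ x2 @ x1 @ succ x0
         == x2 @ x0 @ (Cst (Rec ty0) @ x2 @ x1 @ x0)))))
| ax_ext r t :
    RCA0w (All (r --> t) (All r (All r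
      (eq_at x1 x0 ==> eq_at (x2 @ x1) (x2 @ x0)))))
| ax_ind G (A : fm (ty0 :: G)) : qf A ->
    RCA0w (closure
      (inst A zero
       ==> All ty0 (A ==> sub_fm (scons (P := tm (ty0 :: G)) (succ x0)
                                 (fun _ v => Var (vs v))) A)
       ==> All ty0 A))
| ax_qfac10 G (A : fm (ty0 :: ty1 :: G)) : qf A ->
    (* in A the variable x1 is x and x0 is y; in the conclusion x1 is Y and
       x0 is x *)
    RCA0w (closure
      (All ty1 (Ex ty0 A)
       ==> Ex (ty1 --> ty0) (All ty1
             (sub_fm (scons (P := tm (ty1 :: ty2 :: G)) (x1 @ x0)
                       (scons (P := tm (ty1 :: ty2 :: G)) x0
                         (fun _ v => Var (vs (vs v))))) A)))).

(** * Coding *)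

Definition comb_I {G s} : tm G (s --> s) :=
  Cst (Sigma s (s --> s) s) @ Cst (Pi s (s --> s)) @ Cst (Pi s s).

(** Lambda abstraction of [x0] by the combinators. *)
Fixpoint lam {G s t} (a : tm (s :: G) t) : tm G (s --> t) :=
  match a with
  | Var v => scons (P := fun t => tm G (s --> t)) comb_I
               (fun t v => Cst (Pi t s) @ Var v) v
  | Cst c => Cst (Pi _ s) @ Cst c
  | App a b => Cst (Sigma _ _ _) @ lam a @ lam b
  end.

Definition rec0 {G} (f : tm G (ty0 --> ty0 --> ty0)) (m n : tm G ty0) : tm G ty0 :=
  Cst (Rec ty0) @ f @ m @ n.

Definition pow2 {G} (n : tm G ty0) : tm G ty0 := rec0 (lam (lam (x0 +' x0))) one n.

(** The injective pairing (a + b)^2 + a. *)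
Definition pairN {G} (a b : tm G ty0) : tm G ty0 := (a +' b) *' (a +' b) +' a.

Fixpoint tuple {G} (l : list (tm G ty0)) : tm G ty0 :=
  match l with
  | [] => zero
  | [a] => a
  | a :: l => pairN a (tuple l)
  end.

(** The code of <g(0),...,g(n-1)>: the empty sequence has code 0, and s
    followed by a has code pairN s a + 1. *)
Definition bar {G} (g : tm G ty1) (n : tm G ty0) : tm G ty0 :=
  rec0 (lam (lam (succ (pairN x0 (wk (wk g) @ x1))))) zero n.

(** The sequence a, f(0), f(1), ... *)
Definition cons1 {G} (a : tm G ty0) (f : tm G ty1) : tm G ty1 :=
  lam (rec0 (lam (lam (wk (wk (wk f)) @ x1))) (wk a) x0).

(** The tuple (f,m,n) coded as the sequence m, n, f(0), f(1), ... *)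
Definition code_fmn {G} (f : tm G ty1) (m n : tm G ty0) : tm G ty1 :=
  cons1 m (cons1 n f).

(** * The axioms (S_k^2) and the system Z_2^omega *)

(** The formula with k alternating type 1 quantifiers
      (E g_1)(A g_2)...(Q g_k)(Q' n) f(<bar g_1 n, ..., bar g_k n>) = 0,
    where Q' is the dual of Q. The flag [b] tells whether the next quantifier
    is existential and [gs] lists the functions already quantified. *)
Fixpoint normal_form (k : nat) (b : bool) {G} (f : tm G ty1)
    (gs : list (tm G ty1)) : fm G :=
  let Q s (A : fm (s :: G)) := if b then Ex s A else All s A in
  match k with
  | 0 => Q ty0 (wk f @ tuple (map (fun g => bar (wk g) x0) gs) == zero)
  | S k => Q ty1 (normal_form k (negb b) (wk f) (map wk gs ++ [x0]))
  end.

Definition Sigma1 (k : nat) {G} (f : tm G ty1) : fm G := normal_form k true f [].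

Definition S_ax (k : nat) : fm [] :=
  Ex ty2 (All ty1
    ((x1 @ x0 == zero |' x1 @ x0 == one)
     &' Iff (Sigma1 k x0) (x1 @ x0 == zero))).

Definition Z2w : theory := fun A => exists k, 1 <= k /\ extend RCA0w (S_ax k) A.

(** * Real numbers *)

(** The rational (a - b) / (c + 1); each rational has many codes. *)
Definition rat {G} (a b c : tm G ty0) : tm G ty0 := pairN (pairN a b) c.

Section Compare.
Variable rel : forall G, tm G ty0 -> tm G ty0 -> fm G.

(** [q] and [r] code rationals with q rel r + d / p, for p > 0 and [rel]
    either [Lt] or [Le]. *)
Definition cmpQ {G} (q r d p : tm G ty0) : fm G :=
  let w t := wk (wk (wk (wk (wk (wk t))))) in
  let a := x5 in let b := x4 in let c := x3 in
  let a' := x2 in let b' := x1 in let c' := x0 in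
  Ex ty0 (Ex ty0 (Ex ty0 (Ex ty0 (Ex ty0 (Ex ty0
    (w q == rat a b c &' w r == rat a' b' c' &'
     rel (w p *' (a *' succ c' +' b' *' succ c))
         (w p *' (b *' succ c' +' a' *' succ c)
          +' w d *' (succ c *' succ c')))))))).

End Compare.

Definition two {G} : tm G ty0 := succ one.

Definition is_real {G} (x : tm G ty1) : fm G :=
  let q := wk (wk x) @ x1 in
  let r := wk (wk x) @ (x1 +' x0) in
  All ty0 (All ty0 (cmpQ (@Lt) q r one (pow2 x1) &' cmpQ (@Lt) r q one (pow2 x1))).

Definition leR {G} (x y : tm G ty1) : fm G :=
  All ty0 (cmpQ (@Le) (wk x @ x0) (wk y @ x0) two (pow2 x0)).

(** |q_n - r_n| <= 2^{-n+1} for all n *)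
Definition eqR {G} (x y : tm G ty1) : fm G :=
  All ty0 (cmpQ (@Le) (wk x @ x0) (wk y @ x0) two (pow2 x0)
         &' cmpQ (@Le) (wk y @ x0) (wk x @ x0) two (pow2 x0)).

Definition zeroR {G} : tm G ty1 := lam (rat zero zero zero).
Definition oneR {G} : tm G ty1 := lam (rat one zero zero).

Definition in01 {G} (x : tm G ty1) : fm G :=
  is_real x &' leR zeroR x &' leR x oneR.

(** Y maps =_R-equal elements of [0,1] to equal numbers. *)
Definition fun01 {G} (Y : tm G ty2) : fm G :=
  All ty1 (All ty1 (in01 x1 ==> in01 x0 ==> eqR x1 x0
    ==> wk (wk Y) @ x1 == wk (wk Y) @ x0)).

(** * The principles NCC, NIN and NBI *)

Definition cantor {G} (f : tm G ty1) : fm G :=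
  All ty0 (wk f @ x0 == zero |' wk f @ x0 == one).

Definition NCC_matrix {G} (Y : tm G ty2) (n m : tm G ty0) : fm G :=
  Ex ty1 (cantor x0 &' wk Y @ code_fmn x0 (wk m) (wk n) == zero).

Definition NCC : fm [] :=
  All ty2
    (All ty0 (Ex ty0 (NCC_matrix x2 x1 x0))
     ==> Ex ty1 (All ty0 (NCC_matrix x2 x0 (x1 @ x0)))).

Definition not_injective {G} (Y : tm G ty2) : fm G :=
  Ex ty1 (Ex ty1 (in01 x1 &' in01 x0 &' Not (eqR x1 x0)
    &' wk (wk Y) @ x1 == wk (wk Y) @ x0)).

Definition NIN : fm [] := All ty2 (fun01 x0 ==> not_injective x0).

Definition NBI : fm [] :=
  All ty2 (fun01 x0 ==>
    (not_injective x0
     |' Ex ty0 (All ty1 (in01 x0 ==> Not (x2 @ x0 == x1))))).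

(* Main.v *)
(** The first half is Cantor's diagonal argument.  Every f in Cantor space codes,
    through the digits f(2i) + f(2i+1) in base 2, a real x_f of [0,1], and every real
    of [0,1] is of this form.  If Y is injective and onto on [0,1], then NCC, applied
    to "some f satisfies Y(x_f) = n and m is the numerator of the approximation of x_f
    by 2n+3 digits", yields a function approximating the real x_n with Y(x_n) = n so
    well that a real different from all x_n can be computed from it.  By completeness
    this argument may be carried out in arbitrary models; inequalities are verified in
    the field of fractions of the (possibly nonstandard) numbers of the model.

    For the second half, force with partial injections s from the reals to the natural
    numbers whose range is coinfinite, together with a finite set of values that must
    stay outside the range.  Reserving one more value at each step, the union of a
    decreasing sequence of conditions is again a condition (fusion).  Hence every name
    of a sequence of numbers is densely equal to a ground sequence, so that second-order
    formulas are absolute, the functionals S_k survive, and NCC holds because one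
    condition decides witnesses for all n; but the generic function is an injection of
    the reals into the natural numbers. *)

From HB Require Import structures.
From mathcomp Require all_boot all_order all_algebra boolp ring lra.
From mathcomp Require Import ssreflect.
From Stdlib Require Import Classical ClassicalEpsilon ProofIrrelevance
  FunctionalExtensionality PropExtensionality Ring.
From Stdlib Require List Cantor PeanoNat Lia Eqdep.
Require Defs.

Set Implicit Arguments.
Unset Strict Implicit.
Unset Printing Implicit Defensive.
Unset Asymmetric Patterns.

(** NCC chooses numbers, not sequences: for each n some f is known to exist, but no function n -> f
    is available. The diagonal may therefore use only one number attached to n, a finite
    approximation of x_n. Digits 0, 1, 2 are forced by the lack of a functional comparing reals:
    overlapping digit intervals let a rational approximation decide the next digit, and a digit is
    the sum of two threshold tests, hence of two bits, which suits a quantifier over Cantor space.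
    Since models have only quantifier-free induction, every estimate is phrased as a comparison of
    sequences of fractions given by elements of the model, never through limits. On the forcing side
    no generic model is built: forcing is sound for natural deduction, and no condition forces NIN.
    Extensionality at all types shapes the names: they are compared by a hereditary relation, and
    only names related to themselves count as objects. The union of a fusion sequence cannot keep
    the reserved values of all stages, so whatever fusion preserves must be settled by the partial
    injection alone. *)

Module Fractions.

(** * Ordered semirings with subtraction and their fields of fractions *)

Record osr := Osr {
  ocar :> Type;
  o0 : ocar;
  o1 : ocar;
  oadd : ocar -> ocar -> ocar;
  omul : ocar -> ocar -> ocar;
  olt : ocar -> ocar -> Prop;
  oaddA : forall a b c, oadd (oadd a b) c = oadd a (oadd b c);
  oaddC : forall a b, oadd a b = oadd b a;
  oadd0 : forall a, oadd a o0 = a;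
  omulA : forall a b c, omul (omul a b) c = omul a (omul b c);
  omulC : forall a b, omul a b = omul b a;
  omul1 : forall a, omul a o1 = a;
  omul0 : forall a, omul a o0 = o0;
  omulD : forall a b c, omul a (oadd b c) = oadd (omul a b) (omul a c);
  olt_irr : forall a, ~ olt a a;
  olt_trans : forall a b c, olt a b -> olt b c -> olt a c;
  olt_tri : forall a b, olt a b \/ a = b \/ olt b a;
  olt01 : olt o0 o1;
  olt_add : forall a b c, olt a b -> olt (oadd a c) (oadd b c);
  olt_mul : forall a b c, olt o0 c -> olt a b -> olt (omul a c) (omul b c);
  oge0 : forall a, o0 = a \/ olt o0 a;
  osub : forall a b, olt a b -> exists d, b = oadd (oadd a d) o1 }.

Section Semiring.
Variable N : osr.
Notation "0" := (@o0 N).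
Notation "1" := (@o1 N).
Infix "+" := (@oadd N).
Infix "*" := (@omul N).
Infix "<" := (@olt N).
Definition ole (a b : N) := a < b \/ a = b.
Infix "<=" := ole.

Lemma osr_semiring : semi_ring_theory 0 1 (@oadd N) (@omul N) eq.
Proof.
split=> [a|a b|a b c|a|a|a b|a b c|a b c].
- by rewrite oaddC oadd0.
- exact: oaddC.
- by rewrite oaddA.
- by rewrite omulC omul1.
- by rewrite omulC omul0.
- exact: omulC.
- by rewrite omulA.
- by rewrite omulC omulD (omulC c a) (omulC c b).
Qed.
Add Ring osr_ring : osr_semiring.

Lemma ole_lt_trans a b c : a <= b -> b < c -> a < c.
Proof. by move=> [H|->] //; exact: olt_trans. Qed.

Lemma olt_le_trans a b c : a < b -> b <= c -> a < c.
Proof. by move=> + [H|<-] //; move/olt_trans; apply. Qed.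

Lemma ole_trans a b c : a <= b -> b <= c -> a <= c.
Proof. by move=> [H|->] // H'; left; apply: olt_le_trans H H'. Qed.

Lemma ole_refl a : a <= a. Proof. by right. Qed.

Lemma ole_anti a b : a <= b -> b <= a -> a = b.
Proof. by move=> [H|//] [/(olt_trans H)/olt_irr //|->]. Qed.

Lemma olt_nle a b : ~ a < b <-> b <= a.
Proof.
split=> [H|H /(ole_lt_trans H)/olt_irr //].
by case: (olt_tri a b) => [//|[->|]]; [right|left].
Qed.

Lemma ole_nlt a b : ~ a <= b <-> b < a.
Proof.
split=> [H|H /(fun H' => ole_lt_trans H' H)/olt_irr //].
by case: (olt_tri a b) => [?|[?|//]]; case: H; [left|right].
Qed.

Lemma ole_total a b : a <= b \/ b <= a.
Proof. by case: (olt_tri a b) => [?|[->|?]]; [left; left|left; right|right; left]. Qed.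

Lemma ole_add a b c d : a <= b -> c <= d -> a + c <= b + d.
Proof.
have H x y z : x <= y -> x + z <= y + z by move=> [/olt_add ?|->]; [left|right].
by move=> ab cd; apply: ole_trans (H _ _ _ ab) _; rewrite !(oaddC b); exact: H.
Qed.

Lemma ole_addr a b c : a + c <= b + c <-> a <= b.
Proof.
split=> [H|H]; last exact: ole_add H (ole_refl c).
apply/olt_nle => /(@olt_add _ _ _ c) H'; exact: olt_irr (ole_lt_trans H H').
Qed.

Lemma osucc_gt0 c : 0 < c + 1.
Proof.
case: (oge0 c) => [<-|H]; first by rewrite oaddC oadd0; exact: olt01.
by apply: olt_trans H _; rewrite -{1}(oadd0 c) !(oaddC c); apply/olt_add/olt01.
Qed.

Lemma ole_mul a b c : a <= b -> a * c <= b * c.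
Proof.
case: (oge0 c) => [<- _|c0 [H|->]]; first by rewrite !omul0; right.
  by left; exact: olt_mul.
by right.
Qed.

Lemma ole_mulS a b c : a * (c + 1) <= b * (c + 1) <-> a <= b.
Proof.
split=> [H|]; last exact: ole_mul.
apply/olt_nle => /(olt_mul (osucc_gt0 c)) H'; exact: olt_irr (ole_lt_trans H H').
Qed.

Lemma ole0 a : 0 <= a.
Proof. by case: (oge0 a); [right|left]. Qed.

(** The triple (a, b, c) stands for the fraction (a - b) / (c + 1). *)
Record trip := Trip { tpos : N; tneg : N; tden : N }.

Definition cross (x y : trip) : N := tpos x * (tden y + 1) + tneg y * (tden x + 1).
Definition tle (x y : trip) := cross x y <= cross y x.
Definition teq (x y : trip) := cross x y = cross y x.

Lemma teqP x y : teq x y <-> tle x y /\ tle y x.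
Proof.
split=> [E|[]]; last exact: ole_anti.
by rewrite /tle E; split; right.
Qed.

Lemma tle_trans x y z : tle x y -> tle y z -> tle x z.
Proof.
case: x y z => a b c [a' b' c'] [a'' b'' c'']; rewrite /tle /cross /=.
move=> /(@ole_mul _ _ (c'' + 1)) H1 /(@ole_mul _ _ (c + 1)) H2.
apply/(ole_mulS _ _ c').
apply/(ole_addr _ _ (b' * (c + 1) * (c'' + 1) + a' * (c + 1) * (c'' + 1))).
by move: (ole_add H1 H2); congr (_ <= _); ring.
Qed.

Lemma teq_sym x y : teq x y -> teq y x. Proof. by move=> E; exact: eq_sym. Qed.
Lemma teq_trans x y z : teq x y -> teq y z -> teq x z.
Proof.
by move=> /teqP[a b] /teqP[c d]; apply/teqP; split; [exact: tle_trans a c|exact: tle_trans d b].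
Qed.

(** The last component is (c + 1)(c' + 1) - 1, so that the true denominators multiply and never
    vanish. *)
Definition tadd x y := Trip (tpos x * (tden y + 1) + tpos y * (tden x + 1))
  (tneg x * (tden y + 1) + tneg y * (tden x + 1)) (tden x * tden y + tden x + tden y).
Definition tmul x y := Trip (tpos x * tpos y + tneg x * tneg y)
  (tpos x * tneg y + tneg x * tpos y) (tden x * tden y + tden x + tden y).
Definition topp x := Trip (tneg x) (tpos x) (tden x).
Definition tnat a := Trip a 0 0.

Lemma tadd_eq x x' y : teq x x' -> teq (tadd x y) (tadd x' y).
Proof.
case: x x' y => a b c [a' b' c'] [p q r]; rewrite /teq /cross /= => E.
have -> : (a * (r + 1) + p * (c + 1)) * (c' * r + c' + r + 1)
   + (b' * (r + 1) + q * (c' + 1)) * (c * r + c + r + 1)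
  = (r + 1) * (r + 1) * (a * (c' + 1) + b' * (c + 1))
    + (r + 1) * (c + 1) * (c' + 1) * (p + q) by ring.
by rewrite E; ring.
Qed.

Lemma taddC x y : teq (tadd x y) (tadd y x).
Proof. by rewrite /teq /cross /=; ring. Qed.

Lemma taddA x y z : teq (tadd x (tadd y z)) (tadd (tadd x y) z).
Proof. by rewrite /teq /cross /=; ring. Qed.

Lemma tadd0 x : teq (tadd (tnat 0) x) x.
Proof. by rewrite /teq /cross /=; ring. Qed.

Lemma taddN x : teq (tadd (topp x) x) (tnat 0).
Proof. by rewrite /teq /cross /=; ring. Qed.

Lemma topp_eq x y : teq x y -> teq (topp x) (topp y).
Proof.
by rewrite /teq /cross /= => E; rewrite oaddC -E oaddC.
Qed.

Lemma tmul_eq x x' y : teq x x' -> teq (tmul x y) (tmul x' y).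
Proof.
case: x x' y => a b c [a' b' c'] [p q r]; rewrite /teq /cross /= => E.
(* Without negatives, both sides of the hypothesis [E] occur: one as the coefficient of p, the other
   as that of q. *)
have -> : (a * p + b * q) * (c' * r + c' + r + 1)
   + (a' * q + b' * p) * (c * r + c + r + 1)
  = (r + 1) * (p * (a * (c' + 1) + b' * (c + 1)) + q * (a' * (c + 1) + b * (c' + 1))) by ring.
by rewrite E -{2}E; ring.
Qed.

Lemma tmulC x y : teq (tmul x y) (tmul y x).
Proof. by rewrite /teq /cross /=; ring. Qed.

Lemma tmulA x y z : teq (tmul x (tmul y z)) (tmul (tmul x y) z).
Proof. by rewrite /teq /cross /=; ring. Qed.

Lemma tmul1 x : teq (tmul (tnat 1) x) x.
Proof. by rewrite /teq /cross /=; ring. Qed.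

Lemma tmulD x y z : teq (tmul (tadd x y) z) (tadd (tmul x z) (tmul y z)).
Proof. by rewrite /teq /cross /=; ring. Qed.

Lemma tinv_exists x : ~ teq x (tnat 0) -> exists y, teq (tmul y x) (tnat 1).
Proof.
case: x => a b c; rewrite /teq /cross /= => H.
case: (olt_tri a b) => [/osub[d E]|[E|/osub[d E]]].
- by exists (Trip 0 (c + 1) d); rewrite /cross /= E; ring.
- by case: H; rewrite E; ring.
- by exists (Trip (c + 1) 0 d); rewrite /cross /= E; ring.
Qed.

Lemma tle0 x : tle (tnat 0) x <-> tneg x <= tpos x.
Proof.
rewrite /tle /cross /=.
have -> : 0 * (tden x + 1) + tneg x * (0 + 1) = tneg x by ring.
by have -> : tpos x * (0 + 1) + 0 * (tden x + 1) = tpos x by ring.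
Qed.

Lemma tle0_add x y : tle (tnat 0) x -> tle (tnat 0) y -> tle (tnat 0) (tadd x y).
Proof. by rewrite !tle0 /= => Hx Hy; apply: ole_add; apply: ole_mul. Qed.

Lemma tle0_mul x y : tle (tnat 0) x -> tle (tnat 0) y -> tle (tnat 0) (tmul x y).
Proof.
rewrite !tle0 /= => -[/osub[d ->]|<-]; last by move=> _; right; ring.
move=> /(@ole_mul _ _ (d + 1)) H.
have -> : (tneg x + d + 1) * tneg y + tneg x * tpos y = tneg y * (d + 1) + tneg x * (tneg y + tpos y) by ring.
have -> : (tneg x + d + 1) * tpos y + tneg x * tneg y = tpos y * (d + 1) + tneg x * (tneg y + tpos y) by ring.
exact/ole_addr.
Qed.

Lemma tsub_ge0 x y : tle (tnat 0) (tadd y (topp x)) <-> tle x y.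
Proof.
rewrite tle0 /tle /cross /=.
by rewrite [tneg y * _ + _]oaddC; split; congr (_ <= _); ring.
Qed.

Lemma ttotal x y : tle x y \/ tle y x.
Proof. exact: ole_total. Qed.

Lemma tone_neq0 : ~ teq (tnat 1) (tnat 0).
Proof.
rewrite /teq /cross /=.
have -> : 1 * (0 + 1) + 0 * (0 + 1) = 1 by ring.
have -> : 0 * (0 + 1) + 0 * (0 + 1) = 0 by ring.
by move=> E; apply: (@olt_irr N 0); rewrite -{2}E; exact: olt01.
Qed.

Lemma tnat_le a b : tle (tnat a) (tnat b) <-> a <= b.
Proof.
rewrite /tle /cross /=.
have -> : a * (0 + 1) + 0 * (0 + 1) = a by ring.
by have -> : b * (0 + 1) + 0 * (0 + 1) = b by ring.
Qed.

Lemma tle_bound a b c : tle (Trip a b c) (tnat a).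
Proof.
rewrite /tle /cross /=.
have -> : a * (0 + 1) + 0 * (c + 1) = 0 + a by ring.
have -> : a * (c + 1) + b * (0 + 1) = (a * c + b) + a by ring.
exact/ole_addr/ole0.
Qed.

Lemma tfrac_eq a b c :
  teq (tadd (tmul (Trip a b c) (tadd (tnat c) (tnat 1))) (tnat b)) (tnat a).
Proof. by rewrite /teq /cross /=; ring. Qed.

Lemma tnatD a b : teq (tnat (a + b)) (tadd (tnat a) (tnat b)).
Proof. by rewrite /teq /cross /=; ring. Qed.

Lemma tnatM a b : teq (tnat (a * b)) (tmul (tnat a) (tnat b)).
Proof. by rewrite /teq /cross /=; ring. Qed.

(** Equivalent triples satisfy the same predicate [teq x], so [epsilon] picks the same
    representative for both; the quotient is the type of chosen representatives. *)
Definition tcanon (x : trip) : trip := epsilon (inhabits x) (teq x).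

Lemma tcanon_eq x : teq x (tcanon x).
Proof. by apply: (epsilon_spec (inhabits x) (teq x)); exists x. Qed.

Lemma tcanonE x y : teq x y -> tcanon x = tcanon y.
Proof.
move=> xy; rewrite /tcanon (_ : inhabits x = inhabits y); last exact: proof_irrelevance.
congr (epsilon _ _); apply: functional_extensionality => z; apply: propositional_extensionality.
by split; [apply: teq_trans; apply: teq_sym|apply: teq_trans].
Qed.

Record ofrac := OFrac { ftrip : trip; ftripP : tcanon ftrip = ftrip }.

Definition mkf (x : trip) : ofrac := OFrac (tcanonE (teq_sym (tcanon_eq x))).

Lemma mkf_eq x y : mkf x = mkf y <-> teq x y.
Proof.
split=> [[E]|/tcanonE E].
  by apply: teq_trans (tcanon_eq x) _; rewrite E; apply/teq_sym/tcanon_eq.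
rewrite /mkf; move: (tcanonE _) (tcanonE _); rewrite E => p q.
by rewrite (proof_irrelevance _ p q).
Qed.

Lemma mkfK u : mkf (ftrip u) = u.
Proof.
case: u => x p; rewrite /mkf /=; move: (tcanonE _); rewrite p => q.
by rewrite (proof_irrelevance _ p q).
Qed.

Lemma ftrip_mkf x : teq (ftrip (mkf x)) x.
Proof. exact/teq_sym/tcanon_eq. Qed.

Definition fadd u v := mkf (tadd (ftrip u) (ftrip v)).
Definition fmul u v := mkf (tmul (ftrip u) (ftrip v)).
Definition fopp u := mkf (topp (ftrip u)).
Definition fle u v := tle (ftrip u) (ftrip v).

Lemma fadd_mk x y : fadd (mkf x) (mkf y) = mkf (tadd x y).
Proof.
apply/mkf_eq; apply: teq_trans (tadd_eq _ (ftrip_mkf x)) _.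
apply: teq_trans (taddC _ _) _; apply: teq_trans (tadd_eq _ (ftrip_mkf y)) _.
exact: taddC.
Qed.

Lemma fmul_mk x y : fmul (mkf x) (mkf y) = mkf (tmul x y).
Proof.
apply/mkf_eq; apply: teq_trans (tmul_eq _ (ftrip_mkf x)) _.
apply: teq_trans (tmulC _ _) _; apply: teq_trans (tmul_eq _ (ftrip_mkf y)) _.
exact: tmulC.
Qed.

Lemma fopp_mk x : fopp (mkf x) = mkf (topp x).
Proof. exact/mkf_eq/topp_eq/ftrip_mkf. Qed.

Lemma fle_mk x y : fle (mkf x) (mkf y) <-> tle x y.
Proof.
have [/teqP[x1 x2] /teqP[y1 y2]] := (ftrip_mkf x, ftrip_mkf y).
split=> H; first by apply: tle_trans x2 _; apply: tle_trans H y1.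
by apply: tle_trans x1 _; apply: tle_trans H y2.
Qed.
End Semiring.

(** * The fractions as a totally ordered field *)

Module FracField.
Import all_boot all_order all_algebra ring lra.
Import GRing.Theory Num.Theory Order.TTheory.
Local Open Scope ring_scope.

Section Field.
Variable N : osr.
Notation F := (ofrac N).

HB.instance Definition _ := boolp.gen_eqMixin F.
HB.instance Definition _ := boolp.gen_choiceMixin F.

Lemma frac_ind2 (P : F -> Prop) : (forall x, P (mkf x)) -> forall u, P u.
Proof. by move=> H u; rewrite -(mkfK u). Qed.

Lemma faddA : associative (@fadd N).
Proof.
elim/frac_ind2=> x; elim/frac_ind2=> y; elim/frac_ind2=> z.
by rewrite !fadd_mk; apply/mkf_eq/taddA.
Qed.
Lemma faddC : commutative (@fadd N).
Proof.
by elim/frac_ind2=> x; elim/frac_ind2=> y; rewrite !fadd_mk; apply/mkf_eq/taddC.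
Qed.
Lemma fadd0 : left_id (mkf (tnat (@o0 N))) (@fadd N).
Proof. by elim/frac_ind2=> x; rewrite fadd_mk; apply/mkf_eq/tadd0. Qed.
Lemma faddN : left_inverse (mkf (tnat (@o0 N))) (@fopp N) (@fadd N).
Proof. by elim/frac_ind2=> x; rewrite fopp_mk fadd_mk; apply/mkf_eq/taddN. Qed.

HB.instance Definition _ := GRing.isZmodule.Build F faddA faddC fadd0 faddN.

Lemma fmulA : associative (@fmul N).
Proof.
elim/frac_ind2=> x; elim/frac_ind2=> y; elim/frac_ind2=> z.
by rewrite !fmul_mk; apply/mkf_eq/tmulA.
Qed.
Lemma fmulC : commutative (@fmul N).
Proof.
by elim/frac_ind2=> x; elim/frac_ind2=> y; rewrite !fmul_mk; apply/mkf_eq/tmulC.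
Qed.
Lemma fmul1 : left_id (mkf (tnat (@o1 N))) (@fmul N).
Proof. by elim/frac_ind2=> x; rewrite fmul_mk; apply/mkf_eq/tmul1. Qed.
Lemma fmulD : left_distributive (@fmul N) (@fadd N).
Proof.
elim/frac_ind2=> x; elim/frac_ind2=> y; elim/frac_ind2=> z.
by rewrite !(fmul_mk, fadd_mk); apply/mkf_eq/tmulD.
Qed.
Lemma fone_neq0 : mkf (tnat (@o1 N)) != 0.
Proof. by apply/eqP => /mkf_eq; exact: tone_neq0. Qed.

HB.instance Definition _ :=
  GRing.Zmodule_isComNzRing.Build F fmulA fmulC fmul1 fmulD fone_neq0.

Definition finv (u : F) : F :=
  if u == 0 then 0 else epsilon (inhabits u) (fun v => v * u = 1).

Lemma fmulVf (u : F) : u != 0 -> finv u * u = 1.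
Proof.
move=> u0; rewrite /finv (negbTE u0).
apply: (epsilon_spec (inhabits u) (fun v => v * u = 1)).
elim/frac_ind2: u u0 => x x0.
have /tinv_exists[y xy] : ~ teq x (tnat (o0 N)).
  by move=> /mkf_eq E; move: x0; rewrite E eqxx.
by exists (mkf y); rewrite [LHS]fmul_mk; apply/mkf_eq.
Qed.
Lemma finv0 : finv 0 = 0.
Proof. by rewrite /finv eqxx. Qed.

HB.instance Definition _ := GRing.ComNzRing_isField.Build F fmulVf finv0.

Definition bfle (u v : F) : bool := boolp.asbool (fle u v).
Definition bflt (u v : F) : bool := (v != u) && bfle u v.
Definition fnorm (u : F) : F := if bfle 0 u then u else - u.

Lemma bfle_mk x y : reflect (tle x y) (bfle (mkf x) (mkf y)).
Proof.
by apply: (iffP (boolp.asboolP _)) => /fle_mk.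
Qed.

Lemma fle0_add (u v : F) : bfle 0 u -> bfle 0 v -> bfle 0 (u + v).
Proof.
elim/frac_ind2: u => x; elim/frac_ind2: v => y /bfle_mk x0 /bfle_mk y0.
by rewrite [_ + _]fadd_mk; apply/bfle_mk/tle0_add.
Qed.
Lemma fle0_mul (u v : F) : bfle 0 u -> bfle 0 v -> bfle 0 (u * v).
Proof.
elim/frac_ind2: u => x; elim/frac_ind2: v => y /bfle_mk x0 /bfle_mk y0.
by rewrite [_ * _]fmul_mk; apply/bfle_mk/tle0_mul.
Qed.
Lemma fle0_anti (u : F) : bfle 0 u -> bfle u 0 -> u = 0.
Proof.
elim/frac_ind2: u => x /bfle_mk x0 /bfle_mk x0'.
by apply/mkf_eq/teqP.
Qed.
Lemma fsub_ge0 (u v : F) : bfle 0 (v - u) = bfle u v.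
Proof.
elim/frac_ind2: u => x; elim/frac_ind2: v => y.
by rewrite [- _]fopp_mk [_ + _]fadd_mk; apply/bfle_mk/bfle_mk => /tsub_ge0.
Qed.
Lemma fle0_total (u : F) : bfle 0 u || bfle u 0.
Proof.
elim/frac_ind2: u => x; apply/orP.
by case: (ttotal (tnat (o0 N)) x) => H; [left|right]; apply/bfle_mk.
Qed.
Lemma fge0_norm (u : F) : bfle 0 u -> fnorm u = u.
Proof. by rewrite /fnorm => ->. Qed.
Lemma fnormN (u : F) : fnorm (- u) = fnorm u.
Proof.
rewrite /fnorm -[X in bfle 0 X]sub0r fsub_ge0 opprK.
have := fle0_total u; case: ifP => u0; case: ifP => u0' // _.
by rewrite (fle0_anti u0' u0) oppr0.
Qed.
Lemma flt_def (u v : F) : bflt u v = (v != u) && bfle u v.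
Proof. by []. Qed.

HB.instance Definition _ := Num.IntegralDomain_isLeReal.Build F
  fle0_add fle0_mul fle0_anti fsub_ge0 fle0_total fnormN fge0_norm flt_def.

Definition fracF : realFieldType := F.

Definition ofnat (a : N) : fracF := mkf (tnat a).

Lemma ofnat0 : ofnat (o0 N) = 0. Proof. by []. Qed.
Lemma ofnat1 : ofnat (o1 N) = 1. Proof. by []. Qed.
Lemma ofnatD a b : ofnat (oadd a b) = ofnat a + ofnat b.
Proof. by rewrite [RHS]fadd_mk; apply/mkf_eq/tnatD. Qed.
Lemma ofnatM a b : ofnat (omul a b) = ofnat a * ofnat b.
Proof. by rewrite [RHS]fmul_mk; apply/mkf_eq/tnatM. Qed.
Lemma ofnat_le a b : ofnat a <= ofnat b <-> ole a b.
Proof. by split=> [/bfle_mk/tnat_le|/tnat_le H]; [|apply/bfle_mk]. Qed.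
Lemma ofnat_lt a b : ofnat a < ofnat b <-> olt a b.
Proof.
rewrite ltNge; split=> [/negP H|/ole_nlt H]; last by apply/negP => /ofnat_le.
by apply/ole_nlt => /ofnat_le.
Qed.
Lemma ofnat_inj a b : ofnat a = ofnat b -> a = b.
Proof.
by move=> E; apply: ole_anti; apply/ofnat_le; rewrite E.
Qed.
Lemma ofnat_ge0 a : 0 <= ofnat a.
Proof. by apply/ofnat_le/ole0. Qed.

Lemma frac_surj (u : fracF) :
  exists a b c, u = (ofnat a - ofnat b) / (ofnat c + 1).
Proof.
elim/frac_ind2: u => -[a b c]; exists a, b, c.
have c0 : ofnat c + 1 != 0.
  by rewrite gt_eqF // -[0]addr0 ler_ltD ?ofnat_ge0 ?ltr01.
apply: (mulIf c0); rewrite mulfVK //; apply: (addIr (ofnat b)); rewrite subrK.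
by rewrite [_ + 1]fadd_mk [_ * _]fmul_mk [_ + _]fadd_mk; apply/mkf_eq/tfrac_eq.
Qed.
(** The Archimedean property relative to the numbers of the model; over a nonstandard model the
    field is not Archimedean in the usual sense. *)
Lemma ofnat_bound (u : fracF) : exists n, u <= ofnat n.
Proof.
elim/frac_ind2: u => -[a b c]; exists a; apply/bfle_mk/tle_bound.
Qed.
End Field.
End FracField.

End Fractions.

(** * Syntax, completeness, and extensional models of the base theory *)

Module Syntax.
Import List Cantor PeanoNat Lia Eqdep Defs.
Import ListNotations.
Local Open Scope lw_scope.
Import Fractions.

Definition env (P : ty -> Type) (G : ctx) := forall t, var G t -> P t.

Notation "a .: f" := (scons a f) (at level 55, right associativity).

Lemma env_ext P G (f g : env P G) : (forall t v, f t v = g t v) -> f = g.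
Proof.
move=> fg; apply: functional_extensionality_dep => t.
by apply: functional_extensionality_dep => v.
Qed.

(** Written by hand, with the motive quantified inside the match, so that no equation between
    contexts has to be inverted. *)
Definition var_case s G (P : forall t, var (s :: G) t -> Prop)
    (Pz : P s vz) (Ps : forall t (v : var G t), P t (vs v)) t v : P t v :=
  match v as v' in var G' t'
    return match G' return var G' t' -> Prop with
           | [] => fun _ => True
           | s' :: G'' => fun v' => forall Q : forall t, var (s' :: G'') t -> Prop,
                Q s' vz -> (forall t (w : var G'' t), Q t (vs w)) -> Q t' v'
           end v' with
  | vz => fun Q Qz _ => Qz
  | vs w => fun Q _ Qs => Qs _ w
  end P Pz Ps.

Definition var_nil (P : forall t, var [] t -> Prop) t (v : var [] t) : P t v :=
  match v as v' in var G' t'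
    return match G' return var G' t' -> Prop with
           | [] => fun v' => forall Q : forall t, var [] t -> Prop, Q t' v'
           | _ :: _ => fun _ => True
           end v' with
  | vz => I
  | vs _ => I
  end P.

Definition nil_env (P : ty -> Type) : env P [] := fun t v =>
  match v in var G' t' return match G' with [] => P t' | _ => unit end with
  | vz => tt
  | vs _ => tt
  end.

Lemma nil_env_eq P (f g : env P []) : f = g.
Proof. by apply: env_ext => t v; elim/var_nil: t / v. Qed.

Lemma scons_comp (P Q : ty -> Type) (h : forall t, P t -> Q t) G s (a : P s)
    (f : env P G) :
  (fun t v => h t (scons a f v)) = h s a .: (fun t v => h t (f t v)).
Proof. by apply: env_ext => t v; elim/var_case: t / v. Qed.

Lemma scons_eta P G s (f : env P (s :: G)) :
  f = f s vz .: (fun t v => f t (vs v)).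
Proof. by apply: env_ext => t v; elim/var_case: t / v. Qed.

(** * Renaming and substitution *)

Lemma ren_ren_tm G D E (r : ren G D) (r' : ren D E) t (a : tm G t) :
  ren_tm r' (ren_tm r a) = ren_tm (fun t v => r' t (r t v)) a.
Proof. by elim: a => //= u w a -> b ->. Qed.

Lemma ren_sub_tm G D E (r : sub G D) (r' : ren D E) t (a : tm G t) :
  ren_tm r' (sub_tm r a) = sub_tm (fun t v => ren_tm r' (r t v)) a.
Proof. by elim: a => //= u w a -> b ->. Qed.

Lemma sub_ren_tm G D E (r : ren G D) (r' : sub D E) t (a : tm G t) :
  sub_tm r' (ren_tm r a) = sub_tm (fun t v => r' t (r t v)) a.
Proof. by elim: a => //= u w a -> b ->. Qed.

Lemma sub_sub_tm G D E (r : sub G D) (r' : sub D E) t (a : tm G t) :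
  sub_tm r' (sub_tm r a) = sub_tm (fun t v => sub_tm r' (r t v)) a.
Proof. by elim: a => //= u w a -> b ->. Qed.

Lemma sub_Var_tm G D (r : ren G D) t (a : tm G t) :
  sub_tm (fun t v => Var (r t v)) a = ren_tm r a.
Proof. by elim: a => //= u w a -> b ->. Qed.

Lemma ren_up_sub G D E s (r : sub G D) (r' : ren D E) :
  (fun t v => ren_tm (up_ren r') (up_sub (s := s) r v))
  = up_sub (fun t v => ren_tm r' (r t v)).
Proof.
apply: env_ext => t v; elim/var_case: t / v => //= t v.
by rewrite /wk !ren_ren_tm.
Qed.

Lemma sub_up_sub G D E s (r : sub G D) (r' : sub D E) :
  (fun t v => sub_tm (up_sub r') (up_sub (s := s) r v))
  = up_sub (fun t v => sub_tm r' (r t v)).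
Proof.
apply: env_ext => t v; elim/var_case: t / v => //= t v.
by rewrite /wk sub_ren_tm ren_sub_tm.
Qed.

Lemma up_sub_Var G D s (r : ren G D) :
  up_sub (s := s) (fun t v => Var (r t v)) = fun t v => Var (up_ren r v).
Proof. by apply: env_ext => t v; elim/var_case: t / v. Qed.

Lemma ren_sub_fm G (A : fm G) : forall D E (r : sub G D) (r' : ren D E),
  ren_fm r' (sub_fm r A) = sub_fm (fun t v => ren_tm r' (r t v)) A.
Proof.
elim: G / A => //= [G a b|G a b|G A IA B IB|G A IA B IB|G A IA B IB|G s A IA|G s A IA]
  D E r r'; rewrite ?ren_sub_tm ?IA ?IB //; by rewrite ren_up_sub.
Qed.

Lemma sub_sub_fm G (A : fm G) : forall D E (r : sub G D) (r' : sub D E),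
  sub_fm r' (sub_fm r A) = sub_fm (fun t v => sub_tm r' (r t v)) A.
Proof.
elim: G / A => //= [G a b|G a b|G A IA B IB|G A IA B IB|G A IA B IB|G s A IA|G s A IA]
  D E r r'; rewrite ?sub_sub_tm ?IA ?IB //; by rewrite sub_up_sub.
Qed.

Lemma sub_Var_fm G (A : fm G) : forall D (r : ren G D),
  sub_fm (fun t v => Var (r t v)) A = ren_fm r A.
Proof.
elim: G / A => //= [G a b|G a b|G A IA B IB|G A IA B IB|G A IA B IB|G s A IA|G s A IA]
  D r; rewrite ?sub_Var_tm ?IA ?IB // up_sub_Var ?IA //.
Qed.

Lemma inst_sub_fm G D s (A : fm (s :: G)) (r : sub G D) (a : tm D s) :
  inst (sub_fm (up_sub r) A) a = sub_fm (a .: r) A.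
Proof.
rewrite /inst sub_sub_fm; congr (sub_fm _ A).
apply: env_ext => t v; elim/var_case: t / v => //= t v.
rewrite /wk sub_ren_tm -[RHS]/(r t v).
have -> : (fun u (w : var D u) => scons a (fun t v => Var v) (shift (s := s) w))
  = fun u w => Var w by [].
elim: (r t v) => //= u w b -> c -> //.
Qed.

Lemma sub_fm_id G (A : fm G) : sub_fm (fun t v => Var v) A = A.
Proof.
have tm_id G' t (a : tm G' t) : sub_tm (fun t v => Var v) a = a.
  by elim: t / a => //= s t a -> b ->.
elim: G / A => //= [G a b|G a b|G A IA B IB|G A IA B IB|G A IA B IB|G s A IA|G s A IA];
  rewrite ?tm_id ?IA ?IB //; rewrite -[in RHS]IA; congr (_ _ (sub_fm _ A));
  by apply: env_ext => t v; elim/var_case: t / v.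
Qed.

Lemma inst_up_shift G s (A : fm (s :: G)) :
  inst (ren_fm (up_ren shift) A) x0 = A.
Proof.
rewrite /inst -sub_Var_fm sub_sub_fm -[RHS]sub_fm_id; congr (sub_fm _ A).
by apply: env_ext => t v; elim/var_case: t / v.
Qed.

(** * Structures *)

Record structure := Structure {
  dom : ty -> Type;
  capp : forall s t, dom (s --> t) -> dom s -> dom t;
  ccst : forall t, cst t -> dom t;
  eq0 : dom ty0 -> dom ty0 -> Prop;
  lt0 : dom ty0 -> dom ty0 -> Prop }.

Arguments capp {_ _ _} : simpl nomatch.
Arguments ccst _ {_} : simpl nomatch.
Arguments eq0 {_} : simpl nomatch.
Arguments lt0 {_} : simpl nomatch.

Section Satisfaction.
Variable S : structure.

Fixpoint ev G (f : env (dom S) G) t (a : tm G t) : dom S t :=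
  match a with
  | Var v => f _ v
  | Cst c => ccst S c
  | App a b => capp (ev f a) (ev f b)
  end.

Fixpoint sat G (f : env (dom S) G) (A : fm G) : Prop :=
  match A in fm _ return Prop with
  | Eq a b => eq0 (ev f a) (ev f b)
  | Lt a b => lt0 (ev f a) (ev f b)
  | Bot => False
  | Imp A B => sat f A -> sat f B
  | And A B => sat f A /\ sat f B
  | Or A B => sat f A \/ sat f B
  | All s A => forall x : dom S s, sat (x .: f) A
  | Ex s A => exists x : dom S s, sat (x .: f) A
  end.

Lemma ev_ren G D (r : ren G D) (f : env (dom S) D) t (a : tm G t) :
  ev f (ren_tm r a) = ev (fun t v => f t (r t v)) a.
Proof. by elim: a => //= u w a -> b ->. Qed.

Lemma ev_wk G s (x : dom S s) (f : env (dom S) G) t (a : tm G t) :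
  ev (x .: f) (wk a) = ev f a.
Proof. by rewrite /wk ev_ren. Qed.

Lemma ev_sub G D (r : sub G D) (f : env (dom S) D) t (a : tm G t) :
  ev f (sub_tm r a) = ev (fun t v => ev f (r t v)) a.
Proof. by elim: a => //= u w a -> b ->. Qed.

Lemma up_sub_env G D s (r : sub G D) (x : dom S s) (f : env (dom S) D) :
  (fun t v => ev (x .: f) (up_sub r v)) = x .: (fun t v => ev f (r t v)).
Proof. by apply: env_ext => t v; elim/var_case: t / v => //= t v; rewrite ev_wk. Qed.

Lemma sat_sub G (A : fm G) : forall D (r : sub G D) (f : env (dom S) D),
  sat f (sub_fm r A) <-> sat (fun t v => ev f (r t v)) A.
Proof.
elim: G / A => //= [G a b|G a b|G A IA B IB|G A IA B IB|G A IA B IB|G s A IA|G s A IA]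
  D r f; rewrite ?ev_sub ?IA ?IB //.
- by split=> H x; move: (H x); rewrite IA up_sub_env.
- by split=> -[x H]; exists x; move: H; rewrite IA up_sub_env.
Qed.

Lemma sat_inst G s (A : fm (s :: G)) (a : tm G s) (f : env (dom S) G) :
  sat f (inst A a) <-> sat (ev f a .: f) A.
Proof.
rewrite /inst sat_sub; suff -> : (fun t v => ev f (scons (P := tm G) a
  (fun t v => Var v) v)) = ev f a .: f by [].
by apply: env_ext => t v; elim/var_case: t / v.
Qed.

Lemma sat_closure G (A : fm G) (f : env (dom S) []) :
  sat f (closure A) <-> forall g : env (dom S) G, sat g A.
Proof.
elim: G A => [|s G IH] A /=.
  by split=> [H g|]; [rewrite (nil_env_eq g f)|exact].
rewrite IH; split=> [H g|H g x]; last exact: H.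
by rewrite (scons_eta g); exact: H.
Qed.

End Satisfaction.

(** * Countability of the syntax *)

Definition pr (a b : nat) : nat := to_nat (a, b).

Lemma pr_inj a b c d : pr a b = pr c d -> a = c /\ b = d.
Proof. by move/to_nat_inj => [-> ->]. Qed.

Fixpoint ty_code (t : ty) : nat :=
  match t with ty0 => 0 | Arr s t => S (pr (ty_code s) (ty_code t)) end.

Lemma ty_code_inj s t : ty_code s = ty_code t -> s = t.
Proof.
elim: s t => [|s IHs t IHt] [|s' t'] //= [] /pr_inj[/IHs -> /IHt ->] //.
Qed.

Fixpoint var_code G t (v : var G t) : nat :=
  match v with vz => 0 | vs w => S (var_code w) end.

Lemma var_code_inj G t (v : var G t) : forall t' (w : var G t'),
  var_code v = var_code w -> existT _ t v = existT _ t' w.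
Proof.
elim: G t / v => [G s|G s t v IH] t' w; elim/var_case: t' / w => //= t' w [/IH E].
by move: (f_equal (fun p : {t & var G t} =>
  existT (var (s :: G)) (projT1 p) (vs (projT2 p))) E).
Qed.

Definition cst_code t (c : cst t) : nat :=
  match c with
  | Zero => pr 0 0
  | One => pr 1 0
  | Plus => pr 2 0
  | Times => pr 3 0
  | Pi r s => pr 4 (pr (ty_code r) (ty_code s))
  | Sigma r s t => pr 5 (pr (ty_code r) (pr (ty_code s) (ty_code t)))
  | Rec s => pr 6 (ty_code s)
  end.

Lemma cst_code_inj t (c : cst t) t' (d : cst t') :
  cst_code c = cst_code d -> existT _ t c = existT _ t' d.
Proof.
case: t / c => [||||r s|r s t|s]; case: t' / d => [||||r' s'|r' s' t'|s'] /pr_inj[] //.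
- by move=> _ /pr_inj[/ty_code_inj <- /ty_code_inj <-].
- by move=> _ /pr_inj[/ty_code_inj <- /pr_inj[/ty_code_inj <- /ty_code_inj <-]].
- by move=> _ /ty_code_inj <-.
Qed.

Lemma existT_app (P : ty -> Type) (app : forall s t, P (s --> t) -> P s -> P t)
    s t s' t' (a : P (s --> t)) (b : P s) (a' : P (s' --> t')) (b' : P s') :
  existT P _ a = existT P _ a' -> existT P _ b = existT P _ b' ->
  existT P t (app s t a b) = existT P t' (app s' t' a' b').
Proof.
move=> E; case: (f_equal (@projT1 _ _) E) => Es Et.
move: a' b' E; rewrite -Es -Et => a' b' /(inj_pair2 _ _ _ _ _) <-.
by move=> /(inj_pair2 _ _ _ _ _) <-.
Qed.

Fixpoint tm_code G t (a : tm G t) : nat :=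
  match a with
  | Var v => pr 0 (var_code v)
  | Cst c => pr 1 (cst_code c)
  | App a b => pr 2 (pr (tm_code a) (tm_code b))
  end.

Lemma tm_code_inj' G t (a : tm G t) : forall t' (b : tm G t'),
  tm_code a = tm_code b -> existT _ t a = existT _ t' b.
Proof.
elim: t / a => [t v|t c|s t a IHa b IHb] t' [t'' v'|t'' c'|s' t'' a' b'] /= /pr_inj[] //.
- move=> _ /var_code_inj E.
  by move: (f_equal (fun p : {t & var G t} => existT (tm G) (projT1 p) (Var (projT2 p))) E).
- move=> _ /cst_code_inj E.
  by move: (f_equal (fun p : {t & cst t} => existT (tm G) (projT1 p) (Cst (projT2 p))) E).
- by move=> _ /pr_inj[/IHa Ea /IHb Eb]; exact: (existT_app (@App G)).
Qed.

Lemma tm_code_inj G t (a b : tm G t) : tm_code a = tm_code b -> a = b.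
Proof. by move/tm_code_inj'/(inj_pair2 _ _ _ _ _). Qed.

Fixpoint fm_code G (A : fm G) : nat :=
  match A with
  | Eq a b => pr 0 (pr (tm_code a) (tm_code b))
  | Lt a b => pr 1 (pr (tm_code a) (tm_code b))
  | Bot => pr 2 0
  | Imp A B => pr 3 (pr (fm_code A) (fm_code B))
  | And A B => pr 4 (pr (fm_code A) (fm_code B))
  | Or A B => pr 5 (pr (fm_code A) (fm_code B))
  | All s A => pr 6 (pr (ty_code s) (fm_code A))
  | Ex s A => pr 7 (pr (ty_code s) (fm_code A))
  end.

Lemma fm_code_inj G (A B : fm G) : fm_code A = fm_code B -> A = B.
Proof.
elim: G / A B => [G a b|G a b|G|G A IA B IB|G A IA B IB|G A IA B IB|G s A IA|G s A IA]
  [a' b'|a' b'||A' B'|A' B'|A' B'|s' A'|s' A'] /= /pr_inj[] //.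
- by move=> _ /pr_inj[/tm_code_inj -> /tm_code_inj ->].
- by move=> _ /pr_inj[/tm_code_inj -> /tm_code_inj ->].
- by move=> _ /pr_inj[/IA -> /IB ->].
- by move=> _ /pr_inj[/IA -> /IB ->].
- by move=> _ /pr_inj[/IA -> /IB ->].
- by move=> _ /pr_inj[/ty_code_inj E]; move: A'; rewrite -E => A' /IA ->.
- by move=> _ /pr_inj[/ty_code_inj E]; move: A'; rewrite -E => A' /IA ->.
Qed.

(** * Closed terms over Henkin constants, and sentences *)

Inductive ntm : ty -> Type :=
| NC s : nat -> ntm s
| NK t : cst t -> ntm t
| NA s t : ntm (s --> t) -> ntm s -> ntm t.

Fixpoint ntm_code t (a : ntm t) : nat :=
  match a with
  | NC s i => pr 0 (pr (ty_code s) i)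
  | NK c => pr 1 (cst_code c)
  | NA a b => pr 2 (pr (ntm_code a) (ntm_code b))
  end.

Lemma ntm_code_inj' t (a : ntm t) : forall t' (b : ntm t'),
  ntm_code a = ntm_code b -> existT _ t a = existT _ t' b.
Proof.
elim: t / a => [t i|t c|s t a IHa b IHb] t' [t'' i'|t'' c'|s' t'' a' b'] /= /pr_inj[] //.
- by move=> _ /pr_inj[/ty_code_inj <- <-].
- move=> _ /cst_code_inj E.
  by move: (f_equal (fun p : {t & cst t} => existT ntm (projT1 p) (NK (projT2 p))) E).
- by move=> _ /pr_inj[/IHa Ea /IHb Eb]; exact: (existT_app NA).
Qed.

Lemma ntm_code_inj t (a b : ntm t) : ntm_code a = ntm_code b -> a = b.
Proof. by move/ntm_code_inj'/(inj_pair2 _ _ _ _ _). Qed.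

Fixpoint env_code G : env ntm G -> nat :=
  match G with
  | [] => fun _ => 0
  | s :: G => fun f => pr (ntm_code (f s vz)) (env_code (fun t v => f t (vs v)))
  end.

Lemma env_code_inj G (f g : env ntm G) : env_code f = env_code g -> f = g.
Proof.
elim: G f g => [f g _|s G IH f g /= /pr_inj[/ntm_code_inj E /IH E']].
  exact: nil_env_eq.
by rewrite (scons_eta f) (scons_eta g) E E'.
Qed.

(** The substitution of closed terms for free variables is delayed, so the language with Henkin
    constants needs no second syntax of formulas. *)
Record sent := Sent { sctx : ctx; sfm : fm sctx; senv : env ntm sctx }.
Arguments Sent {sctx}.

Fixpoint ctx_code (G : ctx) : nat :=
  match G with [] => 0 | s :: G => S (pr (ty_code s) (ctx_code G)) end.

Lemma ctx_code_inj G D : ctx_code G = ctx_code D -> G = D.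
Proof. by elim: G D => [|s G IH] [|s' D] //= [] /pr_inj[/ty_code_inj -> /IH ->]. Qed.

Definition sent_code (c : sent) : nat :=
  pr (ctx_code (sctx c)) (pr (fm_code (sfm c)) (env_code (@senv c))).

Lemma sent_code_inj c d : sent_code c = sent_code d -> c = d.
Proof.
case: c => G A f; case: d => G' A' f' /pr_inj[/= /ctx_code_inj E].
move: A' f'; rewrite -E => A' f' /pr_inj[/fm_code_inj -> /env_code_inj ->] //.
Qed.

Definition SBot : sent := Sent Bot (nil_env ntm).

Definition enum (n : nat) : sent := epsilon (inhabits SBot) (fun c => sent_code c = n).

Lemma enum_code c : enum (sent_code c) = c.
Proof.
by apply: sent_code_inj; apply: (epsilon_spec (inhabits SBot)
  (fun d => sent_code d = sent_code c)); exists c.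
Qed.

Definition assignment D := forall s, nat -> tm D s.

Fixpoint ninst D (tau : assignment D) t (a : ntm t) : tm D t :=
  match a with
  | NC s i => tau s i
  | NK c => Cst c
  | NA a b => ninst tau a @ ninst tau b
  end.

Definition sinst D (tau : assignment D) (c : sent) : fm D :=
  sub_fm (fun t v => ninst tau (@senv c t v)) (sfm c).

Fixpoint nbound t (a : ntm t) : nat :=
  match a with
  | NC s i => S i
  | NK c => 0
  | NA a b => max (nbound a) (nbound b)
  end.

Lemma ninst_ext D (tau tau' : assignment D) i t (a : ntm t) :
  nbound a <= i -> (forall s j, j < i -> tau s j = tau' s j) ->
  ninst tau a = ninst tau' a.
Proof.
move=> + E; elim: t / a => [s j|t c|s t a IHa b IHb] //= le_i; first exact: E.
by rewrite IHa ?IHb //; lia.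
Qed.

Lemma ninst_ren D E (r : ren D E) (tau : assignment D) t (a : ntm t) :
  ren_tm r (ninst tau a) = ninst (fun s i => ren_tm r (tau s i)) a.
Proof. by elim: t / a => //= s t a -> b ->. Qed.

Definition sbounded (i : nat) (c : sent) := forall t v, nbound (@senv c t v) <= i.

Lemma sbounded_exists c : exists i, sbounded i c.
Proof.
case: c => G A f; rewrite /sbounded /=; elim: G {A} f => [|s G IH] f.
  by exists 0 => t v; elim/var_nil: t / v.
case: (IH (fun t v => f t (vs v))) => i Hi; exists (max i (nbound (f s vz))) => t v.
elim/var_case: t / v => [|t v]; first lia.
by move: (Hi t v); lia.
Qed.

Lemma sbounded_list (L : list sent) : exists i, forall c, In c L -> sbounded i c.
Proof.
elim: L => [|c L [i Hi]]; first by exists 0.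
case: (sbounded_exists c) => j Hj; exists (max i j) => d [<-|/Hi Hd] t v.
  by move: (Hj t v); lia.
by move: (Hd t v); lia.
Qed.

Lemma nd_weaken (T : theory) G (H : list (fm G)) A :
  nd T H A -> forall H', incl H H' -> nd T H' A.
Proof.
have mono G' (H1 H2 : list (fm G')) B : incl H1 H2 -> incl (B :: H1) (B :: H2).
  by move=> s C [->|/s]; [left|right].
elim; clear G H A.
- by move=> *; apply: nd_ax.
- by move=> G H A HA H' s; apply: nd_hyp; apply: s.
- by move=> G H A _ IH H' s; apply: nd_raa; apply/IH/mono.
- by move=> G H A B _ IH H' s; apply: nd_impI; apply/IH/mono.
- by move=> G H A B _ IH1 _ IH2 H' s; apply: nd_impE; [apply: IH1|apply: IH2].
- by move=> G H A B _ IH1 _ IH2 H' s; apply: nd_andI; [apply: IH1|apply: IH2].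
- by move=> G H A B _ IH H' s; apply: nd_andE1; apply: IH s.
- by move=> G H A B _ IH H' s; apply: nd_andE2; apply: IH s.
- by move=> G H A B _ IH H' s; apply: nd_orI1; apply: IH.
- by move=> G H A B _ IH H' s; apply: nd_orI2; apply: IH.
- move=> G H A B C _ IH _ IH1 _ IH2 H' s.
  by apply: nd_orE (IH _ s) _ _; [apply/IH1/mono|apply/IH2/mono].
- by move=> G H s A _ IH H' sub; apply: nd_allI; apply/IH/incl_map.
- by move=> G H s A a _ IH H' sub; apply: nd_allE; apply: IH.
- by move=> G H s A a _ IH H' sub; apply: nd_exI; apply: IH sub.
- move=> G H s A C _ IH1 _ IH2 H' sub; apply: nd_exE (IH1 _ sub) _.
  by apply/IH2/mono/incl_map.
Qed.

(** * Henkin's completeness theorem *)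

Section Completeness.
Variable T : theory.

Definition entails (L : list sent) (c : sent) :=
  forall D (tau : assignment D), nd T (map (sinst tau) L) (sinst tau c).

(** Quantifying over all assignments of terms in all contexts makes Henkin constants
    behave like variables, so that an unused constant can serve as an eigenvariable. *)
Definition incons (L : list sent) :=
  forall D (tau : assignment D), nd T (map (sinst tau) L) Bot.

Lemma incons_incl L L' : incl L L' -> incons L -> incons L'.
Proof. by move=> s H D tau; apply: nd_weaken (H D tau) _ _; apply: incl_map. Qed.

Lemma incons_cut L c : entails L c -> incons (c :: L) -> incons L.
Proof. by move=> H1 H2 D tau; apply: nd_impE (H1 D tau); apply/nd_impI/H2. Qed.

Definition fresh_tau D (tau : assignment D) s i : assignment (s :: D) :=
  fun u j => match Nat.eq_dec i j, excluded_middle_informative (s = u) with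
             | left _, left e => eq_rect s (fun u => tm (s :: D) u) x0 u e
             | _, _ => wk (tau u j)
             end.

Lemma fresh_tau_new D (tau : assignment D) s i : fresh_tau tau s i s i = x0.
Proof.
rewrite /fresh_tau; case: Nat.eq_dec => // _.
by case: excluded_middle_informative => // e; rewrite -Eq_rect_eq.eq_rect_eq.
Qed.

Lemma ninst_fresh D (tau : assignment D) s i t (a : ntm t) :
  nbound a <= i -> ninst (fresh_tau tau s i) a = wk (ninst tau a).
Proof.
move=> ba; rewrite /wk ninst_ren; apply: ninst_ext ba _ => u j lt_ji.
by rewrite /fresh_tau; case: Nat.eq_dec => // e; lia.
Qed.

Lemma sinst_fresh D (tau : assignment D) s i c : sbounded i c ->
  sinst (fresh_tau tau s i) c = wk_fm (sinst tau c).
Proof.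
move=> bc; rewrite /sinst /wk_fm ren_sub_fm; congr (sub_fm _ _).
by apply: env_ext => t v; apply: ninst_fresh.
Qed.

(** Sending the constant [NC s i] to a fresh variable turns the hypotheses into weakened ones,
    because no constant of index i occurs in L; this is the eigenvariable condition for eliminating
    [Ex]. *)
Lemma incons_witness L G s (A : fm (s :: G)) (f : env ntm G) i :
  (forall c, In c L -> sbounded i c) -> In (Sent (Ex s A) f) L ->
  incons (Sent A (NC s i .: f) :: L) -> incons L.
Proof.
move=> bL inL H D tau.
apply: (nd_exE (A := sub_fm (up_sub (fun t v => ninst tau (f t v))) A)).
  by apply: nd_hyp; exact: (in_map (sinst tau) _ _ inL).
have -> : sub_fm (up_sub (fun t v => ninst tau (f t v))) A
    = sinst (fresh_tau tau s i) (Sent A (NC s i .: f)).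
  rewrite /sinst /=; congr (sub_fm _ A); apply: env_ext => t v.
  elim/var_case: t / v => [|t v] /=; first by rewrite fresh_tau_new.
  by rewrite ninst_fresh //; exact: (bL _ inL).
suff -> : map wk_fm (map (sinst tau) L) = map (sinst (fresh_tau tau s i)) L.
  exact: (H _ (fresh_tau tau s i)).
by rewrite map_map; apply: map_ext_in => c inc; rewrite sinst_fresh //; exact: bL.
Qed.

(** * Lindenbaum extension with Henkin witnesses *)

Definition bound_of (L : list sent) : nat :=
  epsilon (inhabits 0) (fun i => forall c, In c L -> sbounded i c).

Lemma bound_ofP L c : In c L -> sbounded (bound_of L) c.
Proof.
exact: (epsilon_spec (inhabits 0) (fun i => forall c, In c L -> sbounded i c)
  (sbounded_list L)).
Qed.

Definition witness (i : nat) (c : sent) : list sent :=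
  match c with
  | Sent (Ex s A) f => [Sent A (NC s i .: f)]
  | _ => []
  end.

Definition step (L : list sent) (c : sent) : list sent :=
  if excluded_middle_informative (incons (c :: L)) is left _ then L
  else witness (bound_of (c :: L)) c ++ c :: L.

Lemma step_consistent L c : ~ incons L -> ~ incons (step L c).
Proof.
rewrite /step; case: excluded_middle_informative => // nc _ H; apply: nc.
case: c H => G [a b|a b||A B|A B|A B|s A|s A] f //= H.
by apply: incons_witness H; [exact: bound_ofP|left].
Qed.

Lemma step_incl L c : incl L (step L c).
Proof.
rewrite /step; case: excluded_middle_informative => [_ d|_ d inL] //.
by apply: in_or_app; right; right.
Qed.

Variable L0 : list sent.
Hypothesis L0_cons : ~ incons L0.

Fixpoint stage (n : nat) : list sent :=
  match n with 0 => L0 | S n => step (stage n) (enum n) end.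

Definition theory_of (c : sent) : Prop := exists n, In c (stage n).

Lemma stage_cons n : ~ incons (stage n).
Proof. by elim: n => //= n; exact: step_consistent. Qed.

Lemma stage_incl n m : n <= m -> incl (stage n) (stage m).
Proof. by elim=> // m' _ IH c /IH; exact: step_incl. Qed.

Lemma stage_list L : (forall c, In c L -> theory_of c) -> exists n, incl L (stage n).
Proof.
elim: L => [|c L IH] H; first by exists 0.
case: (H c (or_introl eq_refl)) => n inn.
case: IH => [d ind|m inm]; first by apply: H; right.
exists (max n m) => d [<-|/inm ind]; first by apply: (stage_incl _ inn); lia.
by apply: (stage_incl _ ind); lia.
Qed.

Lemma theory_cons L : (forall c, In c L -> theory_of c) -> ~ incons L.
Proof. by move=> /stage_list[n Ln] /(incons_incl Ln); exact: stage_cons. Qed.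

(** A sentence outside the theory was rejected at its own stage, and rejection means inconsistency
    with that stage. *)
Lemma enum_incons c : ~ theory_of c -> exists n, incons (c :: stage n).
Proof.
move=> nc; exists (sent_code c); apply: NNPP => ni; apply: nc.
exists (S (sent_code c)); rewrite /= /step enum_code.
by case: excluded_middle_informative => // _; apply: in_or_app; right; left.
Qed.

Lemma theory_closed L c :
  (forall d, In d L -> theory_of d) -> entails L c -> theory_of c.
Proof.
move=> inL Lc; apply: NNPP => /enum_incons[n ni].
apply: (theory_cons (L := L ++ stage n)).
  by move=> d ind; case: (in_app_or _ _ _ ind) => [/inL //|]; exists n.
apply: (incons_cut (c := c)).
  by move=> D tau; apply: nd_weaken (Lc D tau) _ _; apply/incl_map/incl_appl/incl_refl.
apply: incons_incl ni => d [->|ind]; first by left.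
by right; apply: in_or_app; right.
Qed.

Lemma theory_not G (A : fm G) (f : env ntm G) :
  theory_of (Sent (Not A) f) <-> ~ theory_of (Sent A f).
Proof.
split=> [nA iA|/enum_incons[n ni]].
  apply: (theory_cons (L := [Sent (Not A) f; Sent A f])) => [d [<-|[<-|]] //|D tau].
  by apply: nd_impE (nd_hyp _ _); [apply: nd_hyp; left; reflexivity|right; left].
apply: (theory_closed (L := stage n)) => [d ind|D tau]; first by exists n.
exact/nd_impI/ni.
Qed.

Lemma theory_ex G s (A : fm (s :: G)) (f : env ntm G) :
  theory_of (Sent (Ex s A) f) -> exists i, theory_of (Sent A (NC s i .: f)).
Proof.
move=> H; set c := Sent _ _ in H; set n := sent_code c.
exists (bound_of (c :: stage n)), (S n) => /=; rewrite /step enum_code.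
case: excluded_middle_informative => [ni|_]; last by left.
exfalso; apply: (theory_cons _ ni) => d [<-|ind] //.
by exists n.
Qed.

Definition henkin : structure :=
  @Structure ntm NA NK
    (fun a b => theory_of (Sent (x0 == x1) (a .: (b .: nil_env ntm))))
    (fun a b => theory_of (Sent (x0 <' x1) (a .: (b .: nil_env ntm)))).

Lemma henkin_ev G (f : env ntm G) D (tau : assignment D) t (a : tm G t) :
  ninst tau (ev (S := henkin) f a) = sub_tm (fun t v => ninst tau (f t v)) a.
Proof. by elim: t / a => //= s t a -> b ->. Qed.

Lemma theory_ext c d :
  (forall D (tau : assignment D), sinst tau c = sinst tau d) ->
  theory_of c -> theory_of d.
Proof.
move=> E ic; apply: (theory_closed (L := [c])) => [e [<-|] //|D tau].
by apply: nd_hyp; left.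
Qed.

Lemma sinst_scons D (tau : assignment D) G s (A : fm (s :: G)) f (a : ntm s) :
  sinst tau (Sent A (a .: f))
  = inst (sub_fm (up_sub (fun t v => ninst tau (f t v))) A) (ninst tau a).
Proof. by rewrite inst_sub_fm /sinst /= (scons_comp (ninst tau)). Qed.

Lemma henkin_sat G (A : fm G) (f : env ntm G) :
  sat (S := henkin) f A <-> theory_of (Sent A f).
Proof.
elim: G / A f => [G a b|G a b|G|G A IA B IB|G A IA B IB|G A IA B IB|G s A IA|G s A IA] f /=.
- by split; apply: theory_ext => D tau; rewrite /sinst /= !henkin_ev.
- by split; apply: theory_ext => D tau; rewrite /sinst /= !henkin_ev.
- split=> // H; apply: (theory_cons (L := [Sent Bot f])) => [d [<-|] //|D tau].
  by apply: nd_hyp; left.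
- rewrite IA IB; split=> [H|H iA]; last first.
    apply: (theory_closed (L := [Sent (A ==> B) f; Sent A f])) => [d [<-|[<-|]] //|D tau].
    by apply: nd_impE (nd_hyp _ _); [apply: nd_hyp; left; reflexivity|right; left].
  case: (classic (theory_of (Sent A f))) => [/H iB|/theory_not iA].
    apply: (theory_closed (L := [Sent B f])) => [d [<-|] //|D tau].
    by apply/nd_impI/nd_hyp; right; left.
  apply: (theory_closed (L := [Sent (Not A) f])) => [d [<-|] //|D tau].
  apply/nd_impI/nd_raa; apply: nd_impE (nd_hyp _ _); last by right; left; reflexivity.
  by apply: nd_hyp; right; right; left.
- rewrite IA IB; split=> [[iA iB]|H].
    apply: (theory_closed (L := [Sent A f; Sent B f])) => [d [<-|[<-|]] //|D tau].
    by apply: nd_andI; apply: nd_hyp; [left|right; left].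
  by split; apply: (theory_closed (L := [Sent (A &' B) f])) => [d [<-|] //|D tau];
    [apply: nd_andE1|apply: nd_andE2]; apply: nd_hyp; left; reflexivity.
- rewrite IA IB; split=> [[iA|iB]|H].
  + apply: (theory_closed (L := [Sent A f])) => [d [<-|] //|D tau].
    by apply/nd_orI1/nd_hyp; left.
  + apply: (theory_closed (L := [Sent B f])) => [d [<-|] //|D tau].
    by apply/nd_orI2/nd_hyp; left.
  apply: NNPP => /not_or_and[/theory_not nA /theory_not nB].
  apply: (theory_cons (L := [Sent (A |' B) f; Sent (Not A) f; Sent (Not B) f])).
    by move=> d [<-|[<-|[<-|]]].
  move=> D tau; apply: nd_orE; first by apply: nd_hyp; left; reflexivity.
  + by apply: nd_impE (nd_hyp _ _); [apply: nd_hyp; right; right; left; reflexivity|left].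
  + by apply: nd_impE (nd_hyp _ _);
      [apply: nd_hyp; right; right; right; left; reflexivity|left].
- split=> [H|H a]; last first.
    rewrite IA; apply: (theory_closed (L := [Sent (All s A) f])) => [d [<-|] //|D tau].
    by rewrite sinst_scons; apply/nd_allE/nd_hyp; left.
  apply: NNPP => /theory_not nA.
  suff /theory_ex[i] : theory_of (Sent (Ex s (Not A)) f).
    by rewrite theory_not; apply; rewrite -IA; exact: H.
  apply: (theory_closed (L := [Sent (Not (All s A)) f])) => [d [<-|] //|D tau].
  apply: nd_raa; apply: nd_impE; first by apply: nd_hyp; right; left; reflexivity.
  apply/nd_allI/nd_raa; apply: nd_impE; first by apply: nd_hyp; right; left; reflexivity.
  apply: (nd_exI (a := x0)); apply: nd_hyp; left.
  exact: (eq_sym (inst_up_shift (Not (sub_fm (up_sub (fun t v => ninst tau (f t v))) A)))).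
- split=> [[a]|/theory_ex[i]]; last by rewrite -IA; exists (NC s i).
  rewrite IA => iA; apply: (theory_closed (L := [Sent A (a .: f)])) => [d [<-|] //|D tau].
  by rewrite /= sinst_scons; apply/(nd_exI (a := ninst tau a))/nd_hyp; left.
Qed.
End Completeness.

(** A closed term of every type makes it possible to remove the Henkin constants in the empty
    context. *)
Fixpoint default_tm (t : ty) : tm [] t :=
  match t with
  | ty0 => zero
  | Arr s t => Cst (Pi t s) @ default_tm t
  end.

Lemma sub_nil D (B : fm []) (r : sub [] D) (r' : ren [] D) : sub_fm r B = ren_fm r' B.
Proof. by rewrite -sub_Var_fm; congr (sub_fm _ B); exact: nil_env_eq. Qed.

Theorem completeness (T : theory) (A : fm []) :
  (forall S : structure, (forall B, T B -> sat (nil_env (dom S)) B) ->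
     sat (nil_env (dom S)) A) ->
  proves T A.
Proof.
move=> H; apply: NNPP => nA.
pose L0 := [Sent (Not A) (nil_env ntm)].
have c0 : ~ incons T L0.
  move=> /(_ [] (fun s _ => default_tm s)) /= i0; apply/nA/nd_raa.
  suff E : sinst (fun s _ => default_tm s) (Sent (Not A) (nil_env ntm)) = Not A.
    by rewrite E in i0.
  by rewrite -[RHS]sub_fm_id; congr (sub_fm _ (Not A)); exact: nil_env_eq.
have {}H : theory_of T L0 (Sent A (nil_env ntm)).
  apply/henkin_sat => //; apply: H => B TB; apply/henkin_sat => //.
  apply: (theory_closed c0 (L := [])) => // D tau.
  by rewrite /sinst (sub_nil _ _ (nil_env (var D))); apply: nd_ax.
have : theory_of T L0 (Sent (Not A) (nil_env ntm)) by exists 0; left.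
by rewrite theory_not.
Qed.

(** * The quotient by extensional equality *)

Section Quotient.
Variable S : structure.

Fixpoint eqv t : dom S t -> dom S t -> Prop :=
  match t with
  | ty0 => fun a b => eq0 a b
  | Arr s t => fun a b => forall x : dom S s, eqv (capp a x) (capp b x)
  end.

Lemma sat_eq_at G (f : env (dom S) G) t (a b : tm G t) :
  sat f (eq_at a b) <-> eqv (ev f a) (ev f b).
Proof.
elim: t G f a b => //= s _ t IH G f a b.
by split=> H x; move: (H x); rewrite IH /= !ev_wk.
Qed.

Hypothesis eq0_refl : forall a : dom S ty0, eq0 a a.
Hypothesis eq0_sym : forall a b : dom S ty0, eq0 a b -> eq0 b a.
Hypothesis eq0_trans : forall a b c : dom S ty0, eq0 a b -> eq0 b c -> eq0 a c.
Hypothesis lt0_eq0 : forall a a' b b' : dom S ty0,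
  eq0 a a' -> eq0 b b' -> lt0 a b -> lt0 a' b'.
Hypothesis ext : forall s t (a : dom S (s --> t)) x y,
  eqv x y -> eqv (capp a x) (capp a y).

Lemma eqv_refl t (a : dom S t) : eqv a a.
Proof. by elim: t a => [|s _ t IH] a //= x. Qed.

Lemma eqv_sym t (a b : dom S t) : eqv a b -> eqv b a.
Proof. by elim: t a b => [a b /eq0_sym //|s _ t IH a b H x]; exact: IH. Qed.

Lemma eqv_trans t (a b c : dom S t) : eqv a b -> eqv b c -> eqv a c.
Proof.
elim: t a b c => [|s _ t IH] a b c H H'; first exact: eq0_trans H H'.
by move=> x; apply: IH (H x) (H' x).
Qed.

Definition canon t (a : dom S t) : dom S t := epsilon (inhabits a) (eqv a).

Lemma canon_eqv t (a : dom S t) : eqv a (canon a).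
Proof. by apply: (epsilon_spec (inhabits a) (eqv a)); exists a; exact: eqv_refl. Qed.

Lemma canonE t (a b : dom S t) : eqv a b -> canon a = canon b.
Proof.
move=> ab; rewrite /canon (_ : inhabits a = inhabits b); last exact: proof_irrelevance.
congr (epsilon _ _); apply: functional_extensionality => c; apply: propositional_extensionality.
by split=> H; [apply: eqv_trans (eqv_sym ab) H|apply: eqv_trans ab H].
Qed.

Definition qdom t := {a : dom S t | canon a = a}.

Definition cls t (a : dom S t) : qdom t := exist _ (canon a) (canonE (eqv_sym (canon_eqv a))).

Lemma cls_eq t (a b : dom S t) : cls a = cls b <-> eqv a b.
Proof.
split=> [[E]|/canonE E].
  by apply: eqv_trans (canon_eqv a) _; rewrite E; apply/eqv_sym/canon_eqv.
by apply: eq_sig_hprop => // *; exact: proof_irrelevance.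
Qed.

Lemma cls_val t (u : qdom t) : cls (proj1_sig u) = u.
Proof.
by case: u => a /= E; apply: eq_sig_hprop => // *; exact: proof_irrelevance.
Qed.

Definition quotient : structure :=
  @Structure qdom
    (fun s t u v => cls (capp (proj1_sig u) (proj1_sig v)))
    (fun t c => cls (ccst S c))
    eq
    (fun u v => lt0 (proj1_sig u) (proj1_sig v)).

Lemma capp_cls s t (a : dom S (s --> t)) b :
  capp (s0 := quotient) (cls a) (cls b) = cls (capp a b).
Proof.
apply/cls_eq; apply: eqv_trans (ext _ (eqv_sym (canon_eqv b))) => /=.
exact: (eqv_sym (canon_eqv a)).
Qed.

Lemma ev_quotient G (f : env (dom S) G) t (a : tm G t) :
  ev (S := quotient) (fun t v => cls (f t v)) a = cls (ev f a).
Proof.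
elim: t / a => // s t a IHa b IHb.
by rewrite -[RHS]capp_cls -IHa -IHb.
Qed.

Lemma sat_quotient G (A : fm G) (f : env (dom S) G) :
  sat (S := quotient) (fun t v => cls (f t v)) A <-> sat f A.
Proof.
elim: G / A f => //= [G a b|G a b|G A IA B IB|G A IA B IB|G A IA B IB|G s A IA|G s A IA]
  f; rewrite ?IA ?IB ?ev_quotient //.
- exact: cls_eq.
- have E c : eq0 c (canon c) := @canon_eqv ty0 c.
  by split; apply: lt0_eq0 => //; exact/eq0_sym.
- split=> H x; first by move: (H (cls x)); rewrite -(scons_comp cls) IA.
  by rewrite -(cls_val x) -(scons_comp cls) IA.
- split=> -[x H]; last by exists (cls x); rewrite -(scons_comp cls) IA.
  by exists (proj1_sig x); rewrite -IA (scons_comp cls) cls_val.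
Qed.

Lemma quotient_ext s t (u v : dom quotient (s --> t)) :
  (forall x, capp u x = capp v x) -> u = v.
Proof.
move=> H; rewrite -(cls_val u) -(cls_val v); apply/cls_eq => x.
by apply/cls_eq; rewrite -!capp_cls !cls_val.
Qed.
End Quotient.

(** * Extensional models of the base theory *)

Definition zeroM (M : structure) : dom M ty0 := ccst M Zero.
Definition oneM (M : structure) : dom M ty0 := ccst M One.
Definition addM (M : structure) (a b : dom M ty0) : dom M ty0 := capp (capp (ccst M Plus) a) b.
Definition mulM (M : structure) (a b : dom M ty0) : dom M ty0 := capp (capp (ccst M Times) a) b.

(** The axioms as closure conditions on an extensional structure: equality of type 0 is identity,
    and choice is kept for matrices of the form [h x y = 0]. *)
Record rca (M : structure) : Prop := {
  rca_eq : forall a b : dom M ty0, eq0 a b <-> a = b;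
  rca_ext : forall s t (a b : dom M (s --> t)), (forall x, capp a x = capp b x) -> a = b;
  rca_Pi : forall r s (a : dom M r) (b : dom M s), capp (capp (ccst M (Pi r s)) a) b = a;
  rca_Sigma : forall r s t (a : dom M (r --> s --> t)) (b : dom M (r --> s)) c,
    capp (capp (capp (ccst M (Sigma r s t)) a) b) c = capp (capp a c) (capp b c);
  rca_Rec_zero : forall f m, capp (capp (capp (ccst M (Rec ty0)) f) m) (zeroM M) = m;
  rca_Rec_succ : forall f m n,
    capp (capp (capp (ccst M (Rec ty0)) f) m) (addM n (oneM M))
    = capp (capp f n) (capp (capp (capp (ccst M (Rec ty0)) f) m) n);
  rca_arith : forall A, In A arith_axioms -> forall f : env (dom M) _, sat f A;
  rca_ind : forall G (A : fm (ty0 :: G)) (f : env (dom M) G), qf A ->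
    sat (zeroM M .: f) A ->
    (forall n, sat (n .: f) A -> sat (addM n (oneM M) .: f) A) ->
    forall n, sat (n .: f) A;
  rca_ac : forall h : dom M (ty1 --> ty0 --> ty0),
    (forall x, exists y, capp (capp h x) y = zeroM M) ->
    exists Y : dom M (ty1 --> ty0), forall x, capp (capp h x) (capp Y x) = zeroM M }.

Lemma sat_eq_at_ext (M : structure) G (f : env (dom M) G) t (a b : tm G t) :
  (forall a b : dom M ty0, eq0 a b <-> a = b) ->
  (forall s t (a b : dom M (s --> t)), (forall x, capp a x = capp b x) -> a = b) ->
  sat f (eq_at a b) <-> ev f a = ev f b.
Proof.
move=> Eq0 ext; rewrite sat_eq_at.
elim: t {a b} (ev f a) (ev f b) => [a b|s _ t IH a b]; first exact: Eq0.
by split=> [H|-> x]; [apply: ext => x; apply/IH/H|apply/IH].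
Qed.

Lemma sat_rca (M : structure) :
  (forall a b : dom M ty0, eq0 a b <-> a = b) ->
  (forall s t (a b : dom M (s --> t)), (forall x, capp a x = capp b x) -> a = b) ->
  (forall A, RCA0w A -> sat (nil_env (dom M)) A) -> rca M.
Proof.
move=> Eq0 ext H; split=> //.
- move=> r s a b; exact: (proj1 (sat_eq_at_ext _ _ _ Eq0 ext) (H _ (ax_Pi r s) a b)).
- move=> r s t a b c; exact: (proj1 (sat_eq_at_ext _ _ _ Eq0 ext) (H _ (ax_Sigma r s t) a b c)).
- by move=> f m; have /= := H _ ax_Rec0_zero f m; rewrite Eq0.
- by move=> f m n; have /= := H _ ax_Rec0_succ f m n; rewrite Eq0.
- by move=> A inA f; have := H _ (ax_arith inA); rewrite sat_closure.
- move=> G A f qA A0 AS n; have := H _ (ax_ind qA).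
  rewrite sat_closure => /(_ f) ind.
  apply: ind => [|m /AS Am]; first exact/sat_inst.
  apply/sat_sub; move: Am; congr (sat _ A).
  by apply: env_ext => t v; elim/var_case: t / v.
- move=> h hh.
  have /= := H _ (ax_qfac10 (G := [ty1 --> ty0 --> ty0]) (A := x2 @ x1 @ x0 == zero) I) h.
  case=> [x|Y HY]; last by exists Y => x; apply/Eq0/HY.
  by case: (hh x) => y Hy; exists y; apply/Eq0.
Qed.

Lemma quotient_rca (S : structure) :
  (forall A, RCA0w A -> sat (nil_env (dom S)) A) ->
  exists M : structure, rca M /\ forall A, sat (nil_env (dom M)) A <-> sat (nil_env (dom S)) A.
Proof.
move=> H.
have arith A : In A arith_axioms -> forall f : env (dom S) _, sat f A.
  by move=> inA f; have := H _ (ax_arith inA); rewrite sat_closure.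
pose e a b c : env (dom S) [ty0; ty0; ty0] := a .: (b .: (c .: nil_env _)).
have refl (a : dom S ty0) : eq0 a a.
  by have := arith _ (or_introl eq_refl) (e a a a).
have sym (a b : dom S ty0) : eq0 a b -> eq0 b a.
  by have := arith _ (or_intror (or_introl eq_refl)) (e a b a).
have trans (a b c : dom S ty0) : eq0 a b -> eq0 b c -> eq0 a c.
  by have := arith _ (or_intror (or_intror (or_introl eq_refl))) (e a b c).
have lt1 (a b c : dom S ty0) : eq0 a b -> lt0 a c -> lt0 b c.
  by have := arith _ (or_intror (or_intror (or_intror (or_introl eq_refl)))) (e a b c).
have lt2 (a b c : dom S ty0) : eq0 a b -> lt0 c a -> lt0 c b.
  by have := arith _ (or_intror (or_intror (or_intror (or_intror (or_introl eq_refl)))))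
    (e a b c).
have lt_eq (a a' b b' : dom S ty0) : eq0 a a' -> eq0 b b' -> lt0 a b -> lt0 a' b'.
  by move=> Ea Eb /(lt1 _ _ _ Ea); exact: lt2.
have ext s t (a : dom S (s --> t)) x y : eqv x y -> eqv (capp a x) (capp a y).
  pose f : env (dom S) [s; s; s --> t] := y .: (x .: (a .: nil_env _)).
  move=> xy; apply/(sat_eq_at f (x2 @ x1) (x2 @ x0)).
  by apply: (H _ (ax_ext s t) a x y); apply/(sat_eq_at f x1 x0).
have satQ A : sat (nil_env (dom (quotient refl sym trans))) A <-> sat (nil_env (dom S)) A.
  rewrite -(sat_quotient refl sym trans lt_eq ext A (nil_env (dom S))).
  by rewrite (nil_env_eq (fun t v => cls _ _ _ _) (nil_env _)).
exists (quotient refl sym trans); split=> //.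
apply: sat_rca => //; first exact: quotient_ext.
by move=> A /H; rewrite satQ.
Qed.

(** * Reals and coding evaluated in a model *)

Section Reals.
Variable M : structure.
Notation N := (dom M ty0).
Infix "+" := (@addM M).
Infix "*" := (@mulM M).
Notation "0" := (zeroM M).
Notation "1" := (oneM M).

Definition pairM (a b : N) : N := (a + b) * (a + b) + a.
Definition ratM (a b c : N) : N := pairM (pairM a b) c.
Definition leM (a b : N) : Prop := lt0 a b \/ a = b.

Definition cmpM (rel : N -> N -> Prop) (q r d p : N) : Prop :=
  exists a b c a' b' c', q = ratM a b c /\ r = ratM a' b' c' /\
    rel (p * (a * (c' + 1) + b' * (c + 1)))
        (p * (b * (c' + 1) + a' * (c + 1)) + d * ((c + 1) * (c' + 1))).

Definition powM : dom M ty1 := ev (nil_env (dom M)) (lam (pow2 x0)).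

Definition is_realM (x : N -> N) : Prop := forall n i,
  cmpM lt0 (x n) (x (n + i)) 1 (capp powM n) /\ cmpM lt0 (x (n + i)) (x n) 1 (capp powM n).
Definition leRM (x y : N -> N) : Prop := forall n,
  cmpM leM (x n) (y n) (1 + 1) (capp powM n).
Definition in01M (x : N -> N) : Prop :=
  is_realM x /\ leRM (fun _ => ratM 0 0 0) x /\ leRM x (fun _ => ratM 1 0 0).
Definition eqRM (x y : N -> N) : Prop := leRM x y /\ leRM y x.

Hypothesis R : rca M.

Lemma ev_lam G s t (a : tm (s :: G) t) (f : env (dom M) G) x :
  capp (ev f (lam a)) x = ev (x .: f) a.
Proof.
elim: t / a => [t v|t c|u t a IHa b IHb] /=.
- elim/var_case: t / v => [|t v] /=; last by rewrite (rca_Pi R).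
  by rewrite (rca_Sigma R) !(rca_Pi R).
- by rewrite (rca_Pi R).
- by rewrite (rca_Sigma R) IHa IHb.
Qed.

Lemma rec0_zero G (f : env (dom M) G) h m n :
  ev f n = 0 -> ev f (rec0 h m n) = ev f m.
Proof. by move=> /= ->; rewrite (rca_Rec_zero R). Qed.

Lemma rec0_succ G (f : env (dom M) G) (a : tm (ty0 :: ty0 :: G) ty0) m n k :
  ev f n = k + 1 ->
  ev f (rec0 (lam (lam a)) m n)
  = ev (capp (capp (capp (ccst M (Rec ty0)) (ev f (lam (lam a)))) (ev f m)) k .: (k .: f)) a.
Proof. by move=> /= ->; rewrite (rca_Rec_succ R) !ev_lam. Qed.

Lemma powM0 : capp powM 0 = 1.
Proof. by rewrite /powM ev_lam /pow2 rec0_zero. Qed.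

Lemma powMS n : capp powM (n + 1) = capp powM n + capp powM n.
Proof. by rewrite /powM !ev_lam /pow2 (rec0_succ _ _ (k := n)). Qed.

Lemma ev_pow2 G (f : env (dom M) G) n : ev f (pow2 n) = capp powM (ev f n).
Proof.
by rewrite /powM ev_lam.
Qed.

Lemma sat_Le G (f : env (dom M) G) a b : sat f (Le a b) <-> leM (ev f a) (ev f b).
Proof. by rewrite /= (rca_eq R). Qed.

Lemma sat_cmpQ (rel : forall G, tm G ty0 -> tm G ty0 -> fm G) relM :
  (forall G (f : env (dom M) G) a b, sat f (rel _ a b) <-> relM (ev f a) (ev f b)) ->
  forall G (f : env (dom M) G) q r d p,
  sat f (cmpQ rel q r d p) <-> cmpM relM (ev f q) (ev f r) (ev f d) (ev f p).
Proof.
move=> relE G f q r d p.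
split=> -[a [b [c [a' [b' [c' [Hq [Hr Hrel]]]]]]]]; exists a, b, c, a', b', c'.
  move/(rca_eq R): Hq; move/(rca_eq R): Hr; move/relE: Hrel.
  by rewrite /= !ev_wk.
by split; [apply/(rca_eq R)|split; [apply/(rca_eq R)|apply/relE]]; rewrite /= !ev_wk.
Qed.

Lemma sat_is_real G (f : env (dom M) G) x :
  sat f (is_real x) <-> is_realM (capp (ev f x)).
Proof.
have lt_sat G' (g : env (dom M) G') a b : sat g (Lt a b) <-> lt0 (ev g a) (ev g b) by [].
set q : tm (ty0 :: ty0 :: G) ty0 := wk (wk x) @ x1.
set r : tm (ty0 :: ty0 :: G) ty0 := wk (wk x) @ (x1 +' x0).
have -> : sat f (is_real x) = forall n i,
    sat (i .: (n .: f)) (cmpQ Lt q r one (pow2 x1)) /\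
    sat (i .: (n .: f)) (cmpQ Lt r q one (pow2 x1)) by [].
split=> H n i; have [H1 H2] := H n i.
  by split; [move/(sat_cmpQ lt_sat): H1|move/(sat_cmpQ lt_sat): H2];
    rewrite ev_pow2 /= !ev_wk.
by split; apply/(sat_cmpQ lt_sat); rewrite ev_pow2 /= !ev_wk.
Qed.

Lemma sat_leR G (f : env (dom M) G) x y :
  sat f (leR x y) <-> leRM (capp (ev f x)) (capp (ev f y)).
Proof.
split=> H n; first by move/(sat_cmpQ sat_Le): (H n); rewrite ev_pow2 /= !ev_wk.
by apply/(sat_cmpQ sat_Le); rewrite ev_pow2 /= !ev_wk; exact: H.
Qed.

Lemma sat_eqR G (f : env (dom M) G) x y :
  sat f (eqR x y) <-> eqRM (capp (ev f x)) (capp (ev f y)).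
Proof.
split=> [H|[H1 H2] n].
  by split=> n; case: (H n) => /(sat_cmpQ sat_Le) H1 /(sat_cmpQ sat_Le) H2;
    [move: H1|move: H2]; rewrite ev_pow2 /= !ev_wk.
by split; apply/(sat_cmpQ sat_Le); rewrite ev_pow2 /= !ev_wk; [exact: H1|exact: H2].
Qed.

Lemma sat_in01 G (f : env (dom M) G) x :
  sat f (in01 x) <-> in01M (capp (ev f x)).
Proof.
rewrite /in01 -/(sat f (is_real x)).
have z : capp (ev f zeroR) = fun _ => ratM 0 0 0.
  by apply: functional_extensionality => n; rewrite /zeroR ev_lam.
have o : capp (ev f oneR) = fun _ => ratM 1 0 0.
  by apply: functional_extensionality => n; rewrite /oneR ev_lam.
have -> : sat f (is_real x &' leR zeroR x &' leR x oneR)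
  = (sat f (is_real x) /\ sat f (leR zeroR x) /\ sat f (leR x oneR)) by [].
by rewrite sat_is_real !sat_leR z o.
Qed.

Lemma sat_NBI :
  (forall Y : dom M ty2,
     (forall x y, in01M (capp x) -> in01M (capp y) -> eqRM (capp x) (capp y) ->
        capp Y x = capp Y y) ->
     (exists x y, in01M (capp x) /\ in01M (capp y) /\ ~ eqRM (capp x) (capp y) /\
        capp Y x = capp Y y) \/
     (exists n, forall x, in01M (capp x) -> capp Y x <> n)) ->
  sat (nil_env (dom M)) NBI.
Proof.
move=> H Y HY; case: (H Y) => [x y x01 y01 xy|[x [y [x01 [y01 [xy E]]]]]|[n Hn]].
- apply/(rca_eq R); apply: (HY x y); [exact/sat_in01|exact/sat_in01|exact/sat_eqR].
- left; exists x, y; split; first exact/sat_in01.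
  split; first exact/sat_in01.
  by split; [move/sat_eqR|apply/(rca_eq R)].
- by right; exists n => x /sat_in01 x01 /(rca_eq R); apply: Hn.
Qed.

Definition cantorM (f : dom M ty1) := forall n, capp f n = 0 \/ capp f n = 1.

Definition codeM (f : dom M ty1) (m n : N) : dom M ty1 :=
  ev (n .: (m .: (f .: nil_env (dom M)))) (code_fmn x2 x1 x0).

Lemma ev_cons1 G (f : env (dom M) G) a h : capp (ev f (cons1 a h)) 0 = ev f a /\
  forall n, capp (ev f (cons1 a h)) (n + 1) = capp (ev f h) n.
Proof.
rewrite /cons1; split=> [|n]; rewrite ev_lam; first by rewrite rec0_zero // ev_wk.
by rewrite (rec0_succ _ _ (k := n)) //= !ev_wk.
Qed.

(** The term [cons1 a h] depends on its context; extensionality of the model shows that its value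
    depends only on the values of a and h. This lets [codeM] be fixed in one context. *)
Lemma ev_cons1_ext G (f : env (dom M) G) a h G' (f' : env (dom M) G') a' h' :
  ev f a = ev f' a' -> ev f h = ev f' h' -> ev f (cons1 a h) = ev f' (cons1 a' h').
Proof.
move=> Ea Eh; apply: (rca_ext R) => k; rewrite /cons1 !ev_lam /rec0.
set b := lam (lam _); set b' := lam (lam _).
suff E : ev (k .: f) b = ev (k .: f') b'.
  rewrite -[LHS]/(capp (capp (capp _ (ev (k .: f) b)) (ev (k .: f) (wk a))) k).
  rewrite -[RHS]/(capp (capp (capp _ (ev (k .: f') b')) (ev (k .: f') (wk a'))) k).
  by rewrite E !ev_wk Ea.
apply: (rca_ext R) => n; apply: (rca_ext R) => r; rewrite /b /b' !ev_lam /=.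
by rewrite !ev_wk Eh.
Qed.

Lemma arithM k (f : env (dom M) _) : Nat.ltb k 19 = true -> sat f (nth k arith_axioms Bot).
Proof. by move/PeanoNat.Nat.ltb_lt=> lt_k; apply: (rca_arith R); apply: nth_In. Qed.

Definition env3 (a b c : N) : env (dom M) [ty0; ty0; ty0] :=
  a .: (b .: (c .: nil_env _)).

Lemma addMC (a b : N) : a + b = b + a.
Proof. by apply/(rca_eq R); exact: (@arithM 6 (env3 a b a) eq_refl). Qed.

Lemma addM0 (a : N) : a + 0 = a.
Proof. by apply/(rca_eq R); exact: (@arithM 7 (env3 a a a) eq_refl). Qed.

Lemma codeM_spec f m n : capp (codeM f m n) 0 = m /\ capp (codeM f m n) 1 = n /\
  forall i, capp (codeM f m n) (i + 1 + 1) = capp f i.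
Proof.
rewrite /codeM /code_fmn.
set g := _ .: _; have [H0 HS] := ev_cons1 g x1 (cons1 x0 x2).
have [H0' HS'] := ev_cons1 g x0 x2; split=> //; split=> [|i]; last by rewrite HS HS'.
by rewrite -(addM0 1) addMC HS H0'.
Qed.

Lemma ev_code_fmn G (f : env (dom M) G) h m n :
  ev (h .: f) (code_fmn x0 (wk m) (wk n)) = codeM h (ev f m) (ev f n).
Proof. by apply: ev_cons1_ext; [|apply: ev_cons1_ext]; rewrite ?ev_wk. Qed.

Lemma sat_NCC_matrix G (f : env (dom M) G) Y n m :
  sat f (NCC_matrix Y n m) <->
  exists h, cantorM h /\ capp (ev f Y) (codeM h (ev f m) (ev f n)) = 0.
Proof.
have EY h : ev (h .: f) (wk Y @ code_fmn x0 (wk m) (wk n))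
    = capp (ev f Y) (codeM h (ev f m) (ev f n)) by rewrite -ev_code_fmn /= ev_wk.
have C h : sat (h .: f) (cantor x0) <-> cantorM h.
  split=> H n'; move: (H n') => [H'|H'];
  by [left; move/(rca_eq R): H'|right; move/(rca_eq R): H'|left; apply/(rca_eq R)|
    right; apply/(rca_eq R)].
split=> -[h [/C H1 H2]]; exists h; split=> //; first by rewrite -EY; apply/(rca_eq R).
by apply/(rca_eq R); rewrite EY.
Qed.

Lemma sat_NCC : sat (nil_env (dom M)) NCC -> forall Y : dom M ty2,
  (forall n, exists m h, cantorM h /\ capp Y (codeM h m n) = 0) ->
  exists g : dom M ty1, forall n, exists h, cantorM h /\ capp Y (codeM h (capp g n) n) = 0.
Proof.
move=> H Y HY; have [|g Hg] := H Y.
  by move=> n; have [m Hm] := HY n; exists m; apply/sat_NCC_matrix.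
by exists g => n; apply: (proj1 (sat_NCC_matrix _ x2 x0 (x1 @ x0)) (Hg n)).
Qed.
End Reals.

(** * Arithmetic in a model: predecessor and truncated subtraction *)

Section Arithmetic.
Variable M : structure.
Hypothesis R : rca M.
Notation N := (dom M ty0).
Infix "+" := (@addM M).
Infix "*" := (@mulM M).
Infix "<" := (@lt0 M).
Notation "0" := (zeroM M).
Notation "1" := (oneM M).

Notation arith k a b c := (@arithM M R k (env3 a b c) eq_refl).

Lemma addMA (a b c : N) : (a + b) + c = a + (b + c).
Proof. by apply/(rca_eq R); exact: (arith 5 a b c). Qed.
Lemma mulMA (a b c : N) : (a * b) * c = a * (b * c).
Proof. by apply/(rca_eq R); exact: (arith 8 a b c). Qed.
Lemma mulMC (a b : N) : a * b = b * a.
Proof. by apply/(rca_eq R); exact: (arith 9 a b a). Qed.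
Lemma mulM1 (a : N) : a * 1 = a.
Proof. by apply/(rca_eq R); exact: (arith 10 a a a). Qed.
Lemma mulM0 (a : N) : a * 0 = 0.
Proof. by apply/(rca_eq R); exact: (arith 11 a a a). Qed.
Lemma mulMD (a b c : N) : a * (b + c) = a * b + a * c.
Proof. by apply/(rca_eq R); exact: (arith 12 a b c). Qed.
Lemma ltM_irr (a : N) : ~ a < a.
Proof. exact: (arith 13 a a a). Qed.
Lemma ltM_trans (a b c : N) : a < b -> b < c -> a < c.
Proof. exact: (arith 14 a b c). Qed.
Lemma ltM_tri (a b : N) : a < b \/ a = b \/ b < a.
Proof. by case: (arith 15 a b a) => [|[/(rca_eq R)|]]; [left|right; left|right; right]. Qed.
Lemma ltM01 : 0 < 1.
Proof. exact: (arith 16 0 0 0). Qed.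
Lemma ltM_add (a b c : N) : a < b -> a + c < b + c.
Proof. exact: (arith 17 a b c). Qed.
Lemma ltM_mul (a b c : N) : 0 < c -> a < b -> a * c < b * c.
Proof. exact: (arith 18 a b c). Qed.

Lemma addIM (a b c : N) : a + c = b + c -> a = b.
Proof.
move=> E; case: (ltM_tri a b) => [H|[//|H]]; move: (ltM_add c H); rewrite E;
  by move/ltM_irr.
Qed.

Lemma ltMS (n : N) : n < n + 1.
Proof. by move: (ltM_add n ltM01); rewrite (addMC R) (addM0 R) (addMC R). Qed.

(** That 0 is the least number is not among the arithmetical axioms and has to come from
    induction. *)
Lemma geM0 (n : N) : 0 = n \/ 0 < n.
Proof.
have := @rca_ind M R [] (Or (Eq zero x0) (Lt zero x0)) (nil_env _) (conj I I).
case/(_ _ _ n) => [|m IH|/(rca_eq R)|]; [|right|by left|by right].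
  by left; apply/(rca_eq R).
case: IH => [/(rca_eq R)|] /= H; last exact: ltM_trans H (ltMS m).
by rewrite -[X in addM X]H; exact: ltMS.
Qed.

Definition predT G (a : tm G ty0) : tm G ty0 := rec0 (lam (lam x1)) zero a.
Definition monusT G (a b : tm G ty0) : tm G ty0 := rec0 (lam (lam (predT x0))) a b.
Definition predM : dom M ty1 := ev (nil_env (dom M)) (lam (predT x0)).
Definition monusM : dom M (ty0 --> ty0 --> ty0) :=
  ev (nil_env (dom M)) (lam (lam (monusT x1 x0))).
Definition monM (a b : N) : N := capp (capp monusM a) b.

Lemma predM0 : capp predM 0 = 0.
Proof. by rewrite /predM ev_lam // /predT rec0_zero. Qed.

Lemma predMS n : capp predM (n + 1) = n.
Proof. by rewrite /predM ev_lam // /predT (rec0_succ R _ _ (k := n)). Qed.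

Lemma monM0 a : monM a 0 = a.
Proof. by rewrite /monM /monusM !ev_lam // /monusT rec0_zero. Qed.

Lemma monMS a b : monM a (b + 1) = capp predM (monM a b).
Proof.
by rewrite /monM /monusM !ev_lam // {1}/monusT (rec0_succ R _ _ (k := b)) //.
Qed.

Lemma zero_or_succ (n : N) : n = 0 \/ n = capp predM n + 1.
Proof.
have := @rca_ind M R [ty1] (Or (Eq x0 zero) (Eq x0 (succ (x1 @ x0))))
  (predM .: nil_env _) (conj I I).
case/(_ _ _ n) => [|m _|/(rca_eq R)|/(rca_eq R)]; [|right|by left|by right].
  by left; apply/(rca_eq R).
by apply/(rca_eq R); rewrite /= -/(addM m 1) -/(zeroM M) predMS.
Qed.

(** Induction on b with a fixed: passing from m < a to m + 1 moves one unit from the difference,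
    which cannot be 0 there, to the left summand. *)
Lemma leM_monus (a b : N) : leM b a -> b + monM a b = a.
Proof.
have := @rca_ind M R [ty0; ty0 --> ty0] (Imp (Or (Lt x0 x1) (Eq x0 x1))
  (Eq (plus x0 (x2 @ x0)) x1)) (a .: (capp monusM a .: nil_env _)) (conj (conj I I) I).
move=> /(_ _ _ b) ind ba; apply/(rca_eq R); apply: ind => [|m IH|].
- by move=> _; apply/(rca_eq R); rewrite /= -/(monM a 0) monM0 -/(addM _ _) (addMC R) (addM0 R).
- move=> /= H; apply/(rca_eq R); rewrite -[LHS]/(m + 1 + monM a (m + 1)) monMS.
  have lt_ma : m < a.
    case: H => [|/(rca_eq R) <-]; last exact: ltMS.
    exact: ltM_trans (ltMS m).
  move: (IH (or_introl lt_ma)) => /(rca_eq R) E; change (m + monM a m = a) in E.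
  case: (zero_or_succ (monM a m)) E => [->|E'] E.
    by move: E; rewrite (addM0 R) => E; case: (ltM_irr (a := a)); rewrite -{1}E.
  by rewrite addMA (addMC R 1) -E'.
- by case: ba => [|->]; [left|right; apply/(rca_eq R)].
Qed.

Lemma monM_addr (a d : N) : monM a (a + d) = 0.
Proof.
have := @rca_ind M R [ty0; ty0 --> ty0] (Eq (x2 @ plus x1 x0) zero)
  (a .: (capp monusM a .: nil_env _)) I.
move=> /(_ _ _ d) H; apply/(rca_eq R); apply: H => [|n] /=.
  rewrite -/(addM a 0) -/(monM a (a + 0)) (addM0 R); apply/(rca_eq R).
  have E := @leM_monus a a (or_intror eq_refl).
  by apply: (@addIM _ _ a); rewrite (addMC R) E (addMC R) (addM0 R).
move=> /(rca_eq R) E; change (monM a (a + n) = 0) in E.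
apply/(rca_eq R); change (monM a (a + (n + 1)) = 0).
by rewrite -addMA monMS E predM0.
Qed.

Lemma subM (a b : N) : a < b -> exists d, b = a + d + 1.
Proof.
move=> ab; have E := leM_monus (or_introl ab).
case: (zero_or_succ (monM b a)) => H.
  by move: ab; rewrite -{1}E H (addM0 R) => /ltM_irr.
by exists (capp predM (monM b a)); rewrite addMA -H.
Qed.

Definition osrM : osr := @Osr N 0 1 (@addM M) (@mulM M) (@lt0 M)
  addMA (addMC R) (addM0 R) mulMA mulMC mulM1 mulM0 mulMD
  ltM_irr ltM_trans ltM_tri ltM01 ltM_add ltM_mul geM0 subM.

Lemma monM_eq0 (a b : N) : monM a b = 0 <-> leM a b.
Proof.
split=> [E|[/subM[d ->]|<-]]; last by rewrite -{2}(addM0 R a) monM_addr.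
  case: (ltM_tri a b) => [?|[?|ba]]; [by left|by right|].
  by have := leM_monus (or_introl ba); rewrite E (addM0 R) => H; right.
by rewrite addMA monM_addr.
Qed.
End Arithmetic.

End Syntax.

(** * Rationals, reals and the diagonal argument inside a model *)

Module Analysis.
Import all_boot all_order all_algebra ring lra.
Import Defs(ty, ty0, Arr, ty1, ty2, ctx, var, vz, vs, cst, Zero, One, Plus, Times,
  Pi, Sigma, Rec, scons, tm, Var, App, Cst, fm, Eq, zero).
Import Fractions FracField Syntax.
Import GRing.Theory Num.Theory Order.TTheory.
Local Open Scope ring_scope.
Unset Asymmetric Patterns.

(** * Definability in a model *)

Section Definability.
Variable M : structure.
Hypothesis R : rca M.

(** Terms with parameters from the model. Combinatory abstraction [plam] shows that each function
    given by such a term is represented by an element. *)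
Inductive pt (G : ctx) : ty -> Type :=
| PV t : var G t -> pt G t
| PP t : dom M t -> pt G t
| PA s t : pt G (Arr s t) -> pt G s -> pt G t.
Arguments PV {G t}.
Arguments PP {G t}.
Arguments PA {G s t}.

Fixpoint evp G (f : env (dom M) G) t (a : pt G t) : dom M t :=
  match a with
  | PV v => f _ v
  | PP d => d
  | PA a b => capp (evp f a) (evp f b)
  end.

Fixpoint plam G s t (a : pt (s :: G) t) : pt G (Arr s t) :=
  match a with
  | PV v => scons (P := fun t => pt G (Arr s t))
      (PA (PA (PP (ccst M (Sigma s (Arr s s) s))) (PP (ccst M (Pi s (Arr s s)))))
         (PP (ccst M (Pi s s))))
      (fun t v => PA (PP (ccst M (Pi t s))) (PV v)) v
  | PP d => PA (PP (ccst M (Pi _ s))) (PP d)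
  | PA a b => PA (PA (PP (ccst M (Sigma _ _ _))) (plam a)) (plam b)
  end.

Lemma evp_plam G s t (a : pt (s :: G) t) (f : env (dom M) G) x :
  capp (evp f (plam a)) x = evp (x .: f) a.
Proof.
elim: t / a => [t v|t d|u t a IHa b IHb] /=.
- elim/var_case: t / v => [|t v] /=; last by rewrite (rca_Pi R).
  by rewrite (rca_Sigma R) !(rca_Pi R).
- by rewrite (rca_Pi R).
- by rewrite (rca_Sigma R) IHa IHb.
Qed.

Definition Def G t (F : env (dom M) G -> dom M t) : Prop :=
  exists a : pt G t, forall f, evp f a = F f.

Lemma Def_var G t (v : var G t) : Def (fun f => f t v).
Proof. by exists (PV v). Qed.

Lemma Def_const G t (d : dom M t) : Def (fun _ : env (dom M) G => d).
Proof. by exists (PP d). Qed.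

Lemma Def_app G s t (F : env (dom M) G -> dom M (Arr s t)) X :
  Def F -> Def X -> Def (fun f => capp (F f) (X f)).
Proof. by move=> [a Ha] [b Hb]; exists (PA a b) => f /=; rewrite Ha Hb. Qed.

Lemma Def_ex1 s t (F : dom M s -> dom M t) :
  Def (G := [:: s]) (fun f => F (f s vz)) -> exists h, forall x, capp h x = F x.
Proof. by move=> [a Ha]; exists (evp (nil_env _) (plam a)) => x; rewrite evp_plam Ha. Qed.

Lemma Def_ex2 s u t (F : dom M s -> dom M u -> dom M t) :
  Def (G := [:: u; s]) (fun f => F (f s (vs vz)) (f u vz)) ->
  exists h, forall x y, capp (capp h x) y = F x y.
Proof.
by move=> [a Ha]; exists (evp (nil_env _) (plam (plam a))) => x y; rewrite !evp_plam Ha.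
Qed.

Lemma Def_ex3 s u w t (F : dom M s -> dom M u -> dom M w -> dom M t) :
  Def (G := [:: w; u; s]) (fun f => F (f s (vs (vs vz))) (f u (vs vz)) (f w vz)) ->
  exists h, forall x y z, capp (capp (capp h x) y) z = F x y z.
Proof.
move=> [a Ha]; exists (evp (nil_env _) (plam (plam (plam a)))) => x y z.
by rewrite !evp_plam Ha.
Qed.

Notation N := (dom M ty0).
Local Notation "a .+ b" := (@addM M a b) (at level 50, left associativity).
Local Notation "a .* b" := (@mulM M a b) (at level 40, left associativity).
Local Notation O := (zeroM M).
Local Notation I := (oneM M).
Local Notation mon := (@monM M).

Ltac def := repeat first
  [ exact: Def_const | exact: Def_var | apply: Def_app ].

Definition recM (h : dom M (Arr ty0 (Arr ty0 ty0))) m n : N :=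
  capp (capp (capp (ccst M (Rec ty0)) h) m) n.

Lemma rec_exists (F : N -> N -> N) (m : N) :
  (exists h, forall x y, capp (capp h x) y = F x y) ->
  exists s : dom M ty1, capp s O = m /\ forall n, capp s (n .+ I) = F n (capp s n).
Proof.
move=> [h Hh]; have [s Hs] : exists s : dom M ty1, forall n, capp s n = recM h m n.
  by apply: Def_ex1; rewrite /recM; def.
exists s; rewrite Hs /recM (rca_Rec_zero R); split=> // n.
by rewrite !Hs /recM (rca_Rec_succ R) Hh.
Qed.

Lemma rec_exists1 t (F : dom M t -> N -> N -> N) (m : N) :
  (exists h, forall x y z, capp (capp (capp h x) y) z = F x y z) ->
  exists s : dom M (Arr t ty1), forall x, capp (capp s x) O = m /\
    forall n, capp (capp s x) (n .+ I) = F x n (capp (capp s x) n).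
Proof.
move=> [h Hh].
have [s Hs] : exists s : dom M (Arr t ty1), forall x n, capp (capp s x) n = recM (capp h x) m n.
  by apply: Def_ex2; rewrite /recM; def.
exists s => x; rewrite Hs /recM (rca_Rec_zero R); split=> // n.
by rewrite !Hs /recM (rca_Rec_succ R) Hh.
Qed.

(** * Numerals, definable sequences of fractions and induction *)

Notation K := (fracF (osrM R)).
Definition inj (a : N) : K := @ofnat (osrM R) a.

Lemma inj0 : inj O = 0. Proof. exact: ofnat0. Qed.
Lemma inj1 : inj I = 1. Proof. exact: ofnat1. Qed.
Lemma injD a b : inj (a .+ b) = inj a + inj b. Proof. exact: (@ofnatD (osrM R)). Qed.
Lemma injM a b : inj (a .* b) = inj a * inj b. Proof. exact: (@ofnatM (osrM R)). Qed.
Lemma inj_lt a b : inj a < inj b <-> lt0 a b. Proof. exact: (@ofnat_lt (osrM R)). Qed.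
Lemma inj_le a b : inj a <= inj b <-> leM a b. Proof. exact: (@ofnat_le (osrM R)). Qed.
Lemma inj_inj a b : inj a = inj b -> a = b. Proof. exact: (@ofnat_inj (osrM R)). Qed.
Lemma inj_ge0 a : 0 <= inj a. Proof. exact: (@ofnat_ge0 (osrM R)). Qed.
Definition injE := (injD, injM, inj0, inj1).

Lemma inj_ltS a b : inj a < inj b -> inj a + 1 <= inj b.
Proof.
move=> /inj_lt/(subM R)[d ->]; rewrite !injE; have := inj_ge0 d; lra.
Qed.

Lemma inj_mon a b : inj b <= inj a -> inj (mon a b) = inj a - inj b.
Proof.
by move=> /inj_le/(leM_monus R) E; rewrite -{2}E !injE; ring.
Qed.

Lemma mon_eq0 a b : mon a b = O <-> inj a <= inj b.
Proof. by rewrite (monM_eq0 R); split=> /inj_le. Qed.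

Definition Def1 (F : N -> N) : Prop := exists h : dom M ty1, forall n, capp h n = F n.

Lemma Def1_id : Def1 (fun n => n).
Proof. by apply: Def_ex1; def. Qed.
Lemma Def1_const c : Def1 (fun _ => c).
Proof. by apply: Def_ex1; def. Qed.
Lemma Def1_capp (h : dom M ty1) F : Def1 F -> Def1 (fun n => capp h (F n)).
Proof.
move=> [k Hk]; have [g Hg] : Def1 (fun n => capp h (capp k n)) by apply: Def_ex1; def.
by exists g => n; rewrite Hg Hk.
Qed.
Lemma Def1_op (h : dom M (Arr ty0 ty1)) F G :
  Def1 F -> Def1 G -> Def1 (fun n => capp (capp h (F n)) (G n)).
Proof.
move=> [k Hk] [l Hl].
have [g Hg] : Def1 (fun n => capp (capp h (capp k n)) (capp l n)) by apply: Def_ex1; def.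
by exists g => n; rewrite Hg Hk Hl.
Qed.
Lemma Def1_add F G : Def1 F -> Def1 G -> Def1 (fun n => F n .+ G n).
Proof. exact: Def1_op. Qed.
Lemma Def1_mul F G : Def1 F -> Def1 G -> Def1 (fun n => F n .* G n).
Proof. exact: Def1_op. Qed.
Lemma Def1_mon F G : Def1 F -> Def1 G -> Def1 (fun n => mon (F n) (G n)).
Proof. exact: Def1_op. Qed.
Lemma Def1_comp F G : Def1 F -> Def1 G -> Def1 (fun n => F (G n)).
Proof.
move=> [h Hh] HG; have [k Hk] := Def1_capp h HG.
by exists k => n; rewrite Hk Hh.
Qed.

(** Numerators and denominators come from elements of the model, although the fractions do not.
    Clearing denominators turns a comparison of two such sequences into an equation of type 0, to
    which induction applies. *)
Definition DefQ (u : N -> K) : Prop := exists a b c, Def1 a /\ Def1 b /\ Def1 c /\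
  forall n, u n = (inj (a n) - inj (b n)) / (inj (c n) + 1).

Lemma injS_gt0 c : 0 < inj c + 1.
Proof. have := inj_ge0 c; lra. Qed.
Lemma injS_neq0 c : inj c + 1 != 0.
Proof. by rewrite gt_eqF // injS_gt0. Qed.
Hint Resolve injS_gt0 injS_neq0 : core.

Lemma DefQ_inj F : Def1 F -> DefQ (fun n => inj (F n)).
Proof.
move=> HF; exists F, (fun _ => O), (fun _ => O).
do !split=> //; try exact: Def1_const.
by move=> n; rewrite !inj0 add0r divr1 subr0.
Qed.
Lemma DefQ_opp u : DefQ u -> DefQ (fun n => - u n).
Proof.
move=> [a [b [c [Ha [Hb [Hc E]]]]]]; exists b, a, c; do !split=> //.
by move=> n; rewrite E -mulNr opprB.
Qed.
Lemma DefQ_add u v : DefQ u -> DefQ v -> DefQ (fun n => u n + v n).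
Proof.
move=> [a [b [c [Ha [Hb [Hc E]]]]]] [a' [b' [c' [Ha' [Hb' [Hc' E']]]]]].
exists (fun n => a n .* (c' n .+ I) .+ a' n .* (c n .+ I)),
  (fun n => b n .* (c' n .+ I) .+ b' n .* (c n .+ I)), (fun n => c n .* c' n .+ c n .+ c' n).
do !split; try by repeat first [exact: Def1_const|apply: Def1_add|apply: Def1_mul].
move=> n; rewrite E E' !injE.
have := injS_neq0 (c n); have := injS_neq0 (c' n).
have := injS_neq0 (c n .* c' n .+ c n .+ c' n); rewrite !injE => c0 c1 c2.
by field; apply/and3P.
Qed.
Lemma DefQ_mul u v : DefQ u -> DefQ v -> DefQ (fun n => u n * v n).
Proof.
move=> [a [b [c [Ha [Hb [Hc E]]]]]] [a' [b' [c' [Ha' [Hb' [Hc' E']]]]]].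
exists (fun n => a n .* a' n .+ b n .* b' n),
  (fun n => a n .* b' n .+ b n .* a' n), (fun n => c n .* c' n .+ c n .+ c' n).
do !split; try by repeat first [exact: Def1_const|apply: Def1_add|apply: Def1_mul].
move=> n; rewrite E E' !injE.
have := injS_neq0 (c n); have := injS_neq0 (c' n).
have := injS_neq0 (c n .* c' n .+ c n .+ c' n); rewrite !injE => c0 c1 c2.
by field; apply/and3P.
Qed.
Lemma DefQ_inv F : Def1 F -> DefQ (fun n => (inj (F n) + 1)^-1).
Proof.
move=> HF; exists (fun _ => I), (fun _ => O), F.
by do !split=> //; try exact: Def1_const; move=> n; rewrite !injE subr0 mul1r.
Qed.
Lemma DefQ_const (x : K) : DefQ (fun _ => x).
Proof.
have [a [b [c E]]] : exists a b c, x = (inj a - inj b) / (inj c + 1).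
  exact: (@frac_surj (osrM R)).
exists (fun _ => a), (fun _ => b), (fun _ => c).
by do !split=> //; exact: Def1_const.
Qed.
Lemma DefQ_comp u F : DefQ u -> Def1 F -> DefQ (fun n => u (F n)).
Proof.
move=> [a [b [c [Ha [Hb [Hc E]]]]]] HF.
exists (fun n => a (F n)), (fun n => b (F n)), (fun n => c (F n)).
by do !split=> //; exact: Def1_comp.
Qed.
Lemma DefQ_ext u v : (forall n, u n = v n) -> DefQ v -> DefQ u.
Proof. by move=> E; rewrite (functional_extensionality _ _ E). Qed.

Definition QFP (P : N -> Prop) : Prop := exists2 F, Def1 F & forall n, P n <-> F n = O.

Lemma inj_eq0 a : inj a = 0 <-> a = O.
Proof. by split=> [E|->]; [apply: inj_inj; rewrite E inj0|exact: inj0]. Qed.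

Lemma QFP_le u v : DefQ u -> DefQ v -> QFP (fun n => u n <= v n).
Proof.
move=> [a [b [c [Ha [Hb [Hc E]]]]]] [a' [b' [c' [Ha' [Hb' [Hc' E']]]]]].
exists (fun n => mon (a n .* (c' n .+ I) .+ b' n .* (c n .+ I))
                     (a' n .* (c n .+ I) .+ b n .* (c' n .+ I))).
  by repeat first [exact: Def1_const|apply: Def1_mon|apply: Def1_add|apply: Def1_mul].
move=> n; rewrite mon_eq0 E E' !injE.
rewrite ler_pdivrMr // mulrAC ler_pdivlMr //.
by split; lra.
Qed.
Lemma QFP_and P Q : QFP P -> QFP Q -> QFP (fun n => P n /\ Q n).
Proof.
move=> [F HF EF] [G HG EG]; exists (fun n => F n .+ G n); first exact: Def1_add.
move=> n; rewrite EF EG -!inj_eq0 !injE; have := inj_ge0 (F n); have := inj_ge0 (G n).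
by split=> [[]|]; [lra|split; lra].
Qed.
Lemma QFP_imp P Q : QFP P -> QFP Q -> QFP (fun n => P n -> Q n).
Proof.
(* The factor [mon I (F n)] is 1 if F n = 0 and 0 otherwise, so it switches G off when the premise
   fails. *)
move=> [F HF EF] [G HG EG]; exists (fun n => mon I (F n) .* G n).
  by apply: Def1_mul => //; apply: Def1_mon => //; exact: Def1_const.
move=> n; rewrite EF EG; split=> [H|H E].
  have [E|nE] := classic (F n = O); first by rewrite H // (mulM0 R).
  suff -> : mon I (F n) = O by rewrite (mulMC R) (mulM0 R).
  apply/mon_eq0; rewrite inj1 -[leLHS]add0r -inj0; apply/inj_ltS/inj_lt.
  by case: (geM0 R (F n)) => // E; case: nE.
apply: inj_inj; move/(congr1 inj): H; rewrite E injM inj_mon !injE ?subr0 ?mul1r //.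
Qed.

Lemma qind P : QFP P -> P O -> (forall n, P n -> P (n .+ I)) -> forall n, P n.
Proof.
move=> [F [h Hh] E] P0 PS n; apply/E; rewrite -Hh.
have := @rca_ind M R [:: ty1] (Eq (App (Var (vs vz)) (Var vz)) zero)
  (h .: nil_env _) Logic.I => /(_ _ _ n) ind.
apply/(rca_eq R); apply: ind => [|m] /=.
  by apply/(rca_eq R); rewrite Hh; apply/E.
by move/(rca_eq R) => H; apply/(rca_eq R); rewrite Hh; apply/E/PS/E; rewrite -Hh.
Qed.
End Definability.

(** * Rational codes and reals in a model *)

Section Reals.
Variable M : structure.
Hypothesis R : rca M.

Notation N := (dom M ty0).
Local Notation "a .+ b" := (@addM M a b) (at level 50, left associativity).
Local Notation "a .* b" := (@mulM M a b) (at level 40, left associativity).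
Local Notation O := (zeroM M).
Local Notation I := (oneM M).
Local Notation mon := (@monM M).
Local Notation is_realM := (@is_realM M).
Local Notation leRM := (@leRM M).
Local Notation eqRM := (@eqRM M).
Local Notation in01M := (@in01M M).
Local Notation pairM := (@pairM M).
Local Notation ratM := (@ratM M).
Local Notation K := (fracF (osrM R)).
Local Notation inj := (inj R).
Local Notation injE := (injE R).
Local Notation DefQ := (DefQ (R := R)).
Hint Resolve inj_ge0 : core.

Definition e2 (n : N) : K := (inj (capp (powM M) n))^-1.

Lemma inj_pow0 : inj (capp (powM M) O) = 1.
Proof. by rewrite (powM0 R) inj1. Qed.

Lemma inj_powS n : inj (capp (powM M) (n .+ I)) = 2 * inj (capp (powM M) n).
Proof. rewrite (powMS R) injE; lra. Qed.

Lemma DefQ_pow : DefQ (fun n => inj (capp (powM M) n)).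
Proof. exact: (DefQ_inj _ (Def1_capp R _ (Def1_id R))). Qed.

Lemma inj_pow_ge n : inj n + 1 <= inj (capp (powM M) n).
Proof.
apply: (qind R (P := fun n => inj n + 1 <= inj (capp (powM M) n))) n => [||n IH].
- by apply: QFP_le DefQ_pow; apply: DefQ_add; [exact: (DefQ_inj _ (Def1_id R))|exact: DefQ_const].
- by rewrite inj_pow0 inj0; lra.
- by rewrite inj_powS !injE; have := inj_ge0 R n; lra.
Qed.

Lemma inj_pow_gt0 n : 0 < inj (capp (powM M) n).
Proof. have := inj_pow_ge n; have := inj_ge0 R n; lra. Qed.

Lemma e2_0 : e2 O = 1.
Proof. by rewrite /e2 inj_pow0 invr1. Qed.
Lemma e2_gt0 n : 0 < e2 n.
Proof. by rewrite invr_gt0 inj_pow_gt0. Qed.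
Lemma e2_S n : e2 n = 2 * e2 (n .+ I).
Proof. by rewrite /e2 inj_powS; field; rewrite gt_eqF // inj_pow_gt0. Qed.
Lemma e2K n : e2 n * inj (capp (powM M) n) = 1.
Proof. by rewrite mulVf // gt_eqF // inj_pow_gt0. Qed.

Definition predpow n := mon (capp (powM M) n) I.
Lemma inj_predpow n : inj (predpow n) + 1 = inj (capp (powM M) n).
Proof.
rewrite inj_mon ?inj1; first by ring.
have := inj_pow_ge n; have := inj_ge0 R n; lra.
Qed.

Lemma DefQ_e2 : DefQ e2.
Proof.
apply: (DefQ_ext (v := fun n => (inj (predpow n) + 1)^-1)).
  by move=> n; rewrite inj_predpow.
apply/DefQ_inv/(Def1_mon R); last exact: (Def1_const R).
exact: (Def1_capp R _ (Def1_id R)).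
Qed.

Lemma inj_close a b : inj a < inj b + 1 -> inj b < inj a + 1 -> a = b.
Proof.
by move=> ab ba; case: (ltM_tri R a b) => [H|[//|H]];
  have {}H := inj_ltS ((inj_lt R _ _).2 H); exfalso; lra.
Qed.

Lemma pairM_inj a b a' b' : pairM a b = pairM a' b' -> a = a' /\ b = b'.
Proof.
move/(congr1 inj); rewrite /Syntax.pairM !injE => E.
have [[[a0 b0] a0'] b0'] := (inj_ge0 R a, inj_ge0 R b, inj_ge0 R a', inj_ge0 R b').
(* With s = a + b the code lies between s^2 and (s + 1)^2, the latter excluded, and therefore
   determines s. *)
have S : a .+ b = a' .+ b'.
  by case: (ltM_tri R (a .+ b) (a' .+ b')) => [H|[//|H]];
    have {}H := inj_ltS ((inj_lt R _ _).2 H); exfalso; rewrite !injE in H; nra.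
have S' : inj a + inj b = inj a' + inj b' by rewrite -!injD S.
have Ea : inj a = inj a' by move: E; rewrite S' => /addrI.
have Eb : inj b = inj b' by move: S'; rewrite Ea => /addrI.
by split; apply: (@inj_inj M R).
Qed.

Lemma ratM_inj a b c a' b' c' : ratM a b c = ratM a' b' c' -> a = a' /\ b = b' /\ c = c'.
Proof. by move/pairM_inj => [/pairM_inj[-> ->] ->]. Qed.

Definition israt (k : N) : Prop := exists a b c, k = ratM a b c.

Definition val (k : N) : K := epsilon (inhabits 0) (fun u =>
  exists a b c, k = ratM a b c /\ u = (inj a - inj b) / (inj c + 1)).

Lemma val_rat a b c : val (ratM a b c) = (inj a - inj b) / (inj c + 1).
Proof.
have : exists u : K, exists a' b' c', ratM a b c = ratM a' b' c' /\
    u = (inj a' - inj b') / (inj c' + 1) by exists ((inj a - inj b) / (inj c + 1)), a, b, c.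
move/(epsilon_spec (inhabits 0)); rewrite -/(val _) => -[a' [b' [c' [E ->]]]].
by have [-> [-> ->]] := ratM_inj E.
Qed.

(** An abstract pair of relations is used so that the strict and the weak comparison share the
    clearing of denominators. *)
Lemma cmpM_char (rel : N -> N -> Prop) (relK : K -> K -> bool) q r d p :
  (forall a b, rel a b <-> relK (inj a) (inj b)) ->
  (forall x y z, 0 < z -> relK (x * z) (y * z) = relK x y) ->
  (forall x y z, relK (x - z) y = relK x (y + z)) ->
  0 < inj p ->
  cmpM rel q r d p <-> israt q /\ israt r /\ relK (val q - val r) (inj d / inj p).
Proof.
move=> relE relM relB p0.
suff E a b c a' b' c' : rel (p .* (a .* (c' .+ I) .+ b' .* (c .+ I)))
    (p .* (b .* (c' .+ I) .+ a' .* (c .+ I)) .+ d .* ((c .+ I) .* (c' .+ I))) <->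
    relK (val (ratM a b c) - val (ratM a' b' c')) (inj d / inj p).
  split=> [[a [b [c [a' [b' [c' [-> [-> /E H]]]]]]]]|].
    by split; [exists a, b, c|split; [exists a', b', c'|]].
  move=> [[a [b [c ->]]] [[a' [b' [c' ->]]] /E H]].
  by exists a, b, c, a', b', c'.
rewrite relE !val_rat.
have c0 := injS_gt0 R c; have c0' := injS_gt0 R c'.
rewrite -(@relM (_ - _) _ (inj p * ((inj c + 1) * (inj c' + 1)))) ?mulr_gt0 //.
move: c0 c0'; set C := inj c + 1; set C' := inj c' + 1 => c0 c0'.
have -> : ((inj a - inj b) / C - (inj a' - inj b') / C') * (inj p * (C * C'))
  = inj p * (inj a * C' + inj b' * C) - inj p * (inj b * C' + inj a' * C).
  by field; rewrite !gt_eqF.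
have -> : inj d / inj p * (inj p * (C * C')) = inj d * (C * C').
  by field; rewrite gt_eqF.
by rewrite relB !injE -/C -/C' [in X in _ <-> is_true (relK _ X)]addrC.
Qed.

Lemma cmpM_lt q r d n : cmpM (@lt0 M) q r d (capp (powM M) n) <->
  israt q /\ israt r /\ val q - val r < inj d * e2 n.
Proof.
apply: (cmpM_char (relK := fun x y => x < y)); last exact: inj_pow_gt0.
- by move=> a b; rewrite inj_lt.
- by move=> x y z z0; rewrite ltr_pM2r.
- by move=> x y z; rewrite ltrBlDr.
Qed.

Lemma cmpM_le q r d n : cmpM (@leM M) q r d (capp (powM M) n) <->
  israt q /\ israt r /\ val q - val r <= inj d * e2 n.
Proof.
apply: (cmpM_char (relK := fun x y => x <= y)); last exact: inj_pow_gt0.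
- by move=> a b; rewrite inj_le.
- by move=> x y z z0; rewrite ler_pM2r.
- by move=> x y z; rewrite lerBlDr.
Qed.

Lemma realM_char x : is_realM x <-> (forall n, israt (x n)) /\
  forall n k, val (x n) - val (x (n .+ k)) < e2 n /\ val (x (n .+ k)) - val (x n) < e2 n.
Proof.
split=> [H|[Hr H] n k].
  split=> n; first by have [/cmpM_lt[]] := H n O.
  by move=> k; have [/cmpM_lt[_ [_]] + /cmpM_lt[_ [_]]] := H n k; rewrite !inj1 !mul1r.
by split; apply/cmpM_lt; (split; [|split]) => //; rewrite inj1 mul1r; have [] := H n k.
Qed.

Lemma leRM_char x y : leRM x y <-> forall n, israt (x n) /\ israt (y n) /\
  val (x n) - val (y n) <= 2 * e2 n.
Proof.
have two : inj (I .+ I) = 2 by rewrite !injE; lra.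
by split=> H n; [have /cmpM_le := H n|apply/cmpM_le]; rewrite two.
Qed.

Lemma israt_rat a b c : israt (ratM a b c).
Proof. by exists a, b, c. Qed.

Lemma val_zero : val (ratM O O O) = 0.
Proof. by rewrite val_rat inj0 subrr mul0r. Qed.

Lemma val_one : val (ratM I O O) = 1.
Proof. by rewrite val_rat inj0 inj1 subr0 add0r divr1. Qed.

Lemma in01M_char x : in01M x <-> is_realM x /\
  forall n, - (2 * e2 n) <= val (x n) /\ val (x n) <= 1 + 2 * e2 n.
Proof.
split=> [[Hr [/leRM_char H0 /leRM_char H1]]|[Hr H]]; split=> //.
  move=> n; have [_ [_]] := H0 n; have [_ [_]] := H1 n; rewrite val_zero val_one; lra.
have [xr _] := (realM_char x).1 Hr.
by split; apply/leRM_char => n; (split; [|split]) => //; try exact: israt_rat;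
  rewrite ?val_zero ?val_one; have := H n; lra.
Qed.

Lemma eqRM_refl x : is_realM x -> eqRM x x.
Proof.
move=> /realM_char[Hr _]; by split; apply/leRM_char => n; (split; [|split]) => //;
  rewrite subrr; have := e2_gt0 n; lra.
Qed.

Lemma eqRM_sym x y : eqRM x y -> eqRM y x.
Proof. by case. Qed.

Lemma leRM_trans x y z : is_realM x -> is_realM z -> leRM x y -> leRM y z -> leRM x z.
Proof.
move=> /realM_char[xr xc] /realM_char[zr zc] /leRM_char xy /leRM_char yz.
apply/leRM_char => n; (split; [|split]) => //; rewrite leNgt; apply/negP => H.
(* The slack 2 * 2^-n would double if both inequalities were added at n. They are added at n + m
   instead, with 4 * 2^-m < d; moving x and z back to n costs less than 2 * 2^-n. Since 2^m > m, any
   m >= 4 / d will do. *)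
set d : K := val (x n) - val (z n) - 2 * e2 n; have d0 : 0 < d by rewrite /d; lra.
have [m Hm] := @ofnat_bound (osrM R) (4 / d); rewrite -/(inj m) in Hm.
have em : 4 * e2 m < d.
  have := inj_pow_ge m => Hp; have p0 := inj_pow_gt0 m.
  rewrite -(ltr_pM2r p0) -mulrA e2K mulr1.
  have : 4 < d * (inj m + 1).
    apply: (@le_lt_trans _ _ (d * inj m)); first by rewrite mulrC -ler_pdivrMr.
    by rewrite mulrDr mulr1; lra.
  by move=> H4; apply: (lt_le_trans H4); rewrite ler_pM2l.
have [x1 _] := xc n m; have [_ z1] := zc n m.
have [_ [_ h1]] := xy (n .+ m); have [_ [_ h2]] := yz (n .+ m).
have le_e : e2 (n .+ m) <= e2 m.
  move: (n); apply: (qind R (P := fun i => e2 (i .+ m) <= e2 m)) => [||k IH].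
  - apply: QFP_le; last exact: DefQ_const.
    by apply: DefQ_comp DefQ_e2 _; apply: (Def1_add R); [exact: (Def1_id R)|exact: (Def1_const R)].
  - by rewrite (addMC R) (addM0 R).
  - apply: le_trans IH; have -> : k .+ I .+ m = k .+ m .+ I.
      by rewrite !(addMA R) (addMC R I).
    rewrite [leRHS]e2_S; have := e2_gt0 (k .+ m .+ I); lra.
rewrite /d in em; lra.
Qed.

Lemma eqRM_trans x y z : is_realM x -> is_realM z -> eqRM x y -> eqRM y z -> eqRM x z.
Proof.
by move=> xr zr [xy yx] [yz zy]; split; [exact: leRM_trans yz|exact: leRM_trans yx].
Qed.
End Reals.

Section Diagonal.
Variable M : structure.
Hypothesis R : rca M.

Notation N := (dom M ty0).
Local Notation "a .+ b" := (@addM M a b) (at level 50, left associativity).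
Local Notation "a .* b" := (@mulM M a b) (at level 40, left associativity).
Local Notation O := (zeroM M).
Local Notation I := (oneM M).
Local Notation mon := (@monM M).
Local Notation is_realM := (@is_realM M).
Local Notation eqRM := (@eqRM M).
Local Notation in01M := (@in01M M).
Local Notation cantorM := (@cantorM M).
Local Notation pairM := (@pairM M).
Local Notation ratM := (@ratM M).
Local Notation K := (fracF (osrM R)).
Local Notation inj := (inj R).
Local Notation injE := (injE R).
Local Notation DefQ := (DefQ (R := R)).
Local Notation Def1 := (Def1 (M := M)).
Local Notation e2 := (e2 R).
Local Notation val := (val R).
Local Notation pow := (capp (powM M)).
Local Notation predpow := (@predpow M).

Ltac def := rewrite /addM /mulM /monM; repeat first
  [ exact: Def_const | exact: Def_var | apply: Def_app ].
Ltac def1 := repeat first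
  [ exact: (Def1_const R) | exact: (Def1_id R) | apply: (Def1_add R) | apply: (Def1_mul R)
  | apply: (Def1_mon R) | apply: (Def1_capp R) ].
Ltac defq := lazymatch goal with
  | |- Analysis.DefQ (fun _ => ?c) => exact: DefQ_const
  | |- Analysis.DefQ (Analysis.inj _) => exact: (DefQ_inj _ (Def1_id R))
  | |- Analysis.DefQ (Analysis.e2 _) => exact: DefQ_e2
  | |- Analysis.DefQ (fun n => @?u n + @?v n) => apply: (@DefQ_add M R u v); defq
  | |- Analysis.DefQ (fun n => - @?u n) => apply: (@DefQ_opp M R u); defq
  | |- Analysis.DefQ (fun n => @?u n * @?v n) => apply: (@DefQ_mul M R u v); defq
  | |- Analysis.DefQ (fun n => Analysis.inj _ (@?F n)) => apply: (@DefQ_inj M R F); def1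
  | |- Analysis.DefQ (fun n => Analysis.e2 _ (@?F n)) =>
      apply: (@DefQ_comp M R e2 F); [exact: DefQ_e2|def1]
  end.

Lemma add0M n : O .+ n = n. Proof. by rewrite (addMC R) (addM0 R). Qed.

(** The increase of u is paid for by the decrease of w: u grows and u + w falls. Both are
    comparisons of definable sequences, so the telescoping is an induction available in the
    model. *)
Lemma steps_bounds (u w : N -> K) : DefQ u -> DefQ w ->
  (forall n, 0 <= u (n .+ I) - u n <= w n - w (n .+ I)) ->
  forall n k, u n <= u (n .+ k) <= u n + w n - w (n .+ k).
Proof.
move=> Du Dw H n k.
suff [-> ?] : u n <= u (n .+ k) /\ u (n .+ k) + w (n .+ k) <= u n + w n by rewrite /=; lra.
pose P k := u n <= u (n .+ k) /\ u (n .+ k) + w (n .+ k) <= u n + w n.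
move: k; apply: (qind R (P := P)) => [||k [IH1 IH2]].
- apply: (QFP_and R); apply: QFP_le; try exact: DefQ_const.
    by apply: DefQ_comp Du _; def1.
  by apply: DefQ_add; [apply: DefQ_comp Du _|apply: DefQ_comp Dw _]; def1.
- by rewrite /P (addM0 R).
- by rewrite /P -(addMA R); have /andP[] := H (n .+ k); split; lra.
Qed.

Lemma steps_real (x : N -> N) (w : N -> K) :
  (forall n, israt (x n)) -> DefQ (fun n => val (x n)) -> DefQ w ->
  (forall n, 0 < w n <= e2 n) ->
  (forall n, 0 <= val (x (n .+ I)) - val (x n) <= w n - w (n .+ I)) -> is_realM x.
Proof.
move=> xr Dx Dw Hw H; apply/(realM_char R); split=> // n k.
have /andP[H1 H2] := steps_bounds Dx Dw H n k.
by have /andP[w0 wn] := Hw n; have /andP[wk _] := Hw (n .+ k); split; lra.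
Qed.

(** * Reals with digits 0, 1, 2 in base 2 coded by elements of Cantor space *)

Lemma digit_sum_exists : exists S : dom M (Arr ty1 ty1), forall f,
  capp (capp S f) O = O /\ forall n, capp (capp S f) (n .+ I)
    = (capp (capp S f) n .+ capp (capp S f) n)
      .+ (capp f (n .+ n) .+ capp f (n .+ n .+ I)).
Proof.
apply: (@rec_exists1 M R ty1 (fun f n r => (r .+ r) .+ (capp f (n .+ n) .+ capp f (n .+ n .+ I)))).
by apply: Def_ex3 => //; def.
Qed.

Lemma shift_exists : exists Sh : dom M (Arr ty1 ty1), forall z n,
  capp (capp Sh z) n = capp z (n .+ I .+ I).
Proof. by apply: Def_ex2 => //; def. Qed.

Variable S : dom M (Arr ty1 ty1).
Hypothesis S_spec : forall f,
  capp (capp S f) O = O /\ forall n, capp (capp S f) (n .+ I)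
    = (capp (capp S f) n .+ capp (capp S f) n)
      .+ (capp f (n .+ n) .+ capp f (n .+ n .+ I)).

(** The index is shifted by one: the remaining tail is at most 2^-(n+1), strictly below the 2^-n
    that a real requires. The last argument of [ratM] is the denominator minus one. *)
Lemma digit_real_exists : exists X : dom M (Arr ty1 ty1), forall f n,
  capp (capp X f) n = ratM (capp (capp S f) (n .+ I)) O (predpow (n .+ I .+ I)).
Proof. by apply: Def_ex2 => //; rewrite /Syntax.ratM /Syntax.pairM /Analysis.predpow; def. Qed.

Variable X : dom M (Arr ty1 ty1).
Hypothesis X_spec : forall f n,
  capp (capp X f) n = ratM (capp (capp S f) (n .+ I)) O (predpow (n .+ I .+ I)).

(** The digit f(2i) + f(2i+1) has weight 2^-(i+2), so the largest possible sum, with all digits 2,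
    is 1. *)
Definition approx (f : dom M ty1) (n : N) : K := inj (capp (capp S f) n) * e2 (n .+ I).

Lemma val_X f n : val (capp (capp X f) n) = approx f (n .+ I).
Proof. by rewrite X_spec val_rat inj0 subr0 inj_predpow. Qed.

Lemma israt_X f n : israt (capp (capp X f) n).
Proof. by rewrite X_spec; exact: israt_rat. Qed.

Lemma DefQ_approx f : DefQ (approx f).
Proof. by apply: DefQ_mul; defq. Qed.

Lemma approx0 f : approx f O = 0.
Proof. by rewrite /approx (S_spec f).1 inj0 mul0r. Qed.

Lemma approxS f n : approx f (n .+ I)
  = approx f n + (inj (capp f (n .+ n)) + inj (capp f (n .+ n .+ I))) * e2 (n .+ I .+ I).
Proof. by rewrite /approx (S_spec f).2 !injE (e2_S R (n .+ I)); ring. Qed.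

Lemma inj_bit f n : cantorM f -> 0 <= inj (capp f n) <= 1.
Proof. by move=> /(_ n)[] ->; rewrite ?inj0 ?inj1 ?lexx ler01. Qed.

Lemma approx_steps f n : cantorM f ->
  0 <= approx f (n .+ I) - approx f n <= e2 n - e2 (n .+ I).
Proof.
move=> cf; rewrite approxS (e2_S R n) (e2_S R (n .+ I)).
have /andP[a0 a1] := inj_bit (n .+ n) cf; have /andP[b0 b1] := inj_bit (n .+ n .+ I) cf.
have := e2_gt0 R (n .+ I .+ I); set e := e2 _ => e0; apply/andP; split; nra.
Qed.

Lemma approx_bounds f n k : cantorM f ->
  approx f n <= approx f (n .+ k) <= approx f n + e2 n - e2 (n .+ k).
Proof.
move=> cf; apply: (steps_bounds (DefQ_approx f) (DefQ_e2 R)) => m.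
exact: approx_steps.
Qed.

Lemma X_bounds f n k : cantorM f ->
  approx f n <= val (capp (capp X f) (n .+ k)) <= approx f n + e2 n.
Proof.
move=> cf; rewrite val_X (addMA R).
have /andP[-> H] := approx_bounds n (k .+ I) cf.
by apply: le_trans H _; have := e2_gt0 R (n .+ (k .+ I)); lra.
Qed.

Lemma X_in01 f : cantorM f -> in01M (capp (capp X f)).
Proof.
move=> cf; apply/(in01M_char R); split.
  apply: (@steps_real _ (fun n => e2 (n .+ I))) => [n|||n|n].
  - exact: israt_X.
  - apply: (DefQ_ext (v := fun n => approx f (n .+ I))) => [n|]; first exact: val_X.
    by apply: DefQ_comp (DefQ_approx f) _; def1.
  - by defq.
  - by rewrite e2_gt0 (e2_S R n); have := e2_gt0 R (n .+ I); lra.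
  - by rewrite !val_X; exact: approx_steps.
move=> n; rewrite val_X; have := approx_bounds O (n .+ I) cf.
rewrite add0M approx0 e2_0 => /andP[].
by have := e2_gt0 R n; have := e2_gt0 R (n .+ I); lra.
Qed.

(** * Every real of the unit interval has such digits *)

Definition leT (a b : N) : N := mon I (mon a b).

Lemma leT_spec a b :
  (inj a <= inj b /\ leT a b = I) \/ (inj b < inj a /\ leT a b = O).
Proof.
rewrite /leT; have [ab|ba] := lerP (inj a) (inj b); [left|right]; split=> //.
  by rewrite (mon_eq0 R a b).2 // (monM0 R).
have c : inj b <= inj a by exact: ltW.
apply/(mon_eq0 R); rewrite inj_mon // inj1.
by have := inj_ltS ba; lra.
Qed.

(** Needed to invert the pairing: the integer square root of the code of (a, b) is a + b. The root
    grows by one exactly when the next square is reached. *)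
Lemma sqrt_exists : exists w : dom M ty1, forall p,
  inj (capp w p) * inj (capp w p) <= inj p /\
  inj p + 1 <= (inj (capp w p) + 1) * (inj (capp w p) + 1).
Proof.
pose F p w := w .+ leT ((w .+ I) .* (w .+ I)) (p .+ I).
have [|w [w0 wS]] := @rec_exists M R F O.
  by apply: Def_ex2 => //; rewrite /F /leT; def.
exists w; pose P p := inj (capp w p) * inj (capp w p) <= inj p /\
  inj p + 1 <= (inj (capp w p) + 1) * (inj (capp w p) + 1).
apply: (qind R (P := P)) => [||p [IH1 IH2]].
- by apply: (QFP_and R); apply: QFP_le; defq.
- by rewrite /P w0 inj0; split; lra.
rewrite /P wS /F; have := inj_ge0 R (capp w p).
case: (leT_spec ((capp w p .+ I) .* (capp w p .+ I)) (p .+ I)) => -[+ ->].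
  by rewrite !injE; split; nra.
by move/inj_ltS; rewrite !injE; split; nra.
Qed.

Lemma unpair_exists : exists p1 p2 : dom M ty1, forall a b,
  capp p1 (pairM a b) = a /\ capp p2 (pairM a b) = b.
Proof.
have [w Hw] := sqrt_exists.
have [p1 H1] : exists h : dom M ty1, forall p, capp h p = mon p (capp w p .* capp w p).
  by apply: Def_ex1 => //; def.
have [p2 H2] : exists h : dom M ty1, forall p, capp h p = mon (capp w p) (capp p1 p).
  by apply: Def_ex1 => //; def.
exists p1, p2 => a b; rewrite H2 H1.
have -> : capp w (pairM a b) = a .+ b.
  apply: (inj_close (R := R)).
    have [+ _] := Hw (pairM a b); rewrite /Syntax.pairM !injE.
    have := inj_ge0 R a; have := inj_ge0 R b; have := inj_ge0 R (capp w (pairM a b)).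
    rewrite /Syntax.pairM; set v := inj (capp w _) => *; rewrite ltNge; apply/negP => ?; nra.
  have [_] := Hw (pairM a b); rewrite /Syntax.pairM !injE.
  have := inj_ge0 R a; have := inj_ge0 R b; have := inj_ge0 R (capp w (pairM a b)).
  rewrite /Syntax.pairM; set v := inj (capp w _) => v0 b0 a0 H.
  rewrite ltNge; apply/negP => ?; nra.
have E1 : mon (pairM a b) ((a .+ b) .* (a .+ b)) = a.
  apply: (@inj_inj M R); rewrite inj_mon /Syntax.pairM !injE; first by ring.
  by have := inj_ge0 R a; lra.
split=> //; rewrite E1; apply: (@inj_inj M R).
by rewrite inj_mon !injE; [ring|have := inj_ge0 R b; lra].
Qed.

Lemma interleave_exists (b1 b2 : dom M ty1) : cantorM b1 -> cantorM b2 ->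
  exists f, cantorM f /\ forall n, capp f (n .+ n) = capp b1 n /\
    capp f (n .+ n .+ I) = capp b2 n.
Proof.
move=> c1 c2.
have [|par [par0 parS]] := @rec_exists M R (fun _ r => mon I r) O.
  by apply: Def_ex2 => //; def.
have [|half [half0 halfS]] := @rec_exists M R (fun n r => r .+ capp par n) O.
  by apply: Def_ex2 => //; def.
have m0 : mon I O = I by rewrite (monM0 R).
have m1 : mon I I = O by apply/(mon_eq0 R).
have Hpar n : capp par n = O \/ capp par n = I.
  (* The disjunction that [par] is 0 or 1 is rewritten as two inequalities, a form to which [qind]
     applies. *)
  pose P n := inj (capp par n) * (1 - inj (capp par n)) <= 0 /\ inj (capp par n) <= 1.
  have : P n.
    move: n; apply: (qind R (P := P)) => [||n [H1 H2]].
    - by apply: (QFP_and R); apply: QFP_le; defq.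
    - by rewrite /P par0 inj0; split; lra.
    rewrite /P parS inj_mon ?inj1 //.
    by have := inj_ge0 R (capp par n); split; lra.
  move=> [H1 H2]; have H0 := inj_ge0 R (capp par n).
  have : inj (capp par n) * (1 - inj (capp par n)) == 0.
    by apply/eqP/le_anti; rewrite H1 mulr_ge0 // subr_ge0.
  rewrite mulf_eq0 subr_eq0 => /orP[/eqP E|/eqP E]; [left|right].
    by apply/(inj_eq0 R).
  by apply: (@inj_inj M R); rewrite -E inj1.
have Hdd n : capp par (n .+ n) = O /\ capp half (n .+ n) = n.
  have [h2 Hh2] : exists h : dom M ty1, forall n, capp h n = capp par (n .+ n).
    by apply: Def_ex1 => //; def.
  have [h3 Hh3] : exists h : dom M ty1, forall n, capp h n = capp half (n .+ n).
    by apply: Def_ex1 => //; def.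
  pose P n := (inj (capp h2 n) <= 0 /\ inj (capp h3 n) <= inj n) /\ inj n <= inj (capp h3 n).
  have : P n.
    move: n; apply: (qind R (P := P)) => [||n].
    - by do 2?apply: (QFP_and R); apply: QFP_le; defq.
    - by rewrite /P Hh2 Hh3 (addM0 R) par0 half0 inj0.
    rewrite /P !Hh2 !Hh3 => -[[E1 E2] E3].
    have {}E1 : capp par (n .+ n) = O.
      by apply/(inj_eq0 R)/le_anti; rewrite E1 inj_ge0.
    have -> : n .+ I .+ (n .+ I) = n .+ n .+ I .+ I.
      by apply: (@inj_inj M R); rewrite !injE; ring.
    rewrite !parS E1 m0 m1 !halfS parS E1 m0 !injE.
    by do !split; lra.
  move=> [[E1 E2] E3]; rewrite -Hh2 -Hh3; split.
    by apply/(inj_eq0 R)/le_anti; rewrite E1 inj_ge0.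
  by apply: (@inj_inj M R); apply/le_anti; rewrite E2.
have [f Hf] : exists f : dom M ty1, forall j, capp f j
    = mon I (capp par j) .* capp b1 (capp half j) .+ capp par j .* capp b2 (capp half j).
  by apply: Def_ex1 => //; def.
have f0 j : capp par j = O -> capp f j = capp b1 (capp half j).
  by move=> E; rewrite Hf E m0 ![_ .* capp _ _](mulMC R) (mulM1 R) (mulM0 R) (addM0 R).
have f1 j : capp par j = I -> capp f j = capp b2 (capp half j).
  by move=> E; rewrite Hf E m1 ![_ .* capp _ _](mulMC R) (mulM1 R) (mulM0 R) add0M.
exists f; split=> [j|n].
  by case: (Hpar j) => E; [rewrite f0|rewrite f1].
have [E1 E2] := Hdd n; rewrite f0 // f1 ?parS ?E1 // E2 halfS E1 E2.
by rewrite (addM0 R).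
Qed.

(** Greedy expansion with redundant digits: the next digit is read off the rational q(n+3), whose
    error the overlap of neighbouring digit intervals absorbs. *)
Lemma digits_exist (x : dom M ty1) : in01M (capp x) ->
  exists f, cantorM f /\ eqRM (capp (capp X f)) (capp x).
Proof.
move=> /(in01M_char R)[xreal x01]; have [xr xc] := (realM_char R _).1 xreal.
have [p1 [p2 Hp]] := unpair_exists.
pose A n := capp p1 (capp p1 (capp x n)); pose B n := capp p2 (capp p1 (capp x n)).
pose C n := capp p2 (capp x n).
pose q n := val (capp x n).
have qE n : q n = (inj (A n) - inj (B n)) / (inj (C n) + 1).
  have [a [b [c E]]] := xr n.
  rewrite /q /A /B /C E val_rat /Syntax.ratM.
  have [-> ->] := Hp (pairM a b) c.
  by have [-> ->] := Hp a b.
have Dq : DefQ q by exists A, B, C; do !split=> //; rewrite /A /B /C; def1.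
pose m3 n := n .+ I .+ I .+ I.
pose P n := pow (n .+ I .+ I).
(* T c n s = 1 iff 2^(n+1) q(n+3) - s > c/4. *)
pose T c n s := mon I (leT ((I .+ I) .* A (m3 n) .* P n)
  ((I .+ I) .* B (m3 n) .* P n .+ ((I .+ I .+ I .+ I) .* s .+ c) .* (C (m3 n) .+ I))).
pose eta n := e2 (n .+ I .+ I).
have T_spec c n s :
   (T c n s = O /\ q (m3 n) - inj s * (2 * eta n) <= inj c / 2 * eta n) \/
   (T c n s = I /\ inj c / 2 * eta n < q (m3 n) - inj s * (2 * eta n)).
  have P0 : 0 < inj (P n) by exact: inj_pow_gt0.
  have C0 := injS_gt0 R (C (m3 n)).
  have E : (q (m3 n) - inj s * (2 * eta n)) * (2 * inj (P n) * (inj (C (m3 n)) + 1))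
    = 2 * inj (A (m3 n)) * inj (P n) - 2 * inj (B (m3 n)) * inj (P n)
      - 4 * inj s * (inj (C (m3 n)) + 1).
    by rewrite qE /eta /Analysis.e2 -/(P n); field; rewrite !gt_eqF.
  have E' : (inj c / 2 * eta n) * (2 * inj (P n) * (inj (C (m3 n)) + 1))
    = inj c * (inj (C (m3 n)) + 1).
    by rewrite /eta /Analysis.e2 -/(P n); field; rewrite gt_eqF.
  have pos : 0 < 2 * inj (P n) * (inj (C (m3 n)) + 1) by rewrite !mulr_gt0.
  rewrite /T; set a := _ .* P n; set b := _ .+ _.
  case: (leT_spec a b) => -[H ->]; [left|right]; rewrite /a /b !injE in H.
    split; first by apply/(mon_eq0 R).
    by rewrite -(ler_pM2r pos) E E'; lra.
  split; first by rewrite (monM0 R).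
  by rewrite -(ltr_pM2r pos) E E'; lra.
have DT c : exists h : dom M (Arr ty0 ty1), forall n s, capp (capp h n) s = T c n s.
  by apply: Def_ex2 => //; rewrite /T /leT /A /B /C /P /m3; def.
(* In units of eta = 2^-(n+2) the thresholds are 3/2 and 5/2. The remainder before the step lies in
   [0, 4], q(n+3) has error at most 1/2, and after removing the digit 0, 1 or 2 the remainder must
   lie in [0, 2]. *)
pose c3 := I .+ I .+ I; pose c5 := c3 .+ I .+ I.
have [h3 H3] := DT c3; have [h5 H5] := DT c5.
have [|s [s0 sS]] := @rec_exists M R
    (fun n r => (r .+ r) .+ (capp (capp h3 n) r .+ capp (capp h5 n) r)) O.
  by apply: Def_ex2 => //; def.
have [b1 Hb1] : exists b : dom M ty1, forall n, capp b n = T c3 n (capp s n).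
  have [b Hb] : exists b : dom M ty1, forall n, capp b n = capp (capp h3 n) (capp s n).
    by apply: Def_ex1 => //; def.
  by exists b => n; rewrite Hb H3.
have [b2 Hb2] : exists b : dom M ty1, forall n, capp b n = T c5 n (capp s n).
  have [b Hb] : exists b : dom M ty1, forall n, capp b n = capp (capp h5 n) (capp s n).
    by apply: Def_ex1 => //; def.
  by exists b => n; rewrite Hb H5.
have cT c n r : T c n r = O \/ T c n r = I by case: (T_spec c n r) => -[-> _]; [left|right].
have [f [cf Hf]] : exists f, cantorM f /\ forall n, capp f (n .+ n) = capp b1 n /\
    capp f (n .+ n .+ I) = capp b2 n.
  by apply: interleave_exists => n; rewrite ?Hb1 ?Hb2; exact: cT.
exists f; split=> //.
have fs n : capp (capp S f) n = capp s n.
  pose Q n := inj (capp (capp S f) n) <= inj (capp s n) /\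
    inj (capp s n) <= inj (capp (capp S f) n).
  suff [H1 H2] : Q n by apply: (@inj_inj M R); apply/le_anti; rewrite H1.
  move: n; apply: (qind R (P := Q)) => [||n [H1 H2]].
  - by apply: (QFP_and R); apply: QFP_le; defq.
  - by rewrite /Q (S_spec f).1 s0.
  have E : capp (capp S f) n = capp s n by apply: (@inj_inj M R); apply/le_anti; rewrite H1.
  by rewrite /Q (S_spec f).2 sS E H3 H5 (Hf n).1 (Hf n).2 Hb1 Hb2.
(* The limit of q is not an element to compare with, so the remainder is measured against q J for a
   fixed later J, up to the tolerance 2 * 2^-J of [in01M]. The condition n + 3 <= J makes q(n+2),
   used for the digit before n, and all earlier readings accurate relative to q J. *)
have inv J n : inj n + 3 <= inj J ->
    - (2 * e2 J) <= q J - approx f n <= e2 n + 2 * e2 J.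
  pose Q n := inj n + 3 <= inj J ->
    - (2 * e2 J) <= q J - approx f n /\ q J - approx f n <= e2 n + 2 * e2 J.
  suff H : Q n by move=> /H[-> ->].
  move: n; apply: (qind R (P := Q)) => [||n IH].
  - apply: (QFP_imp R); first by apply: QFP_le; defq.
    have Da : DefQ (fun n => q J - approx f n).
      by apply: DefQ_add; [exact: DefQ_const|apply/DefQ_opp/DefQ_approx].
    by apply: (QFP_and R); apply: QFP_le => //; defq.
  - rewrite /Q approx0 subr0 e2_0 => _; have [H1 H2] := x01 J.
    by rewrite /q; split; lra.
  rewrite /Q !injE => HJ; have [|L U] := IH; first by lra.
  have Em : inj (m3 n) <= inj J by rewrite /m3 !injE; lra.
  have [k Ek] : exists k, J = m3 n .+ k.
    by exists (mon J (m3 n)); rewrite (leM_monus R) //; apply/(inj_le R).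
  have [] := xc (m3 n) k; rewrite -Ek -/(q J) -/(q (m3 n)) => C1 C2.
  rewrite approxS (Hf n).1 (Hf n).2 Hb1 Hb2 -fs -/(eta n).
  have Ea : approx f n = inj (capp (capp S f) n) * (2 * eta n).
    by rewrite /approx (e2_S R (n .+ I)).
  have e_n : e2 n = 4 * eta n by rewrite (e2_S R n) (e2_S R (n .+ I)) /eta; ring.
  have e_n1 : e2 (n .+ I) = 2 * eta n by rewrite (e2_S R (n .+ I)).
  have e_n3 : eta n = 2 * e2 (m3 n) by exact: e2_S.
  have eta0 : 0 < eta n := e2_gt0 R _; have eJ0 := e2_gt0 R J.
  have i3 : inj c3 = 3 by rewrite /c3 !injE; lra.
  have i5 : inj c5 = 5 by rewrite /c5 /c3 !injE; lra.
  rewrite e_n in U; rewrite e_n1.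
  case: (T_spec c3 n (capp (capp S f) n)) => -[->]; rewrite -Ea i3 => H3';
    case: (T_spec c5 n (capp (capp S f) n)) => -[->]; rewrite -Ea i5 => H5';
    rewrite ?inj0 ?inj1; split; lra.
have main n : - (2 * e2 n) <= val (capp (capp X f) n) - q n <= 2 * e2 n.
  (* The real at index n is the partial sum n + 1, and n + 4 is the first J that the invariant
     allows for it. *)
  pose k := I .+ I .+ I .+ I; rewrite val_X.
  have /andP[] : - (2 * e2 (n .+ k)) <= q (n .+ k) - approx f (n .+ I)
      <= e2 (n .+ I) + 2 * e2 (n .+ k) by apply: inv; rewrite /k !injE; lra.
  have [] := xc n k; rewrite -/(q n) -/(q (n .+ k)).
  have -> : n .+ k = n .+ I .+ I .+ I .+ I by rewrite /k -!(addMA R).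
  have := e2_gt0 R (n .+ I .+ I .+ I .+ I).
  rewrite (e2_S R n) (e2_S R (n .+ I)) (e2_S R (n .+ I .+ I)) (e2_S R (n .+ I .+ I .+ I)).
  by set e := e2 _ => *; apply/andP; split; lra.
by split; apply/(leRM_char R) => n; (split; [exact: israt_X || exact: xr|split;
  [exact: israt_X || exact: xr|]]); have /andP[] := main n; rewrite /q; lra.
Qed.

(** * The diagonal real *)

Definition times16 (a : N) : N :=
  let b := a .+ a .+ a .+ a in b .+ b .+ b .+ b.
Definition five : N := I .+ I .+ I .+ I .+ I.

(** The real y has base 4 digits 0 or 2 and t n / 4^n are its partial sums. In units of 4^-n/16, x_n
    lies in [g n, g n + 2] and y in [16t, 16t + 4] or [16t + 8, 16t + 12] according to the next
    digit. If g n <= 16t + 5 then x_n <= 16t + 7 and the digit 2 avoids it; otherwise x_n >= 16t + 6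
    and the digit 0 does. *)
Lemma diagonal_exists (g : dom M ty1) : exists y t : dom M ty1, in01M (capp y) /\
  (forall n, capp t (n .+ I) = (capp t n .+ capp t n .+ capp t n .+ capp t n)
     .+ (leT (capp g n) (times16 (capp t n) .+ five)
         .+ leT (capp g n) (times16 (capp t n) .+ five))) /\
  forall n k, inj (capp t n) * (e2 n * e2 n) <= val (capp y (n .+ k))
    <= inj (capp t n) * (e2 n * e2 n) + e2 n * e2 n.
Proof.
pose F n r := (r .+ r .+ r .+ r) .+ (leT (capp g n) (times16 r .+ five)
  .+ leT (capp g n) (times16 r .+ five)).
have [|t [t0 tS]] := @rec_exists M R F O.
  by apply: Def_ex2 => //; rewrite /F /leT /times16 /=; def.
have [y Hy] : exists y : dom M ty1, forall n,
    capp y n = ratM (capp t n) O (mon (pow n .* pow n) I).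
  by apply: Def_ex1 => //; rewrite /Syntax.ratM /Syntax.pairM; def.
pose u n := inj (capp t n) * (e2 n * e2 n).
have vy n : val (capp y n) = u n.
  rewrite Hy val_rat inj0 subr0 inj_mon ?injE.
    by rewrite subrK /u /Analysis.e2 invfM.
  have := inj_pow_ge R n; have := inj_ge0 R n; nra.
have Du : DefQ u by rewrite /u; defq.
pose w n := e2 n * e2 n.
have Dw : DefQ w by rewrite /w; defq.
have steps n : 0 <= u (n .+ I) - u n <= w n - w (n .+ I).
  rewrite /u /w tS /F !injE (e2_S R n); have := e2_gt0 R (n .+ I).
  set e := e2 _ => e0; have ee : 0 < e * e by rewrite mulr_gt0.
  set b := leT _ _; have : 0 <= inj b <= 1.
    rewrite /b; set c := _ .+ five.
    by case: (leT_spec (capp g n) c) => -[_ ->]; rewrite ?inj0 ?inj1 ?lexx ler01.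
  by move=> /andP[b0 b1]; apply/andP; split; nra.
have e_le1 n : e2 n <= 1.
  pose P n := e2 n <= 1.
  move: n; apply: (qind R (P := P)) => [||n]; first by apply: QFP_le; defq.
    by rewrite /P e2_0.
  by rewrite /P (e2_S R n); have := e2_gt0 R (n .+ I); lra.
have bounds n k : u n <= val (capp y (n .+ k)) <= u n + w n.
  rewrite vy; have /andP[-> H] := steps_bounds Du Dw steps n k.
  by apply: le_trans H _; rewrite /w; have := mulr_gt0 (e2_gt0 R (n .+ k)) (e2_gt0 R (n .+ k)); lra.
have w_bd n : 0 < w n <= e2 n.
  by rewrite /w; have := e_le1 n; have := e2_gt0 R n => *; apply/andP; split; nra.
exists y, t; split; last by split.
apply/(in01M_char R); split.
  apply: (@steps_real _ w) => // [n||n].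
  - by rewrite Hy; exact: israt_rat.
  - exact: (DefQ_ext vy).
  - by rewrite !vy.
move=> n; have := bounds O n; rewrite add0M /u /w t0 inj0 mul0r e2_0.
by move=> /andP[]; have := e2_gt0 R n; split; lra.
Qed.

Lemma no_injective_surjection (Y : dom M ty2) :
  (forall Z : dom M ty2,
     (forall n, exists m h, cantorM h /\ capp Z (codeM h m n) = O) ->
     exists g : dom M ty1, forall n, exists h, cantorM h /\
       capp Z (codeM h (capp g n) n) = O) ->
  (forall x y, in01M (capp x) -> in01M (capp y) -> eqRM (capp x) (capp y) ->
     capp Y x = capp Y y) ->
  (forall x y, in01M (capp x) -> in01M (capp y) -> capp Y x = capp Y y ->
     eqRM (capp x) (capp y)) ->
  ~ (forall n, exists x, in01M (capp x) /\ capp Y x = n).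
Proof.
move=> ncc Yext Yinj Ysurj.
have [Sh HSh] := shift_exists.
pose idx n := n .+ n .+ I .+ I .+ I.
pose neq a b := mon a b .+ mon b a.
have neqE a b : neq a b = O <-> a = b.
  rewrite -(inj_eq0 R) /neq injD; split=> [E|->]; last first.
    by rewrite (proj2 (mon_eq0 R b b)) ?inj0 ?addr0.
  have h1 := inj_ge0 R (mon a b); have h2 := inj_ge0 R (mon b a).
  apply: (@inj_inj M R); apply/le_anti/andP; split;
    apply/(mon_eq0 R)/(inj_eq0 R)/le_anti; apply/andP; split=> //; lra.
(* The matrix is put into the form Z = 0: equations become sums of truncated differences, z(0) is m,
   z(1) is n, and the shift by two recovers f. The witnesses f remain unchosen, but m alone fixes
   x_n up to 2^-(2n+3). *)
have [Z HZ] : exists Z : dom M ty2, forall z, capp Z z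
    = neq (capp Y (capp X (capp Sh z))) (capp z I)
      .+ neq (capp z O) (capp (capp S (capp Sh z)) (idx (capp z I))).
  by apply: Def_ex1 => //; rewrite /neq /idx; def.
have ZE f m n : capp Z (codeM f m n) = O <->
    capp Y (capp X f) = n /\ m = capp (capp S f) (idx n).
  have [c0 [c1 cS]] := codeM_spec R f m n.
  have -> : capp Z (codeM f m n)
      = neq (capp Y (capp X f)) n .+ neq m (capp (capp S f) (idx n)).
    rewrite HZ c0 c1; have -> // : capp Sh (codeM f m n) = f.
    by apply: (rca_ext R) => i; rewrite HSh cS.
  rewrite -(neqE (capp Y (capp X f)) n) -(neqE m).
  set a := neq _ n; set b := neq m _; rewrite -!(inj_eq0 R) injD.
  have ha := inj_ge0 R a; have hb := inj_ge0 R b.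
  by split=> [?|[-> ->]]; [split; lra|rewrite addr0].
have [n|g Hg] := ncc Z.
  have [x [x01 <-]] := Ysurj n; have [f [cf fx]] := digits_exist x01.
  exists (capp (capp S f) (idx (capp Y x))), f; split=> //; apply/ZE; split=> //.
  by apply: Yext => //; exact: X_in01.
have [y [t [y01 [tS yb]]]] := diagonal_exists g.
have [f [cf /ZE[Yf gE]]] := Hg (capp Y y).
(* Injectivity makes the f belonging to n = Y y a code of y itself, although stage n of the
   construction kept y away from that real. *)
set n := capp Y y in Yf gE; have [lXy lyX] := Yinj _ _ (X_in01 cf) y01 Yf.
have /andP[x1 x2] := X_bounds (idx n) (I .+ I .+ I) cf.
have /andP[y1 y2] := yb (n .+ I) (n .+ (I .+ I .+ I .+ I .+ I)).
(* Both reals are compared at the common index j = 2n + 6, where the tolerance 2 * 2^-j is 4^-n/32,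
   half of the unit in which they are at least one apart. *)
have Ej : n .+ I .+ (n .+ (I .+ I .+ I .+ I .+ I)) = idx n .+ (I .+ I .+ I).
  by apply: (@inj_inj M R); rewrite /idx !injE; ring.
rewrite Ej in y1 y2; set j := idx n .+ (I .+ I .+ I) in x1 x2 y1 y2.
have [_ [_ d1]] := (leRM_char R _ _).1 lXy j; have [_ [_ d2]] := (leRM_char R _ _).1 lyX j.
move: x1 x2 y1 y2; rewrite /approx -gE tS.
pose e := e2 n; have e_pos : 0 < e * e by rewrite mulr_gt0 // e2_gt0.
have e1 : e2 (n .+ I) = e / 2 by rewrite /e (e2_S R n); field.
have pow_add : e2 (n .+ n) = e * e.
  rewrite /e; have H k : e2 (n .+ k) = e2 n * e2 k; last exact: H.
  pose P k := e2 (n .+ k) <= e2 n * e2 k /\ e2 n * e2 k <= e2 (n .+ k).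
  suff [h1 h2] : P k by apply/le_anti; rewrite h1.
  move: k; apply: (qind R (P := P)) => [||k [h1 h2]].
  - by apply: (QFP_and R); apply: QFP_le; defq.
  - by rewrite /P (addM0 R) e2_0 mulr1.
  move: h1 h2; rewrite /P -(addMA R) (e2_S R (n .+ k)) (e2_S R k); split; lra.
have ei : e2 (idx n) = e * e / 8.
  by rewrite -pow_add /idx (e2_S R (n .+ n)) (e2_S R (n .+ n .+ I))
    (e2_S R (n .+ n .+ I .+ I)); field.
have ei1 : e2 (idx n .+ I) = e * e / 16.
  by have := e2_S R (idx n); rewrite ei; lra.
have ej : e2 j = e * e / 64.
  have -> : j = idx n .+ I .+ I .+ I by rewrite /j -!(addMA R).
  by have := e2_S R (idx n .+ I); have := e2_S R (idx n .+ I .+ I); rewrite ei1; lra.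
rewrite ej in d1 d2; rewrite ei ei1 e1.
set m := inj (capp g n).
set c := times16 _ .+ five.
have Ec : inj c = 16 * inj (capp t n) + 5 by rewrite /c /times16 /five /= !injE; ring.
rewrite !injE; set T := inj (capp t n) in Ec *.
have E2 : e / 2 * (e / 2) = e * e / 4 by field.
rewrite E2; move: e_pos d1 d2; set E := e * e; move=> E0 d1 d2.
case: (leT_spec (capp g n) c) => -[+ ->]; last move/inj_ltS; rewrite ?inj0 ?inj1 -/m Ec; nra.
Qed.
End Diagonal.

End Analysis.

(** * NBI from completeness, and forcing with partial injections *)

Module Forcing.
Import List Cantor PeanoNat Lia Eqdep Defs.
Import ListNotations.
Local Open Scope lw_scope.
Import Syntax Analysis.
Unset Asymmetric Patterns.

(** Only extensional models matter, by completeness and the quotient. There the failure of both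
    alternatives says that Y is injective up to equality of reals and onto. *)
Theorem NCC_proves_NBI : proves (extend RCA0w NCC) NBI.
Proof.
apply: completeness => S HS.
have [|M [R satM]] := @quotient_rca S; first by move=> A HA; apply: HS; left.
apply/satM/(sat_NBI R) => Y Yext.
have ncc := sat_NCC R (proj2 (satM NCC) (HS NCC (or_intror eq_refl))).
have [D HD] := digit_sum_exists R; have [X HX] := digit_real_exists R D.
apply: NNPP => /not_or_and[ninj nmiss].
apply: (@no_injective_surjection M R D HD X HX Y) => // [x y x01 y01 E|n].
  by apply: NNPP => nE; apply: ninj; exists x, y.
by apply: NNPP => nx; apply: nmiss; exists n => x x01 E; apply: nx; exists x.
Qed.

(** * The full type structure *)

Fixpoint Fty (t : ty) : Type :=
  match t with ty0 => nat | Arr s t => Fty s -> Fty t end.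

Definition fcst t (c : cst t) : Fty t :=
  match c in cst t return Fty t with
  | Zero => 0
  | One => 1
  | Plus => Nat.add
  | Times => Nat.mul
  | Pi r s => fun a _ => a
  | Sigma r s t => fun a b c => a c (b c)
  | Rec s => fun f m n => nat_rect (fun _ => Fty s) m f n
  end.

Definition full : structure :=
  @Structure Fty (fun s t f x => f x) fcst (@eq nat) lt.

Lemma full_rca : rca full.
Proof.
split=> //=.
- by move=> s t a b H; apply: functional_extensionality.
- by move=> f m n; rewrite Nat.add_1_r.
- move=> A inA f; move: (f ty0 vz) (f ty0 (vs vz)) (f ty0 (vs (vs vz))) => /=.
  rewrite /arith_axioms /= in inA.
  by repeat (case: inA => [<-|inA]; [rewrite /= -/Nat.add; nia|]).
- move=> G A f _ A0 AS; elim=> // n /AS; by rewrite Nat.add_1_r.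
- move=> h H; exists (fun x => epsilon (inhabits 0) (fun y => h x y = 0)) => x.
  by apply: (epsilon_spec (inhabits 0) (fun y => h x y = 0)); exact: H.
Qed.

Notation fev := (ev (S := full)).
Notation fsat := (sat (S := full)).

(** * Conditions *)

(** Points to be enumerated: classes of representatives of reals. *)
Definition point := (nat -> nat) -> Prop.
Definition rel := point -> nat -> Prop.

(** The free values of the third clause are what allows any further point to be added, so the
    generic injection becomes total. *)
Definition good (r : rel) : Prop :=
  (forall x m n, r x m -> r x n -> m = n) /\
  (forall x y n, r x n -> r y n -> x = y) /\
  (forall k, exists n, k <= n /\ forall x, ~ r x n).

Definition rsub (r s : rel) : Prop := forall x n, r x n -> s x n.

(** A finite set of values is reserved to stay outside the range. *)
Record cond := Cond {
  crel : rel;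
  cgood : good crel;
  cex : list nat;
  cexP : forall n x, In n cex -> ~ crel x n }.

Definition cle (q p : cond) : Prop := rsub (crel p) (crel q) /\ incl (cex p) (cex q).

Lemma cle_refl p : cle p p.
Proof. by split=> // n. Qed.

Lemma cle_trans p q r : cle p q -> cle q r -> cle p r.
Proof. by move=> [H1 H2] [H3 H4]; split=> [x n /H3/H1|n /H4/H2]. Qed.

Hint Resolve cle_refl : core.

Lemma reserve p k : exists q, cle q p /\ exists n, k <= n /\ In n (cex q).
Proof.
have [_ [_ /(_ k)[n [kn nr]]]] := cgood p.
have H m x : In m (n :: cex p) -> ~ crel p x m.
  by move=> [<-|/cexP]; [exact: nr|exact].
exists (Cond (cgood p) H); split; first by split=> // m; right.
by exists n; split=> //; left.
Qed.

Lemma extend_at p x : exists q n, cle q p /\ crel q x n.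
Proof.
case: (classic (exists n, crel p x n)) => [[n xn]|nx]; first by exists p, n.
have [fn [ij co]] := cgood p.
pose b := fold_right max 0 (cex p).
have Hb m : In m (cex p) -> m <= b.
  rewrite /b; elim: (cex p) => //= a l IH [->|/IH]; lia.
(* The new value is outside the range and above all reserved values, hence respects both. *)
have [n [bn nr]] := co (S b).
pose r y m := crel p y m \/ (y = x /\ m = n).
have gr : good r.
  split; [|split].
  - move=> y m m' [H|[Ey ->]] [H'|[Ey' ->]] //; first exact: fn H H'.
      by case: nx; exists m; rewrite -Ey'.
    by case: nx; exists m'; rewrite -Ey.
  - move=> y y' m [H|[-> Em]] [H'|[-> Em']] //; first exact: ij H H'.
      by rewrite Em' in H; case: (nr _ H).
    by rewrite Em in H'; case: (nr _ H').
  move=> k; have [m [km mr]] := co (max k (S n)).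
  exists m; split; first lia.
  by move=> y [/mr //|[_ Em]]; lia.
have er m y : In m (cex p) -> ~ r y m.
  by move=> inm [|[_ Em]]; [exact: cexP|have := Hb _ inm; lia].
by exists (Cond gr er), n; split; [split=> // y m; left|right].
Qed.

(** Fusion: reserving one more value at each stage keeps the range of the union coinfinite. *)
Lemma fusion (D : nat -> rel -> Prop) p :
  (forall n r s, rsub r s -> D n r -> D n s) ->
  (forall n q, cle q p -> exists r, cle r q /\ D n (crel r)) ->
  exists r, cle r p /\ forall n, D n (crel r).
Proof.
move=> Dmono H.
pose Q n q r := cle r q /\ (exists k, n <= k /\ In k (cex r)) /\ D n (crel r).
have HQ n q : cle q p -> exists r, Q n q r.
  move=> qp; have [q' [q'q [k [nk ink]]]] := reserve q n.
  have [r [rq' Dr]] := H n q' (cle_trans q'q qp).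
  exists r; split; first exact: cle_trans rq' q'q.
  by split=> //; exists k; split=> //; apply: (proj2 rq').
pose f := fix f n := match n with
  | 0 => p | S n => epsilon (inhabits p) (Q n (f n)) end.
have Hf n : cle (f n) p /\ Q n (f n) (f (S n)).
  elim: n => [|n [IH [IHle _]]].
    by split=> //; apply: (epsilon_spec (inhabits p) (Q 0 p)); exact: HQ.
  have H' : cle (f (S n)) p by exact: cle_trans IHle IH.
  by split=> //; apply: (epsilon_spec (inhabits p) (Q (S n) (f (S n)))); exact: HQ.
have mono n m : n <= m -> cle (f m) (f n).
  by elim=> // {}m _ IH; have [_ [IH' _]] := Hf m; exact: cle_trans IH' IH.
pose r x k := exists n, crel (f n) x k.
have sub n : rsub (crel (f n)) r by move=> x k H'; exists n.
have gr : good r.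
  split; [|split].
  - move=> x m n [i Hi] [j Hj]; have [fn _] := cgood (f (max i j)).
    by apply: (fn x); [apply: (proj1 (mono i _ _)) Hi|apply: (proj1 (mono j _ _)) Hj]; lia.
  - move=> x y n [i Hi] [j Hj]; have [_ [ij _]] := cgood (f (max i j)).
    by apply: (ij _ _ n); [apply: (proj1 (mono i _ _)) Hi|apply: (proj1 (mono j _ _)) Hj]; lia.
  move=> k; have [_ [_ [[n [kn inn]] _]]] := Hf k.
  exists n; split=> // x [i Hi]; apply: (@cexP (f (max i (S k))) n x).
    by apply: (proj2 (mono (S k) _ _)) inn; lia.
  by apply: (proj1 (mono i _ _)) Hi; lia.
have er m x : In m (cex p) -> ~ r x m.
  by move=> inm [i Hi]; apply: (@cexP (f i) m x) => //; apply: (proj2 (proj1 (Hf i))).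
(* Only the reserved values of p are kept, because all stages together reserve infinitely many. This
   is why D is a property of relations, monotone under inclusion. *)
exists (Cond gr er); split; first by split=> //; exact: (sub 0).
by move=> n; have [_ [_ [_ Dn]]] := Hf n; apply: Dmono Dn; exact: sub.
Qed.

(** * Names and their equality *)

(** A name is evaluated pointwise, along all good relations. *)
Definition name (t : ty) : Type := rel -> Fty t.
Definition napp s t (a : name (s --> t)) (b : name s) : name t := fun r => a r (b r).
Definition ground t (v : Fty t) : name t := fun _ => v.

(** The extensions s may use reserved values: a decision rests on the relation alone, which makes it
    a legitimate requirement for [fusion]. *)
Definition dec t (r : rel) (a : name t) (v : Fty t) : Prop :=
  forall s, good s -> rsub r s -> a s = v.

Lemma dec_mono t q r (a : name t) v : cle r q -> dec (crel q) a v -> dec (crel r) a v.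
Proof. by move=> [rq _] H s gs rs; apply: H => // x n /rq/rs. Qed.

Lemma dec_self t p (a : name t) v : dec (crel p) a v -> a (crel p) = v.
Proof. by apply=> //; exact: cgood. Qed.

(** A Kripke logical relation over the conditions, hence only a partial equivalence. The names with
    [fr p a a] are the hereditarily extensional ones, and quantifiers are restricted to them. *)
Fixpoint fr (t : ty) : cond -> name t -> name t -> Prop :=
  match t with
  | ty0 => fun p a b => forall q, cle q p -> exists r, cle r q /\
      exists n, dec (t := ty0) (crel r) a n /\ dec (t := ty0) (crel r) b n
  | Arr s t => fun p a b => forall q, cle q p -> forall c d,
      fr (t := s) q c d -> fr (t := t) q (napp a c) (napp b d)
  end.

Lemma fr_mono t p q (a b : name t) : cle q p -> fr p a b -> fr q a b.
Proof.
by move=> qp; elim: t p q a b qp => [|s _ t IH] p q a b qp H r rq;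
  apply: H; exact: cle_trans rq qp.
Qed.

Lemma fr_dense t p (a b : name t) :
  (forall q, cle q p -> exists r, cle r q /\ fr r a b) -> fr p a b.
Proof.
elim: t p a b => [|s _ t IH] p a b H q qp.
  have [r [rq Hr]] := H q qp; have [r' [r'r Hr']] := Hr r (cle_refl r).
  by exists r'; split=> //; exact: cle_trans r'r rq.
move=> c d cd; apply: IH => q' q'q.
have [r [rq' Hr]] := H q' (cle_trans q'q qp).
exists r; split=> //; apply: (Hr r (cle_refl r)).
by apply: fr_mono cd; exact: cle_trans rq' q'q.
Qed.

(** The two properties need each other: transitivity at an arrow type uses an argument related to
    itself, which symmetry and transitivity at the source type provide. *)
Lemma fr_sym_trans t : (forall p (a b : name t), fr p a b -> fr p b a) /\
  (forall p (a b c : name t), fr p a b -> fr p b c -> fr p a c).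
Proof.
elim: t => [|s [symS transS] t [symT transT]]; split.
- move=> p a b H q /H[r [rq [n [ra rb]]]]; by exists r; split=> //; exists n.
- move=> p a b c H H' q qp; have [r [rq [n [ra rb]]]] := H q qp.
  have [r' [r'r [m [rb' rc]]]] := H' r (cle_trans rq qp).
  have Enm : n = m by rewrite -(dec_self rb') -(dec_self (dec_mono r'r rb)).
  exists r'; split; first exact: cle_trans r'r rq.
  by exists m; split=> //; rewrite -Enm; apply: dec_mono ra.
- move=> p a b H q qp c d cd; apply: symT; apply: H => //; exact: symS.
- move=> p a b c H H' q qp d e de; apply: (transT _ _ (napp b d)).
    by apply: H => //; apply: (transS _ _ e) => //; exact: symS.
  exact: H'.
Qed.

Lemma fr_sym t p (a b : name t) : fr p a b -> fr p b a.
Proof. exact: (proj1 (fr_sym_trans t)). Qed.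

Lemma fr_trans t p (a b c : name t) : fr p a b -> fr p b c -> fr p a c.
Proof. exact: (proj2 (fr_sym_trans t)). Qed.

Definition agree t p (a b : name t) : Prop :=
  forall s, good s -> rsub (crel p) s -> a s = b s.

Lemma fr_eqv t p (a a' b b' : name t) :
  agree p a a' -> agree p b b' -> fr p a b -> fr p a' b'.
Proof.
have mono u q q' (c d : name u) : cle q' q -> agree q c d -> agree q' c d.
  by move=> [H _] cd s gs rs; apply: cd => // x n /H/rs.
elim: t p a a' b b' => [|s _ t IH] p a a' b b' aa bb H q qp.
  have [r [rq [n [ra rb]]]] := H q qp; exists r; split=> //.
  have rp := cle_trans rq qp.
  by exists n; split=> s gs rs; rewrite -?(mono _ _ _ _ _ rp aa s gs rs)
    -?(mono _ _ _ _ _ rp bb s gs rs); auto.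
move=> c d cd; apply: (IH q (napp a c) _ (napp b d)); last exact: H.
  by move=> s' gs rs; rewrite /napp (mono _ _ _ _ _ qp aa s' gs rs).
by move=> s' gs rs; rewrite /napp (mono _ _ _ _ _ qp bb s' gs rs).
Qed.

Lemma fr_left t p (a b : name t) : fr p a b -> fr p a a.
Proof. by move=> H; apply: fr_trans H (fr_sym H). Qed.

Definition low (t : ty) : Prop := t = ty0 \/ t = ty1.

Lemma fr_dec t p (a : name t) v : low t -> dec (crel p) a v -> fr p a (ground v).
Proof.
move=> [E|E]; move: a v; rewrite E => a v H q qp.
  by exists q; split=> //; exists v; split=> //; exact: dec_mono H.
move=> c d cd q' q'q; have [r [rq' [n [rc rd]]]] := cd q' q'q; exists r; split=> //.
have rp : cle r p by apply: cle_trans rq' _; exact: cle_trans q'q qp.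
exists (v n); split=> s gs rs; rewrite /napp ?(rc s) ?(rd s) //.
by rewrite (dec_mono rp H).
Qed.

Lemma fr_ground t p (v : Fty t) : low t -> fr p (ground v) (ground v).
Proof. by move=> lt; apply: fr_dec. Qed.

(** At type 0 this is built into [fr]. At type 1 requirement n asks that the value at n be decided,
    and the limit of the fusion decides all values together. *)
Lemma low_dense t p (a : name t) : low t -> fr p a a ->
  exists r v, cle r p /\ dec (crel r) a v.
Proof.
move=> [E|E]; move: a; rewrite E => a H.
  by have [r [rp [n [ra _]]]] := H p (cle_refl p); exists r, n.
pose D n r := exists v, dec (t := ty0) r (napp a (@ground ty0 n)) v.
have [n r s rs [v Hv]|n q qp|r [rp Hr]] := @fusion D p.
- by exists v => s' gs' ss'; apply: Hv => // x m /rs/ss'.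
- have := H q qp _ _ (@fr_ground ty0 q n (or_introl eq_refl)).
  by move=> /(_ q (cle_refl q))[r [rq [v [Hv _]]]]; exists r; split=> //; exists v.
exists r, (fun n => epsilon (inhabits 0) (fun v => dec (t := ty0) (crel r) (napp a (@ground ty0 n)) v)).
split=> // s gs rs; apply: functional_extensionality => n.
exact: (epsilon_spec (inhabits 0)
  (fun v => dec (t := ty0) (crel r) (napp a (@ground ty0 n)) v) (Hr n) s gs rs).
Qed.

Definition nev G (f : env name G) t (a : tm G t) : name t :=
  fun r => fev (fun u v => f u v r) a.

Definition genv G p (f g : env name G) : Prop := forall t v, fr p (f t v) (g t v).

Lemma genv_mono G p q (f g : env name G) : cle q p -> genv p f g -> genv q f g.
Proof. by move=> qp H t v; exact: fr_mono qp (H t v). Qed.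

Lemma genv_scons G s p (a b : name s) (f g : env name G) :
  fr p a b -> genv p f g -> genv p (a .: f) (b .: g).
Proof. by move=> ab fg t v; elim/var_case: t / v. Qed.

Lemma genv_nil p (f g : env name []) : genv p f g.
Proof. by move=> t v; elim/var_nil: t / v. Qed.

Lemma fr_cst t p (c : cst t) : fr p (ground (fcst c)) (ground (fcst c)).
Proof.
case: t / c => [||||r s|r s t|s].
- by apply: fr_ground; left.
- by apply: fr_ground; left.
- move=> q _ a b ab q' q'q c d cd q'' q''q'.
  have [r [rq [n [ra rb]]]] := ab q'' (cle_trans q''q' q'q).
  have [r' [r'r [m [rc rd]]]] := cd r (cle_trans rq q''q').
  exists r'; split; first exact: cle_trans r'r rq.
  exists (n + m); split=> s gs rs; rewrite /napp /ground /=.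
    by rewrite (dec_mono r'r ra gs rs) (rc s gs rs).
  by rewrite (dec_mono r'r rb gs rs) (rd s gs rs).
- move=> q _ a b ab q' q'q c d cd q'' q''q'.
  have [r [rq [n [ra rb]]]] := ab q'' (cle_trans q''q' q'q).
  have [r' [r'r [m [rc rd]]]] := cd r (cle_trans rq q''q').
  exists r'; split; first exact: cle_trans r'r rq.
  exists (n * m); split=> s gs rs; rewrite /napp /ground /=.
    by rewrite (dec_mono r'r ra gs rs) (rc s gs rs).
  by rewrite (dec_mono r'r rb gs rs) (rd s gs rs).
- by move=> q _ a b ab q' q'q c d _; exact: fr_mono ab.
- move=> q _ a b ab q' q'q c d cd q'' q''q' x y xy.
  apply: (ab q'' (cle_trans q''q' q'q) x y xy q'' (cle_refl _)).
  exact: cd.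
- move=> q _ f g fg q' q'q a b ab q'' q''q' x y xy.
  (* The number of iterations is decided first; then induction on a ground number shows the iterates
     related, at every type s. *)
  apply: fr_dense => q1 q1q; have [r [rq1 [n [rx ry]]]] := xy q1 q1q.
  exists r; split=> //.
  suff H : forall n, fr r (fun s0 => nat_rect (fun _ => Fty s) (a s0) (f s0) n)
      (fun s0 => nat_rect (fun _ => Fty s) (b s0) (g s0) n).
    apply: fr_eqv (H n) => s0 gs rs; rewrite /napp /ground /=; first by rewrite (rx s0 gs rs).
    by rewrite (ry s0 gs rs).
  have rq' : cle r q' by apply: cle_trans rq1 _; apply: cle_trans q1q q''q'.
  elim=> [|m IH]; first exact: fr_mono ab.
  have := fg r (cle_trans rq' q'q) _ _ (@fr_ground ty0 r m (or_introl eq_refl)).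
  by move=> /(_ r (cle_refl r) _ _ IH).
Qed.

Lemma fr_nev G p (f g : env name G) t (a : tm G t) :
  genv p f g -> fr p (nev f a) (nev g a).
Proof.
move=> fg; elim: t / a => [t v|t c|s t a IHa b IHb]; first exact: fg.
  exact: fr_cst.
exact: (IHa p (cle_refl p) _ _ IHb).
Qed.

(** * Weak forcing *)

Fixpoint force G (p : cond) (f : env name G) (A : fm G) : Prop :=
  match A in fm _ return Prop with
  | Eq a b => fr p (nev f a) (nev f b)
  | Lt a b => forall q, cle q p -> exists r, cle r q /\ exists m n,
      dec (crel r) (nev f a) m /\ dec (crel r) (nev f b) n /\ m < n
  | Bot => False
  | Imp A B => forall q, cle q p -> force q f A -> force q f B
  | And A B => force p f A /\ force p f B
  | Or A B => forall q, cle q p -> exists r, cle r q /\ (force r f A \/ force r f B)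
  | All s A => forall q, cle q p -> forall a : name s, fr q a a -> force q (a .: f) A
  | Ex s A => forall q, cle q p -> exists r, cle r q /\ exists a : name s,
      fr r a a /\ force r (a .: f) A
  end.

Lemma force_mono G (A : fm G) p q f : cle q p -> force p f A -> force q f A.
Proof.
elim: G / A p q f => [G a b|G a b|G|G A IA B IB|G A IA B IB|G A IA B IB|G s A IA|G s A IA]
  p q f qp //=.
- exact: (@fr_mono ty0).
- by move=> H r rq; apply: H; exact: cle_trans rq qp.
- by move=> H r rq; apply: H; exact: cle_trans rq qp.
- by move=> [HA HB]; split; [exact: IA HA|exact: IB HB].
- by move=> H r rq; apply: H; exact: cle_trans rq qp.
- by move=> H r rq; apply: H; exact: cle_trans rq qp.
- by move=> H r rq; apply: H; exact: cle_trans rq qp.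
Qed.

(** Density plays the part of double negation; this is what makes classical reductio sound. *)
Lemma force_dense G (A : fm G) p f :
  (forall q, cle q p -> exists r, cle r q /\ force r f A) -> force p f A.
Proof.
elim: G / A p f => [G a b|G a b|G|G A IA B IB|G A IA B IB|G A IA B IB|G s A IA|G s A IA]
  p f H /=.
- exact: (@fr_dense ty0).
- move=> q qp; have [r [rq Hr]] := H q qp; have [r' [r'r Hr']] := Hr r (cle_refl r).
  by exists r'; split=> //; exact: cle_trans r'r rq.
- by have [r [_]] := H p (cle_refl p).
- move=> q qp HA; apply: IB => q' q'q; have [r [rq' Hr]] := H q' (cle_trans q'q qp).
  exists r; split=> //; apply: Hr => //; apply: force_mono HA; exact: cle_trans rq' q'q.
- by split; [apply: IA|apply: IB] => q /H[r [rq [HA HB]]]; exists r.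
- move=> q qp; have [r [rq Hr]] := H q qp; have [r' [r'r Hr']] := Hr r (cle_refl r).
  by exists r'; split=> //; exact: cle_trans r'r rq.
- move=> q qp a aa; apply: IA => q' q'q; have [r [rq' Hr]] := H q' (cle_trans q'q qp).
  exists r; split=> //; apply: Hr => //; apply: fr_mono aa; exact: cle_trans rq' q'q.
- move=> q qp; have [r [rq Hr]] := H q qp; have [r' [r'r Hr']] := Hr r (cle_refl r).
  by exists r'; split=> //; exact: cle_trans r'r rq.
Qed.

Lemma force_ext' G (A : fm G) p f g : genv p f g -> force p f A -> force p g A.
Proof.
have sym G' p' (f' g' : env name G') : genv p' f' g' -> genv p' g' f'.
  by move=> H t v; exact: fr_sym.
elim: G / A p f g => [G a b|G a b|G|G A IA B IB|G A IA B IB|G A IA B IB|G s A IA|G s A IA]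
  p f g fg //=.
- move=> H; apply: (@fr_trans ty0 _ _ (nev f a)); first exact/(@fr_sym ty0)/(@fr_nev _ _ _ _ ty0).
  by apply: (@fr_trans ty0 _ _ _ _ H); exact: (@fr_nev _ _ _ _ ty0).
- move=> H q qp; have [r [rq [m [n [ra [rb mn]]]]]] := H q qp.
  have fg_r : genv r f g by apply: genv_mono fg; exact: cle_trans rq qp.
  have [r1 [r1r [m' [a1 a1']]]] := @fr_nev _ _ _ _ ty0 a fg_r r (cle_refl r).
  have [r2 [r2r [n' [b1 b1']]]] := @fr_nev _ _ _ _ ty0 b fg_r r1 r1r.
  exists r2; split; first by apply: cle_trans rq; exact: cle_trans r2r r1r.
  exists m, n; split; [|split] => //.
    have -> : m = m' by rewrite -(dec_self a1) (dec_self (dec_mono r1r ra)).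
    exact: dec_mono a1'.
  have -> : n = n' by rewrite -(dec_self b1) (dec_self (dec_mono (cle_trans r2r r1r) rb)).
  exact: b1'.
- move=> H q qp HA; apply: (IB q f); first exact: genv_mono fg.
  by apply: H => //; apply: (IA q g) HA; apply: sym; exact: genv_mono fg.
- by move=> [HA HB]; split; [exact: IA HA|exact: IB HB].
- move=> H q qp; have [r [rq Hr]] := H q qp; exists r; split=> //.
  have fg_r : genv r f g by apply: genv_mono fg; exact: cle_trans rq qp.
  by case: Hr => H'; [left; apply: IA H'|right; apply: IB H'].
- move=> H q qp a aa; apply: (IA q (a .: f)); last exact: H.
  by apply: genv_scons => //; exact: genv_mono fg.
- move=> H q qp; have [r [rq [a [aa Hr]]]] := H q qp; exists r; split=> //.
  exists a; split=> //; apply: IA Hr; apply: genv_scons => //.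
  by apply: genv_mono fg; exact: cle_trans rq qp.
Qed.

Lemma nev_ren G D (r : ren G D) (f : env name D) t (a : tm G t) :
  nev f (ren_tm r a) = nev (fun t v => f t (r t v)) a.
Proof. by apply: functional_extensionality => s; rewrite /nev ev_ren. Qed.

Lemma nev_sub G D (r : sub G D) (f : env name D) t (a : tm G t) :
  nev f (sub_tm r a) = nev (fun t v => nev f (r t v)) a.
Proof. by apply: functional_extensionality => s; rewrite /nev ev_sub. Qed.

Lemma nev_wk G s (a : name s) (f : env name G) t (b : tm G t) :
  nev (a .: f) (wk b) = nev f b.
Proof. by rewrite /wk nev_ren. Qed.

Lemma force_sub G (A : fm G) : forall D (r : sub G D) p (f : env name D),
  force p f (sub_fm r A) <-> force p (fun t v => nev f (r t v)) A.
Proof.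
have up G' D s (r : sub G' D) (a : name s) f :
    (fun t v => nev (a .: f) (up_sub r v)) = a .: (fun t v => nev f (r t v)).
  by apply: env_ext => t v; elim/var_case: t / v => //= t v; rewrite nev_wk.
elim: G / A => [G a b|G a b|G|G A IA B IB|G A IA B IB|G A IA B IB|G s A IA|G s A IA]
  D r p f //=; rewrite ?nev_sub //.
- by split=> H q qp /IA/(H q qp)/IB.
- by rewrite IA IB.
- by split=> H q qp; have [r' [r'q [H'|H']]] := H q qp; exists r'; split=> //;
    [left|right|left|right]; first [exact/IA|exact/IB].
- by split=> H q qp a aa; move: (H q qp a aa); rewrite IA up.
- by split=> H q qp; have [r' [r'q [a [aa Ha]]]] := H q qp; exists r'; split=> //;
    exists a; split=> //; move: Ha; rewrite IA up.
Qed.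

Lemma force_ren G (A : fm G) D (r : ren G D) p (f : env name D) :
  force p f (ren_fm r A) <-> force p (fun t v => f t (r t v)) A.
Proof. by rewrite -sub_Var_fm force_sub. Qed.

Lemma force_wk G s (A : fm G) p (a : name s) (f : env name G) :
  force p (a .: f) (wk_fm A) <-> force p f A.
Proof. exact: force_ren. Qed.

Lemma force_inst G s (A : fm (s :: G)) (a : tm G s) p (f : env name G) :
  force p f (inst A a) <-> force p (nev f a .: f) A.
Proof.
rewrite /inst force_sub; suff -> : (fun t v => nev f (scons (P := tm G) a
  (fun t v => Var v) v)) = nev f a .: f by [].
by apply: env_ext => t v; elim/var_case: t / v.
Qed.

(** The environment must consist of legitimate names, [genv p f f]: by [fr_nev] the terms
    instantiating quantifiers then denote legitimate names as well. *)
Theorem forcing_sound (T : theory) :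
  (forall A, T A -> forall p, force p (nil_env name) A) ->
  forall G (H : list (fm G)) A, nd T H A ->
  forall p (f : env name G), genv p f f -> (forall B, In B H -> force p f B) -> force p f A.
Proof.
move=> HT G H A; elim; clear G H A.
- move=> G H A r TA p f _ _; apply/force_ren; rewrite (nil_env_eq (fun _ _ => _) (nil_env name)).
  exact: HT.
- by move=> G H A inA p f _; exact.
- move=> G H A _ IH p f ff HH; apply: force_dense => q qp; apply: NNPP => nA.
  apply: (IH q f); first exact: genv_mono ff.
  move=> B [<-|inB]; last by apply: force_mono (HH B inB).
  by move=> r rq HA; apply: nA; exists r.
- move=> G H A B _ IH p f ff HH q qp HA; apply: IH; first exact: genv_mono ff.
  by move=> C [<-|inC] //; apply: force_mono (HH C inC).
- by move=> G H A B _ IH1 _ IH2 p f ff HH; apply: (IH1 p f) => //; exact: IH2.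
- by move=> G H A B _ IH1 _ IH2 p f ff HH; split; [exact: IH1|exact: IH2].
- by move=> G H A B _ IH p f ff HH; case: (IH p f ff HH).
- by move=> G H A B _ IH p f ff HH; case: (IH p f ff HH).
- move=> G H A B _ IH p f ff HH q qp; exists q; split=> //; left.
  by apply: force_mono qp _; exact: IH.
- move=> G H A B _ IH p f ff HH q qp; exists q; split=> //; right.
  by apply: force_mono qp _; exact: IH.
- move=> G H A B C _ IH _ IHA _ IHB p f ff HH; apply: force_dense => q qp.
  have [r [rq Hr]] := IH p f ff HH q qp; have rp := cle_trans rq qp.
  exists r; split=> //.
  by case: Hr => Hr; [apply: IHA|apply: IHB]; try exact: genv_mono ff;
    move=> D [<-|inD] //; apply: force_mono (HH D inD).
- move=> G H s A _ IH p f ff HH q qp a aa; apply: IH.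
    by apply: genv_scons => //; exact: genv_mono ff.
  move=> B /in_map_iff[C [<- inC]]; apply/force_wk.
  by apply: force_mono (HH C inC).
- move=> G H s A a _ IH p f ff HH; apply/force_inst; apply: (IH p f) => //.
  exact: fr_nev.
- move=> G H s A a _ IH p f ff HH q qp; exists q; split=> //; exists (nev f a).
  split; first by apply: fr_nev; exact: genv_mono ff.
  by apply/force_inst; apply: force_mono qp _; exact: IH.
- move=> G H s A C _ IH1 _ IH2 p f ff HH; apply: force_dense => q qp.
  have [r [rq [a [aa Ha]]]] := IH1 p f ff HH q qp; have rp := cle_trans rq qp.
  exists r; split=> //; apply/(force_wk C r a); apply: IH2.
    by apply: genv_scons => //; exact: genv_mono ff.
  move=> B [<-|/in_map_iff[D [<- inD]]] //; apply/force_wk.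
  by apply: force_mono (HH D inD).
Qed.

Definition valid (A : fm []) : Prop := forall p, force p (nil_env name) A.

Lemma valid_closure G (A : fm G) :
  (forall p f, genv p f f -> force p f A) -> valid (closure A).
Proof.
elim: G A => [|s G IH] A H p /=; first by apply: H; exact: genv_nil.
apply: IH => {}p f ff q qp a aa; apply: H; apply: genv_scons => //.
exact: genv_mono ff.
Qed.

(** * Quantifier-free formulas are decided by a dense set of conditions *)

Definition decides G (r : cond) (f : env name G) (A : fm G) (P : Prop) : Prop :=
  (forall s, good s -> rsub (crel r) s -> fsat (fun t v => f t v s) A <-> P) /\
  (forall q, cle q r -> force q f A <-> P).

Lemma decides_mono G r q f (A : fm G) P : cle q r -> decides r f A P -> decides q f A P.
Proof.
move=> qr [H1 H2]; split=> [s gs qs|q' q'q]; last by apply: H2; exact: cle_trans qr.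
by apply: H1 => // x n /(proj1 qr)/qs.
Qed.

(** Pointwise truth along the relations and forcing are tied to the same proposition P. So names
    defined by pointwise evaluation can be used to satisfy forced quantifier-free formulas. *)
Lemma qf_decided G (A : fm G) : qf A -> forall p f, genv p f f ->
  exists r P, cle r p /\ decides r f A P.
Proof.
elim: G / A => [G a b|G a b|G|G A IA B IB|G A IA B IB|G A IA B IB|//|//] /= qA p f ff.
- have [r [rp [m [ra _]]]] := @fr_nev _ _ _ _ ty0 a ff p (cle_refl p).
  have [r' [r'r [n [rb _]]]] := @fr_nev _ _ _ _ ty0 b (genv_mono rp ff) r (cle_refl r).
  have {}ra := dec_mono r'r ra.
  exists r', (m = n); split; first exact: cle_trans r'r rp.
  split=> [s gs rs|q qr'].
    by rewrite /= -/(nev f a s) -/(nev f b s) (ra s gs rs) (rb s gs rs).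
  split=> [H|E].
    have [q' [q'q [k [ka kb]]]] := H q (cle_refl q).
    have q'r := cle_trans q'q qr'.
    by rewrite -(dec_self (dec_mono q'r ra)) -(dec_self (dec_mono q'r rb))
      (dec_self ka) (dec_self kb).
  move=> q' q'q; exists q'; split=> //; exists m; split.
    by apply: dec_mono ra; exact: cle_trans q'q qr'.
  by rewrite E; apply: dec_mono rb; exact: cle_trans q'q qr'.
- have [r [rp [m [ra _]]]] := @fr_nev _ _ _ _ ty0 a ff p (cle_refl p).
  have [r' [r'r [n [rb _]]]] := @fr_nev _ _ _ _ ty0 b (genv_mono rp ff) r (cle_refl r).
  have {}ra := dec_mono r'r ra.
  exists r', (m < n); split; first exact: cle_trans r'r rp.
  split=> [s gs rs|q qr'].
    by rewrite /= -/(nev f a s) -/(nev f b s) (ra s gs rs) (rb s gs rs).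
  split=> [H|E].
    have [q' [q'q [k [l [ka [kb kl]]]]]] := H q (cle_refl q).
    have q'r := cle_trans q'q qr'.
    by rewrite -(dec_self (dec_mono q'r ra)) -(dec_self (dec_mono q'r rb))
      (dec_self ka) (dec_self kb).
  move=> q' q'q; have q'r := cle_trans q'q qr'.
  exists q'; split=> //; exists m, n; split; first exact: dec_mono ra.
  by split=> //; exact: dec_mono rb.
- by exists p, False; split=> //; split.
- have [r [P [rp HP]]] := IA (proj1 qA) p f ff.
  have [r' [Q [r'r [Q1 Q2]]]] := IB (proj2 qA) r f (genv_mono rp ff).
  have [P1 P2] := decides_mono r'r HP.
  exists r', (P -> Q); split; first exact: cle_trans r'r rp.
  split=> [s gs rs|q qr']; first by rewrite /= (P1 s gs rs) (Q1 s gs rs).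
  split=> [H p0|H q' q'q]; last first.
    have q'r := cle_trans q'q qr'.
    by move/(P2 _ q'r)/H/(Q2 _ q'r).
  by apply/(Q2 q qr')/H => //; exact/P2.
- have [r [P [rp HP]]] := IA (proj1 qA) p f ff.
  have [r' [Q [r'r [Q1 Q2]]]] := IB (proj2 qA) r f (genv_mono rp ff).
  have [P1 P2] := decides_mono r'r HP.
  exists r', (P /\ Q); split; first exact: cle_trans r'r rp.
  split=> [s gs rs|q qr']; first by rewrite /= (P1 s gs rs) (Q1 s gs rs).
  by rewrite /= (P2 q qr') (Q2 q qr').
- have [r [P [rp HP]]] := IA (proj1 qA) p f ff.
  have [r' [Q [r'r [Q1 Q2]]]] := IB (proj2 qA) r f (genv_mono rp ff).
  have [P1 P2] := decides_mono r'r HP.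
  exists r', (P \/ Q); split; first exact: cle_trans r'r rp.
  split=> [s gs rs|q qr']; first by rewrite /= (P1 s gs rs) (Q1 s gs rs).
  split=> [H|H q' q'q].
    have [q' [q'q H']] := H q (cle_refl q); have q'r := cle_trans q'q qr'.
    by case: H' => /= H'; [left; apply/(P2 _ q'r)|right; apply/(Q2 _ q'r)].
  have q'r := cle_trans q'q qr'; exists q'; split=> //.
  by case: H => H; [left; apply/(P2 _ q'r)|right; apply/(Q2 _ q'r)].
Qed.

Lemma force_qf_true G (A : fm G) p f : qf A -> genv p f f ->
  (forall g, fsat g A) -> force p f A.
Proof.
move=> qA ff H; apply: force_dense => q qp.
have [r [P [rq [H1 H2]]]] := qf_decided qA (genv_mono qp ff).
exists r; split=> //; apply/(H2 r (cle_refl r)).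
by apply/(H1 (crel r) (cgood r)) => // x n.
Qed.

(** * Absoluteness of second-order formulas *)

Fixpoint second_order G (A : fm G) : Prop :=
  match A with
  | Eq _ _ | Lt _ _ | Bot => True
  | Imp A B | And A B | Or A B => second_order A /\ second_order B
  | All s A | Ex s A => low s /\ second_order A
  end.

Definition genv_of G (g : env Fty G) : env name G := fun t v => ground (g t v).

Lemma genv_of_scons G s (x : Fty s) (g : env Fty G) :
  genv_of (x .: g) = ground x .: genv_of g.
Proof. exact: (scons_comp (@ground)). Qed.

Lemma genv_of_low G p (g : env Fty G) : (forall t, var G t -> low t) ->
  genv p (genv_of g) (genv_of g).
Proof. by move=> lG t v; apply: fr_ground; exact: lG v. Qed.

(** Quantifiers run over types 0 and 1, where [low_dense] replaces a name by a ground value.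
    Parameters may have higher type, as [Sk] does, provided their ground names are legitimate. *)
Lemma absolute G (A : fm G) : second_order A -> forall p (g : env Fty G),
  (forall q, genv q (genv_of g) (genv_of g)) ->
  force p (genv_of g) A <-> fsat g A.
Proof.
have scons_ok G' s (x : Fty s) (g : env Fty G') : low s ->
    (forall q, genv q (genv_of g) (genv_of g)) ->
    forall q, genv q (genv_of (x .: g)) (genv_of (x .: g)).
  by move=> ls gg q; rewrite genv_of_scons; apply: genv_scons => //; exact: fr_ground.
elim: G / A => [G a b|G a b|G|G A IA B IB|G A IA B IB|G A IA B IB|G s A IA|G s A IA]
  /= soA p g gg.
- have E (c : tm G ty0) : nev (genv_of g) c = ground (t := ty0) (fev g c) by [].
  split=> [H|H]; last first.
    by move=> q qp; exists q; split=> //; rewrite !E H; exists (fev g b).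
  have [q [_ [n [/dec_self + /dec_self]]]] := H p (cle_refl p).
  by rewrite !E /ground => -> ->.
- have E (c : tm G ty0) : nev (genv_of g) c = ground (t := ty0) (fev g c) by [].
  split=> [H|H].
    have [q [_ [m [n [/dec_self + [/dec_self + mn]]]]]] := H p (cle_refl p).
    by rewrite !E /ground => -> ->.
  by move=> q qp; exists q; split=> //; exists (fev g a), (fev g b).
- by [].
- have {}IA q := IA (proj1 soA) q g gg; have {}IB q := IB (proj2 soA) q g gg.
  split=> [H /(IA p) HA|H q qp /IA/H/IB]; last exact.
  by apply/(IB p)/H.
- by rewrite (IA (proj1 soA)) // (IB (proj2 soA)).
- have {}IA q := IA (proj1 soA) q g gg; have {}IB q := IB (proj2 soA) q g gg.
  split=> [H|H q qp].
    by have [q [_ [/IA|/IB]]] := H p (cle_refl p); [left|right].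
  by exists q; split=> //; case: H => [/(IA q)|/(IB q)]; [left|right].
- case: soA => ls soA; have {}IA q x := IA soA q (x .: g) (scons_ok _ _ x g ls gg).
  split=> [H x|H q qp a aa].
    have := H p (cle_refl p) (ground x) (fr_ground _ _ ls).
    by rewrite -genv_of_scons IA.
  apply: force_dense => q' q'q.
  have [r [v [rq' Hv]]] := low_dense ls (fr_mono q'q aa).
  exists r; split=> //; apply: (@force_ext' _ _ _ (ground v .: genv_of g)); last first.
    by rewrite -genv_of_scons IA.
  by apply: genv_scons => //; exact/fr_sym/fr_dec.
- case: soA => ls soA; have {}IA q x := IA soA q (x .: g) (scons_ok _ _ x g ls gg).
  split=> [H|[x Hx] q qp]; last first.
    exists q; split=> //; exists (ground x); split; first exact: fr_ground.
    by rewrite -genv_of_scons IA.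
  have [q [qp [a [aa Ha]]]] := H p (cle_refl p).
  have [r [v [rq Hv]]] := low_dense ls aa.
  exists v; apply/(IA r); rewrite genv_of_scons.
  apply: (force_ext' _ (force_mono rq Ha)).
  by apply: genv_scons => //; exact: fr_dec.
Qed.

Lemma absolute_ren D (A : fm D) G (r : ren D G) p (f : env name G) (g : env Fty D) :
  second_order A -> (forall t, var D t -> low t) ->
  (forall t (v : var D t), dec (crel p) (f t (r t v)) (g t v)) ->
  force p f (ren_fm r A) <-> fsat g A.
Proof.
move=> soA lD fg; rewrite force_ren -(absolute soA p); last by move=> q; exact: genv_of_low.
have H : genv p (fun t v => f t (r t v)) (genv_of g).
  by move=> t v; apply: fr_dec; [exact: lD v|exact: fg].
by split; apply: force_ext' => // t v; exact: fr_sym.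
Qed.

(** * The axioms of the base theory *)

Lemma force_eq_at G p (f : env name G) t (a b : tm G t) : genv p f f ->
  force p f (eq_at a b) <-> fr p (nev f a) (nev f b).
Proof.
elim: t G p f a b => // s _ t IH G p f a b ff.
have E q (c : name s) : genv q f f -> fr q c c ->
    force q (c .: f) (eq_at (wk a @ x0) (wk b @ x0))
    <-> fr q (napp (nev f a) c) (napp (nev f b) c).
  move=> ffq cc; rewrite IH; last exact: genv_scons.
  by rewrite -(nev_wk c f a) -(nev_wk c f b).
split=> [H q qp c d cd|H q qp c cc].
  apply: fr_trans (_ : fr q (napp (nev f b) c) _).
    by apply/E; [exact: genv_mono ff|exact: fr_left cd|apply: H => //; exact: fr_left cd].
  exact: (fr_nev b ff) cd.
by apply/E => //; [exact: genv_mono ff|exact: H].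
Qed.

Lemma nev_eq_force G p (f : env name G) (a b : tm G ty0) : genv p f f ->
  nev f a = nev f b -> force p f (a == b).
Proof. by move=> ff E; rewrite /= E; exact: (@fr_nev _ _ _ _ ty0). Qed.

Lemma valid_Pi r s :
  valid (All r (All s (eq_at (Cst (Pi r s) @ x1 @ x0) x1))).
Proof.
apply: (@valid_closure [s; r]) => p f ff; apply/force_eq_at => //.
exact: (fr_nev x1 ff).
Qed.

Lemma valid_Sigma r s t :
  valid (All (r --> s --> t) (All (r --> s) (All r
    (eq_at (Cst (Sigma r s t) @ x2 @ x1 @ x0) (x2 @ x0 @ (x1 @ x0)))))).
Proof.
apply: (@valid_closure [r; r --> s; r --> s --> t]) => p f ff; apply/force_eq_at => //.
exact: (fr_nev (x2 @ x0 @ (x1 @ x0)) ff).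
Qed.

(** Through [force_eq_at] this is the arrow clause of [fr]. *)
Lemma valid_ext r t : valid (All (r --> t) (All r (All r
  (eq_at x1 x0 ==> eq_at (x2 @ x1) (x2 @ x0))))).
Proof.
apply: (@valid_closure [r; r; r --> t]) => p f ff q qp.
move/(force_eq_at _ _ (genv_mono qp ff)) => xy.
apply/(force_eq_at _ _ (genv_mono qp ff)).
have K := fr_nev x2 ff; exact: (K q qp _ _ xy).
Qed.

(** A name of type 0 is densely equal to a numeral, so induction is inherited from the ambient
    natural numbers. *)
Lemma valid_ind G (A : fm (ty0 :: G)) : valid (closure
  (inst A zero
   ==> All ty0 (A ==> sub_fm (scons (P := tm (ty0 :: G)) (succ x0) (fun _ v => Var (vs v))) A)
   ==> All ty0 A)).
Proof.
apply: valid_closure => p f ff q qp /force_inst A0 q1 q1q AS q2 q2q1 a aa.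
have q1p := cle_trans q1q qp; have q2p := cle_trans q2q1 q1p.
have H n : force q1 (@ground ty0 n .: f) A.
  elim: n => [|n IH]; first exact: force_mono q1q A0.
  have := AS q1 (cle_refl q1) _ (@fr_ground ty0 q1 n (or_introl eq_refl)) q1 (cle_refl q1) IH.
  move/force_sub; suff -> : (fun t v => nev (@ground ty0 n .: f)
      (scons (P := tm (ty0 :: G)) (succ x0) (fun _ v => Var (vs v)) v))
    = @ground ty0 (S n) .: f by [].
  apply: env_ext => t v; elim/var_case: t / v => //=.
  by apply: functional_extensionality => s; rewrite /nev /ground /= Nat.add_1_r.
apply: force_dense => q' q'q2.
have [r [v [rq' Hv]]] := low_dense (or_introl eq_refl) (fr_mono q'q2 aa).
have rq1 : cle r q1 by apply: cle_trans rq' _; exact: cle_trans q'q2 q2q1.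
exists r; split=> //; apply: (force_ext' _ (force_mono rq1 (H v))).
apply: genv_scons; first exact/fr_sym/(fr_dec (or_introl eq_refl)).
by apply: genv_mono ff; exact: cle_trans rq1 q1p.
Qed.

Definition least (P : nat -> Prop) : nat :=
  epsilon (inhabits 0) (fun n => P n /\ forall m, m < n -> ~ P m).

Lemma leastP P n : P n -> P (least P) /\ forall m, m < least P -> ~ P m.
Proof.
move=> Pn; apply: (epsilon_spec (inhabits 0) (fun n => P n /\ forall m, m < n -> ~ P m)).
elim/(well_founded_induction Wf_nat.lt_wf): n Pn => n IH Pn.
case: (classic (exists m, m < n /\ P m)) => [[m [mn Pm]]|H]; first exact: IH Pm.
by exists n; split=> // m mn Pm; apply: H; exists m.
Qed.

Lemma least_unique P n : P n -> (forall m, m < n -> ~ P m) -> least P = n.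
Proof.
move=> Pn H; have [Pl Hl] := leastP Pn.
case: (Nat.lt_trichotomy (least P) n) => [/H //|[//|/Hl //]].
Qed.

(** The choice functional takes the least witness, computed pointwise along s. Once some n is forced
    to be a witness at a ground sequence, deciding the matrix for all m <= n settles the least one,
    so the functional is a legitimate name. *)
Lemma valid_qfac G (A : fm (ty0 :: ty1 :: G)) : qf A -> valid (closure
  (All ty1 (Ex ty0 A)
   ==> Ex (ty1 --> ty0) (All ty1
         (sub_fm (scons (P := tm (ty1 :: ty2 :: G)) (x1 @ x0)
                   (scons (P := tm (ty1 :: ty2 :: G)) x0
                     (fun _ v => Var (vs (vs v))))) A)))).
Proof.
move=> qA; apply: valid_closure => p f ff q qp H q1 q1q.
pose Q (s : rel) (g : nat -> nat) (n : nat) :=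
  fsat ((n : dom full ty0) .: ((g : dom full ty1) .: (fun t v => f t v s))) A.
pose Y : name ty2 := fun s g => least (Q s g).
have core r (x : name ty1) : cle r q -> fr r x x -> exists r' (g : nat -> nat) n,
    cle r' r /\ dec (t := ty1) (crel r') x g /\ dec (t := ty0) (crel r') (napp Y x) n /\
    force r' (@ground ty0 n .: (@ground ty1 g .: f)) A.
  move=> rq xx; have [r0 [g [r0r Hg]]] := low_dense (or_intror eq_refl) xx.
  have r0q := cle_trans r0r rq.
  have [r1 [r1r0 [y [yy Hy]]]] := H r0 r0q _ (@fr_ground ty1 r0 g (or_intror eq_refl)) r0 (cle_refl _).
  have [r2 [n [r2r1 Hn]]] := low_dense (or_introl eq_refl) yy.
  have r2q : cle r2 q by apply: cle_trans r2r1 _; exact: cle_trans r1r0 r0q.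
  have ok m r' : cle r' r2 -> genv r' (@ground ty0 m .: (@ground ty1 g .: f))
      (@ground ty0 m .: (@ground ty1 g .: f)).
    move=> r'r2; apply: genv_scons; first by apply: fr_ground; left.
    apply: genv_scons; first by apply: fr_ground; right.
    by apply: genv_mono ff; apply: cle_trans qp; exact: cle_trans r'r2 r2q.
  have Fn : force r2 (@ground ty0 n .: (@ground ty1 g .: f)) A.
    apply: (force_ext' _ (force_mono r2r1 Hy)).
    apply: genv_scons; first exact: (fr_dec (or_introl eq_refl)).
    by move=> t v; exact: (ok n r2 (cle_refl _) t (vs v)).
  (* Finitely many successive extensions decide the instances m = 0, ..., n. *)
  have [r3 [r3r2 [P HP]]] : exists r3, cle r3 r2 /\ exists P : nat -> Prop,
      forall m, m <= n -> decides r3 (@ground ty0 m .: (@ground ty1 g .: f)) A (P m).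
    move: (n) => k; elim: k => [|k [r3 [r3r2 [P HP]]]].
      have [r3 [P [r3r2 HP]]] := qf_decided qA (ok 0 r2 (cle_refl _)).
      exists r3; split=> //; exists (fun _ => P) => m m0.
      by have -> : m = 0 by lia.
    have [r4 [P' [r4r3 HP']]] := qf_decided qA (ok (S k) r3 r3r2).
    exists r4; split; first exact: cle_trans r4r3 r3r2.
    exists (fun m => (m <= k -> P m) /\ (m = S k -> P')) => m mk.
    case: (Nat.eq_dec m (S k)) => [->|nm].
      have -> // : ((S k <= k -> P (S k)) /\ (S k = S k -> P')) = P'.
      by apply: propositional_extensionality; split=> [[_]|]; [apply|split=> //; lia].
    have -> : ((m <= k -> P m) /\ (m = S k -> P')) = P m.
      by apply: propositional_extensionality; split=> [[h _]|h]; [apply: h; lia|split].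
    by apply: decides_mono r4r3 _; apply: HP; lia.
  have Pn : P n.
    by have [_ /(_ r3 (cle_refl _)) <-] := HP n (le_n n); exact: force_mono Fn.
  have [Pl Pmin] := leastP Pn; set l := least P in Pl Pmin.
  have ln : l <= n by case: (Nat.le_gt_cases l n) => // /Pmin.
  have rr : cle r3 r0 by apply: cle_trans r3r2 _; exact: cle_trans r2r1 r1r0.
  have Hg3 := dec_mono rr Hg.
  exists r3, g, l; split; first exact: cle_trans rr r0r.
  split=> //; split.
    move=> s gs rs; rewrite /napp (Hg3 s gs rs) /Y.
    have E m : m <= n -> Q s g m <-> P m.
      move=> mn; have [/(_ s gs rs) + _] := HP m mn.
      by rewrite (scons_comp (fun t (a : name t) => a s)) (scons_comp (fun t (a : name t) => a s)).
    apply: least_unique; first exact/E.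
    by move=> m ml /E Pm; apply: (Pmin m) => //; apply: Pm; lia.
  by have [_ /(_ r3 (cle_refl _)) ->] := HP l ln.
have YY r : cle r q -> fr r Y Y.
  move=> rq r' r'r c d cd r'' r''r'; change (fr (t := ty1) r' c d) in cd.
  have r''q : cle r'' q by apply: cle_trans rq; exact: cle_trans r''r' r'r.
  have cd'' := @fr_mono ty1 _ _ c d r''r' cd.
  have [r1 [g [n [r1r [Hc [HY _]]]]]] := core r'' c r''q (fr_left cd'').
  have dd : fr (t := ty1) r1 d (@ground ty1 g).
    apply: fr_trans (_ : fr r1 c _); first exact/fr_sym/(fr_mono r1r cd'').
    exact: (fr_dec (or_intror eq_refl)).
  have [r2 [g' [r2r1 Hd]]] := low_dense (or_intror eq_refl) (fr_left dd).
  have Eg : g' = g.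
    have /(_ r2 (cle_refl r2)) := fr_mono r2r1 dd; move=> K.
    apply: functional_extensionality => i.
    have [r3 [r3r2 [m [K1 K2]]]] := K _ _ (@fr_ground ty0 r2 i (or_introl eq_refl)) r2 (cle_refl r2).
    have := dec_self K1; have := dec_self K2; rewrite /napp (dec_self (dec_mono r3r2 Hd)).
    by rewrite /ground => -> ->.
  exists r2; split; first exact: cle_trans r2r1 r1r.
  exists n; split; first exact: dec_mono HY.
  move=> s gs rs; rewrite /napp (Hd s gs rs) Eg.
  have := dec_mono r2r1 HY gs rs; rewrite /napp.
  by rewrite (dec_mono r2r1 Hc gs rs).
exists q1; split=> //; exists Y; split; first exact: YY.
move=> q2 q2q1 x xx; apply: force_dense => q3 q3q2.
have q3q : cle q3 q by apply: cle_trans q3q2 _; exact: cle_trans q2q1 q1q.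
have [r [g [n [rq3 [Hx [HY HA]]]]]] := core q3 x q3q (fr_mono q3q2 xx).
exists r; split=> //; apply/force_sub.
apply: (force_ext' _ HA).
have -> : (fun t v => nev (x .: (Y .: f)) (scons (P := tm (ty1 :: ty2 :: G)) (x1 @ x0)
    (scons (P := tm (ty1 :: ty2 :: G)) x0 (fun _ v => Var (vs (vs v)))) v))
  = napp Y x .: (x .: f).
  apply: env_ext => t v; elim/var_case: t / v => // t v.
  by elim/var_case: t / v.
apply: genv_scons; first exact/fr_sym/(fr_dec (or_introl eq_refl)).
apply: genv_scons; first exact/fr_sym/(fr_dec (or_intror eq_refl)).
by apply: genv_mono ff; apply: cle_trans qp; exact: cle_trans rq3 q3q.
Qed.

Lemma valid_RCA0w A : RCA0w A -> valid A.
Proof.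
case=> {A} [A inA|r s|r s t|||r t|G A _|G A].
- apply: valid_closure => p f ff; apply: force_qf_true => //; last first.
    by move=> g; exact: (rca_arith full_rca).
  rewrite /arith_axioms /= in inA.
  by repeat (case: inA => [<-|inA]; [do ?split|]).
- exact: valid_Pi.
- exact: valid_Sigma.
- apply: (@valid_closure [ty0; ty0 --> ty0 --> ty0]) => p f ff.
  exact: nev_eq_force.
- apply: (@valid_closure [ty0; ty0; ty0 --> ty0 --> ty0]) => p f ff.
  apply: nev_eq_force => //; apply: functional_extensionality => s.
  by rewrite /nev /= Nat.add_1_r.
- exact: valid_ext.
- exact: valid_ind.
- exact: valid_qfac.
Qed.

(** * The functionals S_k *)

Lemma fr_ground2 p (v : Fty ty2) : fr p (@ground ty2 v) (@ground ty2 v).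
Proof.
move=> q qp c d cd q' q'q.
have {}cd : fr (t := ty1) q' c d by exact: (@fr_mono ty1 _ _ c d q'q cd).
(* Related names of type 1 are densely equal to one and the same ground sequence, so v gives both
   the same value. *)
have [r [g [rq' Hc]]] := low_dense (or_intror eq_refl) (fr_left cd).
have cg : fr (t := ty1) r d (@ground ty1 g).
  apply: fr_trans (_ : fr r c _); first exact/fr_sym/(fr_mono rq' cd).
  exact: (fr_dec (or_intror eq_refl)).
have [r' [g' [r'r Hd]]] := low_dense (or_intror eq_refl) (fr_left cg).
have Eg : g' = g.
  apply: functional_extensionality => i.
  have K : fr r' d (@ground ty1 g) by exact: fr_mono cg.
  have [r3 [r3r' [m [K1 K2]]]] := K r' (cle_refl _) _ _
    (@fr_ground ty0 r' i (or_introl eq_refl)) r' (cle_refl _).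
  have := dec_self K1; have := dec_self K2; rewrite /napp (dec_self (dec_mono r3r' Hd)).
  by rewrite /ground => -> ->.
exists r'; split; first exact: cle_trans r'r rq'.
exists (v g); split=> s gs rs; rewrite /napp /ground; last by rewrite (Hd s gs rs) Eg.
by rewrite (dec_mono r'r Hc gs rs).
Qed.

Lemma second_order_normal_form k : forall b G (f : tm G ty1) gs,
  second_order (normal_form k b f gs).
Proof.
elim: k => [|k IH] [] G f gs /=; split=> //; try by left.
  by right.
by right.
Qed.

Lemma fev_tuple G (F : env Fty G) G' (F' : env Fty G') l l' :
  map (fev F (t := ty0)) l = map (fev F' (t := ty0)) l' ->
  fev F (tuple l) = fev F' (tuple l').
Proof.
elim: l l' => [|a l IH] [|a' l'] //= [Ea El].
have {}IH := IH l' El.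
case: l l' El IH => [|b l] [|b' l'] //= El IH.
by rewrite -[fev F (match l with [] => _ | _ => _ end)]/(fev F (tuple (b :: l))) IH Ea.
Qed.

Lemma fev_bar G (F : env Fty G) (g : tm G ty1) n G' (F' : env Fty G') (g' : tm G' ty1) n' :
  fev F g = fev F' g' -> fev F n = fev F' n' -> fev F (bar g n) = fev F' (bar g' n').
Proof.
move=> Eg En; rewrite /bar /rec0.
set b := lam (lam _); set b' := lam (lam _).
suff E : fev F b = fev F' b'
  by rewrite -[LHS]/(nat_rect (fun _ => nat) 0 (fev F b) (fev F n)) E En.
apply: (rca_ext full_rca) => m; apply: (rca_ext full_rca) => r.
rewrite /b /b' !(ev_lam full_rca) /=.
by rewrite !ev_wk Eg.
Qed.

(** [Sk] evaluates the normal form in a context with f alone, the axiom in one that also contains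
    the functional. Truth depends only on the values of the parameters. *)
Lemma fsat_normal_form k : forall b G (F : env Fty G) f gs
    G' (F' : env Fty G') f' gs',
  fev F f = fev F' f' -> map (fev F (t := ty1)) gs = map (fev F' (t := ty1)) gs' ->
  fsat F (normal_form k b f gs) <-> fsat F' (normal_form k b f' gs').
Proof.
elim: k => [|k IH] b G F f gs G' F' f' gs' Ef Egs.
  have base (n : nat) : fsat ((n : dom full ty0) .: F)
        (wk f @ tuple (map (fun g => bar (wk g) x0) gs) == zero) <->
      fsat ((n : dom full ty0) .: F')
        (wk f' @ tuple (map (fun g => bar (wk g) x0) gs') == zero).
    rewrite /= !ev_wk Ef; set u := ev _ (tuple _); set u' := ev _ (tuple _).
    suff -> : u = u' by [].
    rewrite /u /u'; apply: fev_tuple; rewrite !map_map; clear u u'.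
    elim: gs gs' Egs => [|g gs IHgs] [|g' gs'] // [Eg Egs].
    by apply: (f_equal2 (@cons nat)); [apply: fev_bar; rewrite ?ev_wk|exact: IHgs].
  case: b => /=; last by split=> H x; apply/base; exact: H.
  by split=> -[x H]; exists x; apply/base.
have next (x : Fty ty1) : fsat ((x : dom full ty1) .: F)
      (normal_form k (negb b) (wk f) (map wk gs ++ [x0])) <->
    fsat ((x : dom full ty1) .: F')
      (normal_form k (negb b) (wk f') (map wk gs' ++ [x0])).
  apply: IH; first by rewrite !ev_wk.
  rewrite !map_app !map_map /=; congr (_ ++ _).
  rewrite (map_ext _ (fev F (t := ty1))) => [|a]; last by rewrite ev_wk.
  by rewrite (map_ext (fun x => _) (fev F' (t := ty1))) // => a; rewrite ev_wk.
case: b next => /= next; last by split=> H x; apply/next; exact: H.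
by split=> -[x H]; exists x; apply/next.
Qed.

Definition Sk (k : nat) : Fty ty2 := fun f =>
  if excluded_middle_informative
    (fsat ((f : dom full ty1) .: nil_env Fty) (Sigma1 k x0)) is left _ then 0 else 1.

Lemma valid_S_ax k : valid (S_ax k).
Proof.
move=> p q qp; exists q; split=> //; exists (@ground ty2 (Sk k)).
split; first exact: fr_ground2.
pose B : fm [ty1; ty2] := (x1 @ x0 == zero |' x1 @ x0 == one)
  &' Iff (Sigma1 k x0) (x1 @ x0 == zero).
move=> q1 q1q a aa; apply: (@force_dense _ B) => q2 q2q1.
have [r [g [rq2 Hg]]] := low_dense (or_intror eq_refl) (fr_mono q2q1 aa).
exists r; split=> //.
apply: (@force_ext' _ B _ (@ground ty1 g .: (@ground ty2 (Sk k) .: nil_env name))).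
  apply: genv_scons; first exact/fr_sym/(fr_dec (or_intror eq_refl)).
  by apply: genv_scons; [exact: fr_ground2|exact: genv_nil].
have -> : @ground ty1 g .: (@ground ty2 (Sk k) .: nil_env name)
    = genv_of ((g : dom full ty1) .: ((Sk k : dom full ty2) .: nil_env Fty)).
  by rewrite !genv_of_scons (nil_env_eq (genv_of _) (nil_env name)).
apply/absolute => [|s|].
- do !split; exact: second_order_normal_form.
- rewrite !genv_of_scons; apply: genv_scons; first by apply: fr_ground; right.
  by apply: genv_scons; [exact: fr_ground2|exact: genv_nil].
set F := (_ .: _); have E : fsat F (Sigma1 k x0) <->
    fsat ((g : dom full ty1) .: nil_env Fty) (Sigma1 k x0) by exact: fsat_normal_form.
split; first by rewrite /= /Sk; case: excluded_middle_informative; [left|right].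
have -> : fsat F (Iff (Sigma1 k x0) (x1 @ x0 == zero)) =
  ((fsat F (Sigma1 k x0) -> Sk k g = 0) /\ (Sk k g = 0 -> fsat F (Sigma1 k x0))) by [].
by rewrite E /Sk; case: excluded_middle_informative.
Qed.

(** * Countable choice for numbers *)

Definition fcode (f : nat -> nat) (m n : nat) : Fty ty1 := codeM (M := full) f m n.

(** Once f, m and n are decided, the coded tuple is a ground sequence and membership in Cantor space
    is absolute; only the value of Y at ground points remains to be decided. *)
Lemma force_NCC_matrix G p (F : env name G) Y n m (m0 n0 : nat) : genv p F F ->
  dec (t := ty0) (crel p) (nev F m) m0 -> dec (t := ty0) (crel p) (nev F n) n0 ->
  force p F (NCC_matrix Y n m) <-> forall q, cle q p -> exists r, cle r q /\
    exists h : Fty ty1, cantorM (M := full) h /\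
      dec (t := ty0) (crel r) (napp (nev F Y) (@ground ty1 (fcode h m0 n0))) 0.
Proof.
move=> FF Hm Hn.
have cantorE r (a : name ty1) h : dec (crel r) a h ->
    force r (a .: F) (cantor x0) <-> cantorM (M := full) h.
  move=> Ha; pose rn : ren [ty1] (ty1 :: G) := vz .: nil_env (var (ty1 :: G)).
  rewrite -[cantor x0]/(ren_fm rn (cantor x0)).
  rewrite (@absolute_ren _ _ _ _ _ _ ((h : dom full ty1) .: nil_env Fty)) //.
  - by do !split; left.
  - by move=> t v; elim/var_case: t / v => [|t v]; [right|elim/var_nil: t / v].
  - by move=> t v; elim/var_case: t / v => // t v; elim/var_nil: t / v.
have codeE (a : name ty1) s : nev (a .: F) (wk Y @ code_fmn x0 (wk m) (wk n)) s
    = nev F Y s (fcode (a s) (nev F m s) (nev F n s)).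
  pose F' : env Fty (ty1 :: G) := a s .: (fun t v => F t v s).
  have EF : (fun u v => scons a F v s) = F' by exact: (scons_comp (fun t (a : name t) => a s)).
  rewrite -[LHS]/(fev (fun u v => scons a F v s) (wk Y)
    (fev (fun u v => scons a F v s) (code_fmn x0 (wk m) (wk n)))).
  by rewrite EF /F' ev_wk (ev_code_fmn full_rca).
split=> H q qp.
  have [r [rq [a [aa [Ca Ea]]]]] := H q qp.
  have [r1 [h [r1r Hh]]] := low_dense (or_intror eq_refl) aa.
  have [r2 [r2r1 [k [K1 K2]]]] := Ea r1 r1r.
  have k0 : k = 0 by rewrite -(dec_self K2).
  have r2q : cle r2 q by apply: cle_trans rq; exact: cle_trans r2r1 r1r.
  have r2p := cle_trans r2q qp.
  exists r2; split=> //; exists h; split.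
    by apply/(cantorE r1 a h Hh); exact: (@force_mono _ (cantor x0) _ _ _ r1r Ca).
  move=> s gs rs; have := K1 s gs rs; rewrite codeE k0 (dec_mono r2r1 Hh gs rs).
  by rewrite (dec_mono r2p Hm gs rs) (dec_mono r2p Hn gs rs).
have [r [rq [h [Ch Hh]]]] := H q qp; have rp := cle_trans rq qp.
exists r; split=> //; exists (@ground ty1 h); split; first by apply: fr_ground; right.
split; first exact/(cantorE r _ h).
move=> q' q'r; exists q'; split=> //; exists 0; split=> // s gs rs.
have q'p := cle_trans q'r rp.
rewrite codeE (dec_mono q'p Hm gs rs) (dec_mono q'p Hn gs rs).
exact: (dec_mono q'r Hh gs rs).
Qed.

Lemma valid_NCC : valid NCC.
Proof.
move=> p p1 p1p Y YY p2 p2p1 H p3 p3p2.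
(* Both m and h are ground and the value is decided by the relation, so these requirements suit
   [fusion]. *)
pose D n r := exists m (h : Fty ty1), cantorM (M := full) h /\
  dec (t := ty0) r (napp Y (@ground ty1 (fcode h m n))) 0.
have FY q : cle q p1 -> genv q (Y .: nil_env name) (Y .: nil_env name).
  by move=> qp1; apply: genv_scons; [exact: fr_mono YY|exact: genv_nil].
have gr0 r (k : nat) : fr r (@ground ty0 k) (@ground ty0 k) by apply: fr_ground; left.
have [n r s rs [m [h [Ch Hh]]]|n q qp3|r [rp3 Hr]] := @fusion D p3.
- by exists m, h; split=> // s' gs' ss'; apply: Hh => // x k /rs/ss'.
- have qp2 := cle_trans qp3 p3p2; have qp1 := cle_trans qp2 p2p1.
  have [r [rq [a [aa Ha]]]] := H q qp2 (@ground ty0 n) (gr0 q n) q (cle_refl q).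
  have [r1 [m [r1r Hm]]] := low_dense (or_introl eq_refl) aa.
  have F1 : genv r1 (a .: (@ground ty0 n .: (Y .: nil_env name)))
      (a .: (@ground ty0 n .: (Y .: nil_env name))).
    apply: genv_scons; first exact: fr_mono aa.
    by apply: genv_scons => //; apply: FY; apply: cle_trans qp1; exact: cle_trans r1r rq.
  have /(force_NCC_matrix x2 (n := x1) (m := x0) (n0 := n) F1 Hm) := @force_mono _ (NCC_matrix x2 x1 x0) _ _ _ r1r Ha.
  move=> /(_ (fun s gs rs => eq_refl) r1 (cle_refl _))[r2 [r2r1 [h [Ch Hh]]]].
  exists r2; split; last by exists m, h.
  by apply: cle_trans rq; exact: cle_trans r2r1 r1r.
pose g n := epsilon (inhabits 0) (fun m => exists h : Fty ty1, cantorM (M := full) h /\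
  dec (t := ty0) (crel r) (napp Y (@ground ty1 (fcode h m n))) 0).
have Hg n := epsilon_spec (inhabits 0) (fun m => exists h : Fty ty1, cantorM (M := full) h /\
  dec (t := ty0) (crel r) (napp Y (@ground ty1 (fcode h m n))) 0) (Hr n).
exists r; split=> //; exists (@ground ty1 g); split; first by apply: fr_ground; right.
move=> q qr a aa; apply: (@force_dense _ (NCC_matrix x2 x0 (x1 @ x0))) => q' q'q.
have [r' [n [r'q' Hn]]] := low_dense (or_introl eq_refl) (fr_mono q'q aa).
have r'r : cle r' r by apply: cle_trans qr; exact: cle_trans r'q' q'q.
exists r'; split=> //.
have F' : genv r' (a .: (@ground ty1 g .: (Y .: nil_env name)))
    (a .: (@ground ty1 g .: (Y .: nil_env name))).
  apply: genv_scons; first by apply: fr_mono aa; exact: cle_trans r'q' q'q.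
  apply: genv_scons; first by apply: fr_ground; right.
  by apply: FY; apply: cle_trans p2p1; apply: cle_trans p3p2; exact: cle_trans r'r rp3.
apply/(force_NCC_matrix x2 (n := x0) (m := x1 @ x0) (m0 := g n) (n0 := n) F') => //.
  by move=> s gs rs; rewrite /nev /= (Hn s gs rs).
move=> q1 q1r'; exists q1; split=> //; have [h [Ch Hh]] := Hg n.
by exists h; split=> //; apply: dec_mono Hh; exact: cle_trans q1r' r'r.
Qed.

(** * The generic injection *)

Definition freal (f : nat -> nat) : Prop := in01M (M := full) f.
Definition feq (f g : nat -> nat) : Prop := eqRM (M := full) f g.

Definition cl (f : nat -> nat) : point := fun g => freal g /\ feq f g.

Lemma cl_eq f g : freal f -> freal g -> (cl f = cl g <-> feq f g).
Proof.
move=> f01 g01; have [fr _] := f01; have [gr _] := g01; split=> [E|fg].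
  have : cl g g by split=> //; exact: (eqRM_refl full_rca).
  by rewrite -E => -[].
apply: functional_extensionality => h; apply: propositional_extensionality.
split=> -[h01 H]; split=> //; have [hr _] := h01.
  by apply: (eqRM_trans full_rca gr hr _ H); exact: eqRM_sym.
exact: (eqRM_trans full_rca fr hr fg H).
Qed.

(** The value is arbitrary where the relation is undefined, but [extend_at] densely puts every class
    into the domain. Depending on [cl f] only makes it respect equality of reals. *)
Definition generic : name ty2 :=
  fun s f => epsilon (inhabits 0) (fun v => s (cl f) v).

Lemma generic_val s f v : good s -> s (cl f) v -> generic s f = v.
Proof.
move=> [fn _] sv; apply: (fn (cl f)) => //.
by apply: (epsilon_spec (inhabits 0) (fun v => s (cl f) v)); exists v.
Qed.

Lemma generic_dec r (x : name ty1) f : dec (crel r) x f ->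
  exists q n, cle q r /\ crel q (cl f) n /\ dec (t := ty0) (crel q) (napp generic x) n.
Proof.
move=> Hx; have [q [n [qr qn]]] := extend_at r (cl f); exists q, n; do !split=> //.
move=> s gs rs; rewrite /napp (dec_mono qr Hx gs rs).
by apply: generic_val => //; exact: rs.
Qed.

Lemma same_ground p (a b : name ty1) : fr p a b -> exists r (f : Fty ty1),
  cle r p /\ dec (crel r) a f /\ dec (crel r) b f.
Proof.
move=> ab; have [r [f [rp Ha]]] := low_dense (or_intror eq_refl) (fr_left ab).
have [r' [g [r'r Hb]]] := low_dense (or_intror eq_refl) (fr_left (fr_sym (fr_mono rp ab))).
have E : g = f.
  apply: functional_extensionality => i.
  have ab' := fr_mono (cle_trans r'r rp) ab.
  have [r3 [r3r' [m [K1 K2]]]] := ab' r' (cle_refl _) _ _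
    (@fr_ground ty0 r' i (or_introl eq_refl)) r' (cle_refl _).
  have := dec_self K1; have := dec_self K2; rewrite /napp.
  rewrite (dec_self (dec_mono r3r' Hb)) (dec_self (dec_mono (cle_trans r3r' r'r) Ha)).
  by rewrite /ground => -> ->.
exists r', f; split; first exact: cle_trans r'r rp.
by split; [exact: dec_mono Ha|rewrite -E].
Qed.

Lemma fr_generic p : fr p generic generic.
Proof.
move=> q qp c d cd q' q'q.
have [r [f [rq' [Hc Hd]]]] := same_ground (@fr_mono ty1 _ _ c d q'q cd).
have [r' [n [r'r [rn Hn]]]] := generic_dec Hc.
exists r'; split; first exact: cle_trans r'r rq'.
exists n; split=> // s gs rs; rewrite -(Hn s gs rs) /napp.
by rewrite (dec_mono r'r Hd gs rs) (dec_mono r'r Hc gs rs).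
Qed.

Lemma not_forced_NIN p : ~ force p (nil_env name) NIN.
Proof.
move=> H0; have H := H0 p (cle_refl p) generic (@fr_generic p).
(* The environment contains the generic name, which is not ground. Absoluteness is therefore applied
   to [in01] and [eqR] as renamings of formulas whose variables all have type 1. *)
pose rn1 G (v : var G ty1) : ren [ty1] G := v .: nil_env (var G).
pose rn2 G (v w : var G ty1) : ren [ty1; ty1] G := v .: (w .: nil_env (var G)).
have low1 t (v : var [ty1] t) : low t.
  by elim/var_case: t / v => [|t v]; [right|elim/var_nil: t / v].
have low2 t (v : var [ty1; ty1] t) : low t.
  by elim/var_case: t / v => [|t v]; [right|exact: low1].
have in01E r G (F : env name G) (v : var G ty1) f : dec (crel r) (F _ v) f ->
    force r F (ren_fm (rn1 G v) (in01 x0)) <-> freal f.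
  move=> Hf; rewrite (@absolute_ren _ _ _ _ _ _ ((f : dom full ty1) .: nil_env Fty)) //.
  - by do !split; left.
  - by move=> t w; elim/var_case: t / w => // t w; elim/var_nil: t / w.
have eqRE r G (F : env name G) (v w : var G ty1) f g :
    dec (crel r) (F _ v) f -> dec (crel r) (F _ w) g ->
    force r F (ren_fm (rn2 G v w) (eqR x0 x1)) <-> feq f g.
  move=> Hf Hg; rewrite (@absolute_ren _ _ _ _ _ _
    ((f : dom full ty1) .: ((g : dom full ty1) .: nil_env Fty))) //.
  - exact: (sat_eqR full_rca ((f : dom full ty1) .: ((g : dom full ty1) .: nil_env Fty)) x0 x1).
  - by do !split; left.
  - move=> t u; elim/var_case: t / u => // t u; elim/var_case: t / u => // t u.
    by elim/var_nil: t / u.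
have Hfun : force p (generic .: nil_env name) (fun01 x0).
  move=> q qp x xx q1 q1q y yy q2 q2q1 x01 q3 q3q2 y01 q4 q4q3 xy.
  set F := y .: _ in x01 y01 xy |- *.
  apply: (@fr_dense ty0) => q5 q5q4.
  have q52 : cle q5 q2 by apply: cle_trans q3q2; exact: cle_trans q5q4 q4q3.
  have q51 := cle_trans q52 q2q1.
  have [r [f [rq5 Hx]]] := low_dense (or_intror eq_refl) (fr_mono (cle_trans q51 q1q) xx).
  have [r1 [g [r1r Hy]]] := low_dense (or_intror eq_refl)
    (fr_mono (cle_trans rq5 q51) yy).
  have {}Hx := dec_mono r1r Hx; have r1q5 := cle_trans r1r rq5.
  have {}x01 : freal f.
    apply/(in01E r1 _ F (vs vz) f Hx).
    by apply: (force_mono (A := in01 x1)) x01; exact: cle_trans r1q5 q52.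
  have {}y01 : freal g.
    apply/(in01E r1 _ F vz g Hy); apply: (force_mono (A := in01 x0)) y01.
    by apply: cle_trans r1q5 _; exact: cle_trans q5q4 q4q3.
  have {}xy : cl f = cl g.
    apply/(cl_eq x01 y01)/(eqRE r1 _ F (vs vz) vz f g Hx Hy).
    by apply: (force_mono (A := eqR x1 x0)) xy; exact: cle_trans r1q5 q5q4.
  have [r2 [n [r2r1 [rn Hn]]]] := generic_dec Hx.
  exists r2; split; first exact: cle_trans r2r1 r1q5.
  move=> r3 r3r2; exists r3; split=> //; exists n; split; first exact: dec_mono Hn.
  move=> s gs rs; rewrite /nev /= (dec_mono (cle_trans r3r2 r2r1) Hy gs rs).
  by apply: generic_val => //; rewrite -xy; apply: rs; apply: (proj1 r3r2).
have [q [qp [x [xx Hx]]]] := H p (cle_refl p) Hfun p (cle_refl p).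
have [q1 [q1q [y [yy [x01 [y01 [nxy Exy]]]]]]] := Hx q (cle_refl q).
set F := y .: _ in x01 y01 nxy Exy.
have [r [f [rq1 Hf]]] := low_dense (or_intror eq_refl) (fr_mono q1q xx).
have [r1 [g [r1r Hg]]] := low_dense (or_intror eq_refl) (fr_mono rq1 yy).
have {}Hf := dec_mono r1r Hf; have r1q1 := cle_trans r1r rq1.
have {}x01 : freal f.
  by apply/(in01E r1 _ F (vs vz) f Hf); exact: (force_mono (A := in01 x1)) x01.
have {}y01 : freal g.
  by apply/(in01E r1 _ F vz g Hg); exact: (force_mono (A := in01 x0)) y01.
have [r2 [n [r2r1 [rn Hn]]]] := generic_dec Hf.
have [r3 [m [r3r2 [rm Hm]]]] := generic_dec (dec_mono r2r1 Hg).
have r3q1 : cle r3 q1 by apply: cle_trans r1q1; exact: cle_trans r3r2 r2r1.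
have [r4 [r4r3 [k [K1 K2]]]] := Exy r3 r3q1.
(* The forced equation identifies the two decided values; injectivity of the condition then
   identifies the classes, against the forced inequality of the reals. *)
have Enm : n = m.
  have <- : k = n.
    by rewrite -(dec_self K1) -(dec_self (dec_mono (cle_trans r4r3 r3r2) Hn)).
  by rewrite -(dec_self K2) -(dec_self (dec_mono r4r3 Hm)).
have Ecl : cl f = cl g.
  have [_ [ij _]] := cgood r3; apply: (ij _ _ n); first exact: (proj1 r3r2).
  by rewrite Enm.
apply: (nxy r1 r1q1); apply/(eqRE r1 _ F (vs vz) vz f g Hf Hg).
exact/cl_eq.
Qed.

Theorem NCC_not_NIN : ~ proves (extend Z2w NCC) NIN.
Proof.
move=> H; have g0 : good (fun _ _ => False).
  split; [by []|split; [by []|move=> k; exists k]].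
  by split; [exact: le_n|move=> x []].
pose p := @Cond _ g0 [] (fun _ _ _ x => x).
apply: (@not_forced_NIN p); apply: (forcing_sound _ H); [|exact: genv_nil|by []].
move=> A [[k [_ [/valid_RCA0w //|->]]]|->]; first exact: valid_S_ax.
exact: valid_NCC.
Qed.

End Forcing.

Require Import Defs.

Theorem theorem3p30 :
  proves (extend RCA0w NCC) NBI /\ ~ proves (extend Z2w NCC) NIN.
Proof. exact: (conj Forcing.NCC_proves_NBI Forcing.NCC_not_NIN). Qed.
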